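(* Let $\omega\ge0$ and let $v:\mathbb{R}\to[1,\infty)$ be strongly admissible. Then: \begin{enumerate} \item[(a)] $\mathrm{H\ddot{o}r}^2_v(S_\omega)$ embeds continuously into $\mathrm{UC}_{\mathrm b}(\overline{S_\omega})$, the space of bounded uniformly continuous functions on $\overline{S_\omega}$ (each element extending continuously to $\overline{S_\omega}$). \item[(b)] For $\omega>0$, each $f\in\mathrm{H\ddot{o}r}^2_v(S_\omega)$ extends continuously to $\overline{S_\omega}$ and its boundary functions $f_{|\pm\omega}=f(\cdot\pm\mathrm{i}\omega)$ belong to $\mathrm{H\ddot{o}r}^2_v(\mathbb{R})$. Conversely, if $f\in\mathrm{H}^\infty(S_\omega)$ is such that its $L^\infty$-boundary values $f_{|\pm\omega}$ belong to $\mathrm{H\ddot{o}r}^2_v(\mathbb{R})$, then $f\in\mathrm{H\ddot{o}r}^2_v(S_\omega)$. Moreover \[\|f\|_{\mathrm{H\ddot{o}r}^2_v(S_\omega)}\simeq\|f_{|\omega}\|_{\mathrm{H\ddot{o}r}^2_v(\mathbb{R})}+\|f_{|-\omega}\|_{\mathrm{H\ddot{o}r}^2_v(\mathbb{R})}.\] \item[(c)] $\mathrm{H\ddot{o}r}^2_v(S_\omega)$ is (after a scaling of the norm) a Banach algebra with respect to pointwise multiplication. \item[(d)] Let $\theta>0$ and $\varphi\in\mathrm{H}^\infty_0(S_{\theta+\omega})$. Then for each $f\in\mathrm{H\ddot{o}r}^2_v(S_\omega)$, \[\varphi(0)\,f(z)=\int_{\mathbb{R}}(\tau_z\varphi\cdot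 f)^\vee(s)\,e^{-\mathrm{i}sz}\,ds\qquad(z\in S_\theta\cap\overline{S_\omega}).\] \end{enumerate}
   Context: $S_\omega=\{|\operatorname{Im}z|<\omega\}$ ($S_0=\mathbb{R}$); $(\tau_z\varphi)(w)=\varphi(w-z)$; $\hat g(t)=\int g(s)e^{-\mathrm{i}st}ds$, $g^\vee(t)=\frac1{2\pi}\int g(s)e^{\mathrm{i}st}ds$ (applied to the restriction to $\mathbb{R}$ for functions on strips). A measurable $v:\mathbb{R}\to(0,\infty)$ is admissible if $v\ge1$ and $\sup_{s,t}\frac{v(s+t)}{v(s)+v(t)}<\infty$, strongly admissible if also $1/v\in L^2(\mathbb{R})$. $\mathrm{W}^2_v(S_\omega)=\{\hat g:ve^{\omega|\cdot|}g\in L^2(\mathbb{R})\}$ with norm $\|ve^{\omega|\cdot|}g\|_2$ (for $\omega>0$, holomorphic functions $\int e^{-\mathrm{i}zs}g(s)ds$ on $S_\omega$). With $G(z)=e^{-z^2}$ and $\tau_tf=f(\cdot-t)$, $\mathrm{H\ddot{o}r}^2_v(S_\omega)$ is the space of functions $f$ on $S_\omega$ with $\tau_tG\cdot f\in\mathrm{W}^2_v(S_\omega)$ for all $t$ and norm $\sup_t\|\tau_tG\cdot f\|_{\mathrm{W}^2_v(S_\omega)}<\infty$; $\mathrm{H\ddot{o}r}^2_v(\mathbb{R})=\mathrm{H\ddot{o}r}^2_v(S_0)$. $\mathrm{H}^\infty_0(S_\theta)$: holomorphic $f$ on $S_\theta$ with $|f(z)|\lesssim(1+|\operatorname{Re}z|)^{-\alpha}$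 for all $\alpha>0$. $\mathrm{H}^\infty(S_\omega)$: bounded holomorphic functions on $S_\omega$. *)

(* Defs.v *)
(* MathComp + MathComp-Analysis (R : realType), complex numbers
   = R[i] from mathcomp-real-closed, viewed as a numFieldType (hence a
   normed module over itself, so that [derivable f z 1] is complex
   differentiability). *)
From mathcomp Require Import all_boot all_order all_algebra.
From mathcomp Require Import all_classical all_reals all_analysis.
From mathcomp.real_closed Require Import complex.
Import Order.TTheory GRing.Theory Num.Theory numFieldNormedType.Exports.

Set Implicit Arguments.
Unset Strict Implicit.
Unset Printing Implicit Defensive.

Local Open Scope classical_set_scope.
Local Open Scope ring_scope.

Definition Cplx (R : realType) : numFieldType := R[i].

Section Defs.
Context {R : realType}.
Local Notation C := (Cplx R).
Local Notation mu := (@lebesgue_measure R).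

Definition mkC (x y : R) : C := Complex x y.
Definition ofR (x : R) : C := mkC x 0.
Definition iC : C := mkC 0 1.
Definition reC (z : C) : R := complex.Re (z : R[i]).
Definition imC (z : C) : R := complex.Im (z : R[i]).

Definition cmod (z : C) : R := Num.sqrt (reC z ^+ 2 + imC z ^+ 2).

Definition cexp (u : C) : C :=
  ofR (expR (reC u)) * mkC (cos (imC u)) (sin (imC u)).

Definition gaussC (z : C) : C := cexp (- (z * z)).

Definition strip (w : R) : set C :=
  [set z | `|imC z| < w \/ (w = 0 /\ imC z = 0)].
Definition cl_strip (w : R) : set C := [set z | `|imC z| <= w].

Definition cint (h : R -> C) : C :=
  mkC (Rintegral mu setT (fun x => reC (h x)))
      (Rintegral mu setT (fun x => imC (h x))).

Definition cintegrable (h : R -> C) : Prop :=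
  mu.-integrable setT (fun x => (reC (h x))%:E) /\
  mu.-integrable setT (fun x => (imC (h x))%:E).

Definition cmeasurable (h : R -> C) : Prop :=
  measurable_fun setT (fun x => reC (h x)) /\
  measurable_fun setT (fun x => imC (h x)).

Definition isL2 (h : R -> C) : Prop :=
  cmeasurable h /\ (\int[mu]_x ((cmod (h x)) ^+ 2)%:E < +oo)%E.

Definition L2norm (h : R -> C) : R :=
  Num.sqrt (fine (\int[mu]_x ((cmod (h x)) ^+ 2)%:E)).

Definition admissible (v : R -> R) : Prop :=
  measurable_fun setT v /\ (forall s, 1 <= v s) /\
  exists K : R, forall s t, v (s + t) <= K * (v s + v t).

Definition strongly_admissible (v : R -> R) : Prop :=
  admissible v /\ (\int[mu]_s ((v s)^-1 ^+ 2)%:E < +oo)%E.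

Definition W2_rep (w : R) (v : R -> R) (f : C -> C) (g : R -> C) : Prop :=
  isL2 (fun s => ofR (v s * expR (w * `|s|)) * g s) /\
  forall z, strip w z -> f z = cint (fun s => cexp (- (iC * z * ofR s)) * g s).

Definition inW2 (w : R) (v : R -> R) (f : C -> C) : Prop :=
  exists g, W2_rep w v f g.

(* the norm ||v e^{w|.|} g||_2 (g is unique, so the infimum is attained
   by the unique representing function) *)
Definition normW2 (w : R) (v : R -> R) (f : C -> C) : R :=
  inf [set L2norm (fun s => ofR (v s * expR (w * `|s|)) * g s) | g in W2_rep w v f].

Definition locG (t : R) (f : C -> C) : C -> C :=
  fun z => gaussC (z - ofR t) * f z.

Definition inHor (w : R) (v : R -> R) (f : C -> C) : Prop :=
  (forall t, inW2 w v (locG t f)) /\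
  exists M : R, forall t, normW2 w v (locG t f) <= M.

Definition normHor (w : R) (v : R -> R) (f : C -> C) : R :=
  sup [set normW2 w v (locG t f) | t in [set: R]].

Definition holo_on (D : set C) (f : C -> C) : Prop :=
  forall z, D z -> derivable f z 1.

Definition Hinf (w : R) (f : C -> C) : Prop :=
  holo_on (strip w) f /\ exists M : R, forall z, strip w z -> cmod (f z) <= M.

Definition Hinf0 (th : R) (f : C -> C) : Prop :=
  holo_on (strip th) f /\
  forall a : R, 0 < a -> exists K : R, forall z, strip th z ->
    cmod (f z) <= K * (1 + `|reC z|) `^ (- a).

Definition cont_ext (w : R) (f F : C -> C) : Prop :=
  (forall z, strip w z -> F z = f z) /\ {within cl_strip w, continuous F}.

Definition UCb_on (A : set C) (F : C -> C) : Prop :=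
  (exists M : R, forall z, A z -> cmod (F z) <= M) /\
  forall e : R, 0 < e -> exists d : R, 0 < d /\
    forall z1 z2, A z1 -> A z2 -> cmod (z1 - z2) < d -> cmod (F z1 - F z2) < e.

Definition invFT (h : C -> C) (s : R) : C :=
  cint (fun x => ofR (2 * pi)^-1 * h (ofR x) * cexp (iC * ofR x * ofR s)).

End Defs.

(* Main.v *)
(* A function in Hor is studied through its localizations G(. - t) f, whose densities are the
   explicit inverse Fourier transforms of their restrictions to the real line.  Everything then
   reduces to convolution estimates in the weighted L^2 space: v is quasi-subadditive and 1/v is
   square integrable, so this space embeds in L^1(exp(w|s|)) and is a convolution algebra.
   The key step (holo_mul) bounds m f for a holomorphic m decaying like 1/(1 + (x - t)^2): write
   m f = c^-1 * int (m G(. - r)) (G(. - r) f) dr, where each m G(. - r) has an exponentially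
   decaying density by a shift of contour, and superpose with weights 1/(1 + (r - t)^2).
   This gives the product estimate (split G = G^(1/2) G^(1/2)) and the reproducing formula.
   On the boundary lines Im z = +-w, multiplication by G(. - t) turns densities into
   translates by 2w with factor exp(+-ws), so the two boundary norms control the density on the
   half-lines s >= 0 and s <= 0 respectively. *)
Require Import Defs.
From mathcomp Require Import all_boot all_order all_algebra.
From mathcomp Require Import all_classical all_reals all_analysis measurable_realfun.
From mathcomp.real_closed Require Import complex.
From mathcomp Require Import ring lra.
From HB Require Import structures.
Import Order.TTheory GRing.Theory Num.Theory numFieldNormedType.Exports.
Local Open Scope classical_set_scope.
Local Open Scope ring_scope.
Set Implicit Arguments.
Unset Strict Implicit.
Unset Printing Implicit Defensive.

(** * Complex exponential and modulus *)

(** Two obstacles shape the proof. [normW2] is an infimum over densities, and densities chosen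
    separately for each localization need not be measurable in the parameter, so they cannot be
    superposed. Fourier inversion removes this: it identifies every density almost everywhere with
    [invFT], which is jointly measurable in its parameters. Until then norms are handled through
    upper bounds carried by some density ([Horb]). The localizations G(. - r) f are moreover only
    bounded uniformly in r, so an integral over r needs an integrable weight; it comes from the
    decay of m together with two powers of decay of G. Quasi-subadditivity of v enters twice: in the
    convolution estimates, and because it keeps v below a constant times any growing exponential, so
    that an arbitrarily small widening of the strip pays for the weight. *)

Section ComplexBasics.
Context {R : realType}.
Implicit Types (z u : Cplx R) (x y : R).

Lemma reCD z u : reC (z + u) = reC z + reC u. Proof. by case: z u => [a b] [c d]. Qed.
Lemma imCD z u : imC (z + u) = imC z + imC u. Proof. by case: z u => [a b] [c d]. Qed.
Lemma reCN z : reC (- z) = - reC z. Proof. by case: z. Qed.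
Lemma imCN z : imC (- z) = - imC z. Proof. by case: z. Qed.
Lemma reCM z u : reC (z * u) = reC z * reC u - imC z * imC u.
Proof. by case: z u => [a b] [c d]. Qed.
Lemma imCM z u : imC (z * u) = reC z * imC u + imC z * reC u.
Proof. by case: z u => [a b] [c d]. Qed.
Lemma reC_mk x y : reC (mkC x y) = x. Proof. by []. Qed.
Lemma imC_mk x y : imC (mkC x y) = y. Proof. by []. Qed.
Lemma reC_of x : reC (ofR x) = x. Proof. by []. Qed.
Lemma imC_of x : imC (ofR x) = 0. Proof. by []. Qed.
Lemma reC_i : reC (iC : Cplx R) = 0. Proof. by []. Qed.
Lemma imC_i : imC (iC : Cplx R) = 1. Proof. by []. Qed.
Lemma reC0 : reC (0 : Cplx R) = 0. Proof. by []. Qed.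
Lemma imC0 : imC (0 : Cplx R) = 0. Proof. by []. Qed.
Lemma reC1 : reC (1 : Cplx R) = 1. Proof. by []. Qed.
Lemma imC1 : imC (1 : Cplx R) = 0. Proof. by []. Qed.
Definition reimE := (reCD, imCD, reCN, imCN, reCM, imCM, reC_mk, imC_mk,
  reC_of, imC_of, reC_i, imC_i, reC0, imC0, reC1, imC1).

Lemma eqC z u : reC z = reC u -> imC z = imC u -> z = u.
Proof. by case: z u => [a b] [c d] /= -> ->. Qed.

Lemma ofRD x y : ofR (x + y) = ofR x + ofR y. Proof. by apply: eqC; rewrite !reimE ?addr0. Qed.
Lemma ofRN x : ofR (- x) = - ofR x. Proof. by apply: eqC; rewrite !reimE ?oppr0. Qed.
Lemma ofRM x y : ofR (x * y) = ofR x * ofR y. Proof. by apply: eqC; rewrite !reimE; ring. Qed.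
Lemma ofR0 : ofR 0 = 0 :> Cplx R. Proof. by []. Qed.
Lemma ofR1 : ofR 1 = 1 :> Cplx R. Proof. by []. Qed.
Lemma mkCE x y : mkC x y = ofR x + iC * ofR y.
Proof. by apply: eqC; rewrite !reimE; ring. Qed.

Lemma normCE z : `|z| = ofR (cmod z).
Proof. by case: z => a b; rewrite normc_def. Qed.
Lemma ofR_le x y : ((ofR x : Cplx R) <= ofR y) = (x <= y).
Proof. by rewrite /ofR /mkC lecE /= eqxx. Qed.
Lemma ofR_lt x y : ((ofR x : Cplx R) < ofR y) = (x < y).
Proof. by rewrite /ofR /mkC ltcE /= eqxx. Qed.

Lemma cmod_ge0 z : 0 <= cmod z. Proof. exact: sqrtr_ge0. Qed.
Lemma cmodM z u : cmod (z * u) = cmod z * cmod u.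
Proof. by have := normrM z u; rewrite !normCE -ofRM => -[]. Qed.
Lemma cmodD z u : cmod (z + u) <= cmod z + cmod u.
Proof. by have := ler_normD z u; rewrite !normCE -ofRD ofR_le. Qed.
Lemma cmodN z : cmod (- z) = cmod z.
Proof. by have := normrN z; rewrite !normCE => -[]. Qed.
Lemma cmodB z u : cmod (z - u) = cmod (u - z).
Proof. by rewrite -cmodN opprB. Qed.
Lemma cmodBD z u : cmod (z - u) <= cmod z + cmod u.
Proof. by rewrite -(cmodN u) cmodD. Qed.
Lemma cmod_sub_abs z u : `|cmod z - cmod u| <= cmod (z - u).
Proof.
rewrite ler_norml; apply/andP; split.
  rewrite lerNl opprB lerBlDr cmodB; apply: le_trans (cmodD _ _); by rewrite subrK.
by rewrite lerBlDr; apply: le_trans (cmodD _ _); rewrite subrK.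
Qed.
Lemma cmod0 : cmod (0 : Cplx R) = 0.
Proof. by have := normr0 (Cplx R); rewrite normCE => -[]. Qed.
Lemma cmod1 : cmod (1 : Cplx R) = 1.
Proof. by have := normr1 (Cplx R); rewrite normCE => -[]. Qed.
Lemma cmod_eq0 z : cmod z = 0 -> z = 0.
Proof. by move=> h; apply/eqP; rewrite -normr_eq0 normCE h. Qed.
Lemma cmod_ofR x : cmod (ofR x) = `|x|.
Proof. by rewrite /cmod !reimE expr0n addr0 sqrtr_sqr. Qed.
Lemma cmod_i : cmod (iC : Cplx R) = 1.
Proof. by rewrite /cmod !reimE expr0n expr1n add0r sqrtr1. Qed.
Lemma cmodV z : cmod z^-1 = (cmod z)^-1.
Proof.
have [->|z0] := eqVneq z 0; first by rewrite invr0 cmod0 invr0.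
have c0 : cmod z != 0 by apply: contra_neq z0 => /cmod_eq0.
by apply: (mulfI c0); rewrite -cmodM !divff// cmod1.
Qed.
Lemma cmod_re z : `|reC z| <= cmod z.
Proof. by rewrite -sqrtr_sqr ler_wsqrtr// lerDl sqr_ge0. Qed.
Lemma cmod_im z : `|imC z| <= cmod z.
Proof. by rewrite -sqrtr_sqr ler_wsqrtr// lerDr sqr_ge0. Qed.
Lemma cmod_le_reim z : cmod z <= `|reC z| + `|imC z|.
Proof.
have -> : z = ofR (reC z) + iC * ofR (imC z) by rewrite -mkCE; case: z.
by apply: le_trans (cmodD _ _) _; rewrite cmodM cmod_i mul1r !cmod_ofR !reimE !(mul0r,mul1r,addr0,subr0,add0r).
Qed.

Lemma cexpD z u : cexp (z + u) = cexp z * cexp u.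
Proof. by rewrite /cexp !reimE expRD cosD sinD; apply: eqC; rewrite !reimE; ring. Qed.
Lemma reC_cexp z : reC (cexp z) = expR (reC z) * cos (imC z).
Proof. by rewrite /cexp !reimE mul0r subr0. Qed.
Lemma imC_cexp z : imC (cexp z) = expR (reC z) * sin (imC z).
Proof. by rewrite /cexp !reimE mul0r addr0. Qed.
Lemma cexp0 : cexp 0 = 1 :> Cplx R.
Proof. by rewrite /cexp !reimE expR0 cos0 sin0; apply: eqC; rewrite !reimE; ring. Qed.
Lemma cmod_cexp z : cmod (cexp z) = expR (reC z).
Proof.
rewrite cmodM cmod_ofR ger0_norm ?expR_ge0//.
by rewrite /cmod !reimE cos2Dsin2 sqrtr1 mulr1.
Qed.
Lemma cexp_neq0 z : cexp z != 0.
Proof.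
apply/eqP => h; have := cmod_cexp z; rewrite h cmod0 => e.
by have := expR_gt0 (reC z); rewrite -e ltxx.
Qed.
Lemma cexp_ofR x : cexp (ofR x) = ofR (expR x).
Proof. by rewrite /cexp !reimE cos0 sin0 mulr1. Qed.
Lemma gaussC_neq0 z : gaussC z != 0. Proof. exact: cexp_neq0. Qed.
Lemma cmod_gaussC z : cmod (gaussC z) = expR (imC z ^+ 2 - reC z ^+ 2).
Proof. by rewrite cmod_cexp !reimE; congr expR; ring. Qed.

(** The norm of [Cplx R] takes its values in [Cplx R], so the epsilons of the library are complex; a
    positive one has zero imaginary part. This reduces complex limits to estimates of the real
    number [cmod]. *)
Lemma cvgCP {T} (F : set_system T) {FF : Filter F} (f : T -> Cplx R) (l : Cplx R) :
  f x @[x --> F] --> l <-> cmod (f x - l) @[x --> F] --> (0:R).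
Proof.
split => [/cvgrPdist_lt h|/cvgrPdist_lt h].
  apply/cvgrPdist_lt => e e0; have := h (ofR e); rewrite -(ofR0) ofR_lt => /(_ e0).
  apply: filterS => x; rewrite normCE ofR_lt sub0r normrN ger0_norm ?cmod_ge0//.
  by rewrite cmodB.
apply/cvgrPdist_lt => e e0.
have e1 : e = ofR (reC e).
  by case: e e0 => a b; rewrite ltcE /= => /andP[/eqP -> _].
move: e0; rewrite e1 -ofR0 ofR_lt => /h; apply: filterS => x.
by rewrite sub0r normrN ger0_norm ?cmod_ge0// normCE ofR_lt cmodB.
Qed.

Lemma cvgC_reim {T} (F : set_system T) {FF : Filter F} (f : T -> Cplx R) (l : Cplx R) :
  f x @[x --> F] --> l <-> (reC (f x) @[x --> F] --> reC l /\ imC (f x) @[x --> F] --> imC l).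
Proof.
rewrite cvgCP; split => [/cvgrPdist_lt h|[/cvgrPdist_lt h1 /cvgrPdist_lt h2]].
  split; apply/cvgrPdist_lt => e /h; apply: filterS => x;
   rewrite sub0r normrN ger0_norm ?cmod_ge0// => /le_lt_trans; apply; rewrite cmodB.
     by rewrite -reCN -reCD cmod_re.
  by rewrite -imCN -imCD cmod_im.
apply/cvgrPdist_lt => e e0; have e2 : 0 < e / 2 by rewrite divr_gt0.
near=> x; rewrite sub0r normrN ger0_norm ?cmod_ge0// (le_lt_trans (cmod_le_reim _))//.
rewrite [e]splitr ltrD// !(reimE) distrC; near: x; [exact: h1|exact: h2].
Unshelve. all: by end_near. Qed.

Lemma continuous_reC : continuous (@reC R : Cplx R -> R).
Proof. by move=> z; have /cvgC_reim[] := @cvg_id _ (nbhs z). Qed.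
Lemma continuous_imC : continuous (@imC R : Cplx R -> R).
Proof. by move=> z; have /cvgC_reim[] := @cvg_id _ (nbhs z). Qed.
Lemma continuous_cmod : continuous (@cmod R : Cplx R -> R).
Proof.
move=> z; apply/(@cvgrPdist_lt _ R _ (nbhs z) (nbhs_filter z)) => e e0.
have h := (@cvgCP _ (nbhs z) (nbhs_filter z) id z).1 (@cvg_id _ (nbhs z)).
have := (@cvgrPdist_lt _ R _ (nbhs z) (nbhs_filter z) _ _).1 h e e0.
apply: (@filterS _ (nbhs z) (nbhs_filter z)) => x; rewrite sub0r normrN ger0_norm ?cmod_ge0//.
by apply: le_lt_trans; rewrite cmodB cmod_sub_abs.
Qed.
Lemma continuous_cexp : continuous (@cexp R : Cplx R -> Cplx R).
Proof.
move=> z; apply/(@cvgC_reim _ (nbhs z) (nbhs_filter z)).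
have e : expR (reC x) @[x --> z] --> expR (reC z).
  by apply: continuous_comp; [exact: continuous_reC|exact: continuous_expR].
have c : cos (imC x) @[x --> z] --> cos (imC z).
  by apply: continuous_comp; [exact: continuous_imC|exact: continuous_cos].
have s : sin (imC x) @[x --> z] --> sin (imC z).
  by apply: continuous_comp; [exact: continuous_imC|exact: continuous_sin].
split.
  have E : @reC R \o cexp = fun u => expR (reC u) * cos (imC u) by apply/funext => u; exact: reC_cexp.
  suff: (@reC R \o cexp) u @[u --> z] --> reC (cexp z) by [].
  by rewrite E reC_cexp; exact: (cvgM e c).
have E : @imC R \o cexp = fun u => expR (reC u) * sin (imC u) by apply/funext => u; exact: imC_cexp.
suff: (@imC R \o cexp) u @[u --> z] --> imC (cexp z) by [].
by rewrite E imC_cexp; exact: (cvgM e s).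
Qed.

End ComplexBasics.

(** * Complex-valued integration *)

Section Measurability.
Context {R : realType}.

(** [cmeasurable] over an arbitrary measurable domain, because Fubini and parameter integrals need
    it on products. *)
Definition cmeas d (T : measurableType d) (h : T -> Cplx R) : Prop :=
  measurable_fun setT (fun x => reC (h x)) /\ measurable_fun setT (fun x => imC (h x)).

Section gen.
Context d (T : measurableType d).
Implicit Types h g : T -> Cplx R.

Lemma cmeas_cst (c : Cplx R) : cmeas (fun _ : T => c).
Proof. by split; exact: measurable_cst. Qed.
Lemma cmeasD h g : cmeas h -> cmeas g -> cmeas (fun x => h x + g x).
Proof.
move=> [h1 h2] [g1 g2]; split.
  by under eq_fun do rewrite reCD; exact: measurable_funD.
by under eq_fun do rewrite imCD; exact: measurable_funD.
Qed.
Lemma cmeasN h : cmeas h -> cmeas (fun x => - h x).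
Proof.
move=> [h1 h2]; split.
  by under eq_fun do rewrite reCN; exact: measurableT_comp.
by under eq_fun do rewrite imCN; exact: measurableT_comp.
Qed.
Lemma cmeasB h g : cmeas h -> cmeas g -> cmeas (fun x => h x - g x).
Proof. by move=> mh mg; apply: cmeasD => //; exact: cmeasN. Qed.
Lemma cmeasM h g : cmeas h -> cmeas g -> cmeas (fun x => h x * g x).
Proof.
move=> [h1 h2] [g1 g2]; split.
  by under eq_fun do rewrite reCM; apply: measurable_funB; exact: measurable_funM.
by under eq_fun do rewrite imCM; apply: measurable_funD; exact: measurable_funM.
Qed.
Lemma cmeas_ofR (f : T -> R) : measurable_fun setT f -> cmeas (fun x => ofR (f x)).
Proof. by move=> mf; split => //; exact: measurable_cst. Qed.
Lemma measurable_cmod h : cmeas h -> measurable_fun setT (fun x => cmod (h x)).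
Proof.
move=> [h1 h2]; rewrite /cmod.
apply: (measurableT_comp (continuous_measurable_fun (@sqrt_continuous R))).
by apply: measurable_funD; exact: measurable_funX.
Qed.
Lemma cmeas_cexp h : cmeas h -> cmeas (fun x => cexp (h x)).
Proof.
move=> [h1 h2]; split.
  under eq_fun do rewrite reC_cexp; apply: measurable_funM.
    exact: measurableT_comp.
  by apply: (measurableT_comp _ h2); apply: continuous_measurable_fun; exact: continuous_cos.
under eq_fun do rewrite imC_cexp; apply: measurable_funM.
  exact: measurableT_comp.
by apply: (measurableT_comp _ h2); apply: continuous_measurable_fun; exact: continuous_sin.
Qed.
Lemma cmeas_gaussC h : cmeas h -> cmeas (fun x => gaussC (h x)).
Proof. by move=> mh; apply: cmeas_cexp; apply: cmeasN; exact: cmeasM. Qed.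
End gen.

Lemma cmeas_comp d1 d2 (T1 : measurableType d1) (T2 : measurableType d2)
  (h : T2 -> Cplx R) (p : T1 -> T2) :
  cmeas h -> measurable_fun setT p -> cmeas (fun x => h (p x)).
Proof. by move=> [h1 h2] mp; split; [exact: (measurableT_comp h1)|exact: (measurableT_comp h2)]. Qed.

Lemma continuous_cmeas (h : R -> Cplx R) : continuous h -> cmeas h.
Proof.
move=> ch; split; apply: continuous_measurable_fun => x.
  exact: (continuous_comp (ch x) (@continuous_reC R _)).
exact: (continuous_comp (ch x) (@continuous_imC R _)).
Qed.
End Measurability.

Section ComplexIntegral.
Context {R : realType}.
Notation mu := (@lebesgue_measure R).
Implicit Types h g : R -> Cplx R.

Lemma cintegrableP h :
  cintegrable h <-> cmeas h /\ mu.-integrable setT (EFin \o (fun x => cmod (h x))).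
Proof.
split=> [[i1 i2]|[mh ih]].
  have mh : cmeas h by split; apply/measurable_EFinP; [exact: measurable_int i1|exact: measurable_int i2].
  split => //; apply: (le_integrable measurableT _ _
    (integrableD measurableT (integrable_abse i1) (integrable_abse i2))).
    by apply/measurable_EFinP; exact: measurable_cmod.
  move=> x _ /=; rewrite lee_fin ger0_norm ?cmod_ge0// ger0_norm ?addr_ge0//.
  exact: cmod_le_reim.
split; apply: le_integrable ih => //.
- by apply/measurable_EFinP; case: mh.
- by move=> x _ /=; rewrite lee_fin (ger0_norm (cmod_ge0 _)) cmod_re.
- by apply/measurable_EFinP; case: mh.
- by move=> x _ /=; rewrite lee_fin (ger0_norm (cmod_ge0 _)) cmod_im.
Qed.

Lemma cintegrable_le h (b : R -> R) : cmeas h -> (forall x, cmod (h x) <= b x) ->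
  mu.-integrable setT (EFin \o b) -> cintegrable h.
Proof.
move=> mh hb ib; apply/cintegrableP; split => //; apply: le_integrable ib => //.
  by apply/measurable_EFinP; exact: measurable_cmod.
move=> x _ /=; rewrite lee_fin (ger0_norm (cmod_ge0 _)).
exact: le_trans (hb x) (ler_norm _).
Qed.

Lemma cintegrableD h g : cintegrable h -> cintegrable g -> cintegrable (fun x => h x + g x).
Proof.
move=> [h1 h2] [g1 g2]; split.
  by under eq_fun do rewrite reCD EFinD; exact: integrableD.
by under eq_fun do rewrite imCD EFinD; exact: integrableD.
Qed.

Lemma cintegrableZ (a : Cplx R) h : cintegrable h -> cintegrable (fun x => a * h x).
Proof.
move=> [h1 h2]; split.
  under eq_fun do rewrite reCM EFinB !EFinM.
  by apply: integrableB => //; exact: integrableZl.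
under eq_fun do rewrite imCM EFinD !EFinM.
by apply: integrableD => //; exact: integrableZl.
Qed.

Lemma cintD h g : cintegrable h -> cintegrable g ->
  cint (fun x => h x + g x) = cint h + cint g.
Proof.
move=> [h1 h2] [g1 g2]; apply: eqC; rewrite !reimE.
  by under eq_Rintegral do rewrite reCD; rewrite RintegralD.
by under eq_Rintegral do rewrite imCD; rewrite RintegralD.
Qed.

Lemma cintZ (a : Cplx R) h : cintegrable h -> cint (fun x => a * h x) = a * cint h.
Proof.
move=> [h1 h2]; have iZ (f : R -> R) c : mu.-integrable setT (EFin \o f) ->
    mu.-integrable setT (EFin \o (fun x => c * f x)).
  by move=> fi; rewrite /comp; under eq_fun do rewrite EFinM; exact: integrableZl.
apply: eqC; rewrite !reimE.
  under eq_Rintegral do rewrite reCM.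
  by rewrite RintegralB ?RintegralZl//; exact: iZ.
under eq_Rintegral do rewrite imCM.
by rewrite RintegralD ?RintegralZl//; exact: iZ.
Qed.

Lemma cintZr (a : Cplx R) h : cintegrable h -> cint (fun x => h x * a) = cint h * a.
Proof.
by move=> ih; rewrite mulrC -cintZ//; congr cint; apply/funext => x; rewrite mulrC.
Qed.

Lemma cintegrableN h : cintegrable h -> cintegrable (fun x => - h x).
Proof. by move=> ih; under eq_fun do rewrite -mulN1r; exact: cintegrableZ. Qed.
Lemma cintegrableB h g : cintegrable h -> cintegrable g -> cintegrable (fun x => h x - g x).
Proof. by move=> ih ig; apply: cintegrableD => //; exact: cintegrableN. Qed.

Lemma cintN h : cintegrable h -> cint (fun x => - h x) = - cint h.
Proof.
move=> ih; rewrite -mulN1r -cintZ//; congr cint.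
by apply/funext => x; rewrite mulN1r.
Qed.

Lemma cintB h g : cintegrable h -> cintegrable g ->
  cint (fun x => h x - g x) = cint h - cint g.
Proof. by move=> ih ig; rewrite cintD ?cintN//; exact: cintegrableN. Qed.

(* Multiply by the conjugate phase of the integral to reduce to real parts. *)
Lemma cmod_cint_le h : cintegrable h -> cmod (cint h) <= Rintegral mu setT (fun x => cmod (h x)).
Proof.
move=> ih; have [e0|n0] := eqVneq (cint h) 0.
  by rewrite e0 cmod0; apply: Rintegral_ge0 => x _; exact: cmod_ge0.
pose a := ofR (cmod (cint h)) / cint h.
have aE : a * cint h = ofR (cmod (cint h)) by rewrite /a divfK.
have am : cmod a = 1.
  rewrite /a cmodM cmodV cmod_ofR ger0_norm ?cmod_ge0// divff//.
  by apply: contra_neq n0 => /cmod_eq0.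
have -> : cmod (cint h) = reC (cint (fun x => a * h x)) by rewrite cintZ// aE.
have [i1 _] := cintegrableZ a ih; have [_ i2] := (cintegrableP h).1 ih.
apply: le_Rintegral => // x _; apply: le_trans (ler_norm _) _.
by apply: le_trans (cmod_re _) _; rewrite cmodM am mul1r.
Qed.

Lemma cmod_cint_dom h (b : R -> R) : cmeas h -> (forall x, cmod (h x) <= b x) ->
  mu.-integrable setT (EFin \o b) -> cmod (cint h) <= Rintegral mu setT b.
Proof.
move=> mh hb ib; have ih := cintegrable_le mh hb ib.
apply: le_trans (cmod_cint_le ih) _; have [_ i2] := (cintegrableP h).1 ih.
exact: le_Rintegral.
Qed.

Lemma ae_imp (P Q : R -> Prop) : (forall x, P x -> Q x) ->
  {ae mu, forall x, P x} -> {ae mu, forall x, Q x}.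
Proof. by move=> PQ h; apply: (@filterS _ _ (ae_filter_ringOfSetsType _)) h. Qed.

Lemma ae_imp2 (P1 P2 Q : R -> Prop) : (forall x, P1 x -> P2 x -> Q x) ->
  {ae mu, forall x, P1 x} -> {ae mu, forall x, P2 x} -> {ae mu, forall x, Q x}.
Proof. by move=> PQ h1 h2; apply: (@filterS2 _ _ (ae_filter_ringOfSetsType _)) h1 h2. Qed.

Lemma cint_ae h g : cmeas h -> cmeas g -> {ae mu, forall x, h x = g x} -> cint h = cint g.
Proof.
move=> [h1 h2] [g1 g2] hg; rewrite /cint /Rintegral; congr mkC; congr fine;
  apply: ae_eq_integral => //; try exact/measurable_EFinP.
  by apply: ae_imp hg => x /= -> _.
by apply: ae_imp hg => x /= -> _.
Qed.

(** Dominated convergence in each component. Measurability of the limit comes from convergence at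
    every point, and its integrability is part of the conclusion. *)
Lemma cint_dct (hn : nat -> R -> Cplx R) h (b : R -> R) :
  (forall n, cmeas (hn n)) -> (forall x, hn ^~ x @ \oo --> h x) ->
  (forall n x, cmod (hn n x) <= b x) -> mu.-integrable setT (EFin \o b) ->
  cintegrable h /\ cint (hn n) @[n --> \oo] --> cint h.
Proof.
move=> mhn cv hb ib.
have cre x : reC (hn n x) @[n --> \oo] --> reC (h x) by have /cvgC_reim[] := cv x.
have cim x : imC (hn n x) @[n --> \oo] --> imC (h x) by have /cvgC_reim[] := cv x.
have mh : cmeas h.
  split; apply/measurable_EFinP.
    apply: (emeasurable_fun_cvg (fun n x => (reC (hn n x))%:E)) => [n|x _].
      by apply/measurable_EFinP; case: (mhn n).
    by apply/cvg_EFin; [exact: nearW|exact: cre].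
  apply: (emeasurable_fun_cvg (fun n x => (imC (hn n x))%:E)) => [n|x _].
    by apply/measurable_EFinP; case: (mhn n).
  by apply/cvg_EFin; [exact: nearW|exact: cim].
have key (f : nat -> R -> R) (g : R -> R) : (forall n, measurable_fun setT (f n)) ->
    (forall x, f n x @[n --> \oo] --> g x) -> measurable_fun setT g ->
    (forall n x, `|f n x| <= b x) ->
    mu.-integrable setT (EFin \o g) /\
    Rintegral mu setT (f n) @[n --> \oo] --> Rintegral mu setT g.
  move=> mf cf mg fb.
  have mfE n : measurable_fun setT (fun x : R => (f n x)%:E) by apply/measurable_EFinP; exact: mf.
  have mgE : measurable_fun setT (EFin \o g) by exact/measurable_EFinP.
  have [] := @dominated_convergence _ _ _ mu _ measurableT (fun n x => (f n x)%:E)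
     (EFin \o g) (EFin \o b).
  - exact: mfE.
  - exact: mgE.
  - by apply: aeW => x _; apply/cvg_EFin; [exact: nearW|exact: cf].
  - by [].
  - by apply: aeW => x n _ /=; rewrite lee_fin.
  move=> ig _ cI; split => //; apply: fine_cvg.
  by rewrite fineK//; exact: integrable_fin_num.
have [r1 r2] := key _ _ (fun n => (mhn n).1) cre mh.1 (fun n x => le_trans (cmod_re _) (hb n x)).
have [i1 i2] := key _ _ (fun n => (mhn n).2) cim mh.2 (fun n x => le_trans (cmod_im _) (hb n x)).
by split; [split|apply/cvgC_reim].
Qed.

Lemma measurable_tonelli (f : R * R -> \bar R) : measurable_fun setT f ->
  (forall p, 0 <= f p)%E -> measurable_fun setT (fun x : R => \int[mu]_y f (x, y))%E.
Proof. by move=> mf f0; exact: (measurable_fun_fubini_tonelli_F (m2 := mu) f mf f0). Qed.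

Lemma tonelli (f : R * R -> \bar R) : measurable_fun setT f ->
  (forall p, 0 <= f p)%E ->
  (\int[mu]_x \int[mu]_y f (x, y) = \int[mu]_y \int[mu]_x f (x, y))%E.
Proof. by move=> mf f0; exact: (fubini_tonelli (m1 := mu) (m2 := mu) f mf f0). Qed.

Section Fubini.
Variable f : R * R -> R.
Hypothesis mf : measurable_fun setT f.
Hypothesis ioo : (\int[mu]_x \int[mu]_y (`|f (x, y)|)%:E < +oo)%E.

Definition swapf (p : R * R) := f (p.2, p.1).

Lemma measurable_swapf : measurable_fun setT swapf.
Proof.
apply: (measurableT_comp mf); apply: measurable_fun_pair; first exact: measurable_snd.
exact: measurable_fst.
Qed.

Let If : (mu \x mu)%E.-integrable setT (EFin \o f).
Proof. by apply/integrable12ltyP => //; exact/measurable_EFinP. Qed.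

Let Is : (mu \x mu)%E.-integrable setT (EFin \o swapf).
Proof.
have ms : measurable_fun setT (EFin \o swapf).
  by apply/measurable_EFinP; exact: measurable_swapf.
apply/(@integrable12ltyP _ _ _ _ _ mu mu _ ms); apply: le_lt_trans ioo.
have mn : measurable_fun setT (fun p => (`|f p|)%:E).
  by apply/measurable_EFinP; exact: measurableT_comp.
by rewrite (tonelli mn).
Qed.

(** [Rintegral] applies [fine] to the inner integral before integrating again, whereas Fubini in the
    library keeps extended values. An integrable function is finite almost everywhere, so [fine]
    changes no integral. *)
Let fine_int (F : R -> \bar R) : mu.-integrable setT F ->
  mu.-integrable setT (EFin \o (fine \o F)) /\
  (\int[mu]_x (fine (F x))%:E = \int[mu]_x F x)%E.
Proof.
move=> iF; have mF : measurable_fun setT F by exact: measurable_int iF.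
have mfF : measurable_fun setT (EFin \o (fine \o F)).
  by apply/measurable_EFinP; exact: measurableT_comp.
split.
  apply: le_integrable (iF) => // x _ /=; by case: (F x) => //=; rewrite normr0 leey.
have H : ae_eq mu setT (EFin \o (fine \o F)) F.
  have H0 : {ae mu, forall x : R, setT x -> F x \is a fin_num} by exact: integrable_ae.
  by apply: ae_imp H0 => y /= hy _; exact/fineK/hy.
exact: (@ae_eq_integral _ _ _ mu setT F _ measurableT mfF mF H).
Qed.

Lemma Rfubini : Rintegral mu setT (fun x => Rintegral mu setT (fun y => f (x, y))) =
   Rintegral mu setT (fun y => Rintegral mu setT (fun x => f (x, y))).
Proof.
rewrite {1}/Rintegral [in RHS]/Rintegral; congr fine.
rewrite (fine_int (integrable_fubini_F If)).2 (fine_int (integrable_fubini_F Is)).2.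
exact: Fubini.
Qed.
End Fubini.

Section CFubini.
Variable h : R -> R -> Cplx R.
Hypothesis mh : cmeas (fun p : R * R => h p.1 p.2).
Hypothesis ioo : (\int[mu]_x \int[mu]_y (cmod (h x y))%:E < +oo)%E.

Let iore (r : Cplx R -> R) : measurable_fun setT (fun p : R * R => r (h p.1 p.2)) ->
  (forall z, `|r z| <= cmod z) ->
  (\int[mu]_x \int[mu]_y (`|r (h x y)|)%:E < +oo)%E.
Proof.
move=> mr rc; apply: le_lt_trans ioo.
have m2 : measurable_fun setT (fun p : R * R => (cmod (h p.1 p.2))%:E).
  by apply/measurable_EFinP; exact: measurable_cmod.
have m1 : measurable_fun setT (fun p : R * R => (`|r (h p.1 p.2)|)%:E).
  by apply/measurable_EFinP; exact: measurableT_comp.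
apply: ge0_le_integral => //.
- by move=> x _; exact: integral_ge0.
- exact: (measurable_tonelli m1).
- by apply: (measurable_tonelli m2) => // p; rewrite lee_fin cmod_ge0.
- move=> x _; apply: ge0_le_integral => //.
  + exact: (measurableT_comp m1 (pair1_measurable x)).
  + exact: (measurableT_comp m2 (pair1_measurable x)).
  + by move=> y _; rewrite lee_fin.
Qed.

Let ire := iore mh.1 (@cmod_re R).
Let iim := iore mh.2 (@cmod_im R).

Lemma cfubini : cint (fun x => cint (h x)) = cint (fun y => cint (h ^~ y)).
Proof. by apply: eqC; [exact: (Rfubini mh.1 ire)|exact: (Rfubini mh.2 iim)]. Qed.
End CFubini.

(** The integrals of the positive and negative parts are measurable by Tonelli, infinite values
    included, and [fine] of their difference stays measurable. *)
Lemma cmeas_cint (h : R -> R -> Cplx R) : cmeas (fun p : R * R => h p.1 p.2) ->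
  cmeas (fun x => cint (h x)).
Proof.
have key (f : R -> R -> R) : measurable_fun setT (fun p : R * R => f p.1 p.2) ->
    measurable_fun setT (fun x => Rintegral mu setT (f x)).
  move=> mf; rewrite /Rintegral; apply: measurableT_comp => //.
  have mf' : measurable_fun setT (fun p : R * R => (f p.1 p.2)%:E) by exact/measurable_EFinP.
  under eq_fun do rewrite integralE.
  apply: emeasurable_funB.
    have H := measurable_tonelli (measurable_funepos mf').
    have {H} := H (fun p => funepos_ge0 (fun p : R * R => (f p.1 p.2)%:E) p).
    move=> H; refine (eq_ind _ _ H _ _); apply/funext => x; apply: eq_integral => y _.
    by rewrite !funeposE.
  have H := measurable_tonelli (measurable_funeneg mf').
  have {H} := H (fun p => funeneg_ge0 (fun p : R * R => (f p.1 p.2)%:E) p).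
  move=> H; refine (eq_ind _ _ H _ _); apply/funext => x; apply: eq_integral => y _.
  by rewrite !funenegE.
by move=> [h1 h2]; split; [exact: (key _ h1)|exact: (key _ h2)].
Qed.

(** The measure [c] times the image of Lebesgue measure under [x |-> c * x + d] gives each interval
    open on the left and closed on the right its length, hence is Lebesgue measure. *)
Lemma ge0_integral_affine (c d : R) (f : R -> \bar R) : 0 < c ->
  measurable_fun setT f -> (forall x, 0 <= f x)%E ->
  (\int[mu]_x f x = c%:E * \int[mu]_x f (c * x + d)%R)%E.
Proof.
move=> c0 mf f0.
pose phi : measurableTypeR R -> measurableTypeR R := fun x : R => c * x + d.
have mphi : @measurable_fun _ _ (measurableTypeR R) (measurableTypeR R) setT phi.
  by apply: measurable_funD => //; exact: measurable_funM.
pose nu0 := (mscale (NngNum (ltW c0)) (pushforward mu phi) : {measure set (measurableTypeR R) -> \bar R}).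
pose nu : {measure set (measurableTypeR R) -> \bar R} := nu0 mphi.
have E A : measurable A -> mu A = nu A.
  apply: (lebesgue_measure_unique (mu := nu)) => //= _ [[a b]] _ <-.
  rewrite /nu /= /mscale /= /pushforward /=.
  have -> : phi @^-1` [set` Interval (BRight a) (BRight b)] =
     [set` Interval (BRight ((a - d) / c)) (BRight ((b - d) / c))].
    apply/seteqP; split => x /=; rewrite !in_itv /= ltr_pdivrMr// ler_pdivlMr// ltrBlDr lerBrDr mulrC //.
  rewrite !lebesgue_measure_itv /= !lte_fin ltr_pM2r ?invr_gt0// ltrD2r.
  case: ifPn => // _; last by rewrite mule0.
  by rewrite -EFinM; congr EFin; field; rewrite gt_eqF.
transitivity (\int[nu]_x f x)%E.
  by apply: eq_measure_integral => A mA _; exact: E.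
rewrite ge0_integral_mscale//; congr (_ * _)%E.
by rewrite ge0_integral_pushforward.
Qed.

Lemma ge0_integralN (f : R -> \bar R) :
  measurable_fun setT f -> (forall x, 0 <= f x)%E ->
  (\int[mu]_x f x = \int[mu]_x f (- x)%R)%E.
Proof.
move=> mf f0; transitivity (\int[pushforward mu (-%R : R -> measurableTypeR R)]_x f x)%E.
  by apply: eq_measure_integral => A mA _; rewrite /= -lebesgue_measureN.
by rewrite ge0_integral_pushforward.
Qed.

End ComplexIntegral.

(** * Affine substitutions and the dominating function *)

Section ChangeOfVariable.
Context {R : realType}.
Notation mu := (@lebesgue_measure R).
Implicit Types h g : R -> Cplx R.

Lemma measurable_affine (c d : R) : measurable_fun setT (fun x : R => c * x + d).
Proof. by apply: measurable_funD => //; exact: measurable_funM. Qed.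

Lemma Rintegral_affine (c d : R) (f : R -> R) : 0 < c -> measurable_fun setT f ->
  Rintegral mu setT f = c * Rintegral mu setT (fun x => f (c * x + d)).
Proof.
move=> c0 mf.
have mfE : measurable_fun setT (EFin \o f) by exact/measurable_EFinP.
have ip := ge0_integral_affine d c0 (measurable_funepos mfE) (funepos_ge0 (EFin \o f)).
have im := ge0_integral_affine d c0 (measurable_funeneg mfE) (funeneg_ge0 (EFin \o f)).
rewrite /Rintegral integralE [X in _ = _ * fine X]integralE.
transitivity (fine (\int[mu]_x (EFin \o f)^\+ x - \int[mu]_x (EFin \o f)^\- x)%E) => //.
rewrite ip im -[c in RHS]/(fine c%:E).
set A := (\int[mu]_x _)%E; set B := (X in (_ - _ * X)%E).
have -> : (\int[mu]_x ((fun x : R => (f (c * x + d))%:E)^\+) x)%E = A.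
  by apply: eq_integral => x _; rewrite !funeposE.
have -> : (\int[mu]_x ((fun x : R => (f (c * x + d))%:E)^\-) x)%E = B.
  by apply: eq_integral => x _; rewrite !funenegE.
have : (0 <= A)%E by apply: integral_ge0 => x _; exact: funepos_ge0.
have : (0 <= B)%E by apply: integral_ge0 => x _; exact: funeneg_ge0.
(* Infinite values survive multiplication by [c > 0], and [fine] sends an infinite difference to 0
   on both sides. *)
case: A B => [a| |] [b| |] //= _ _; rewrite ?gt0_muley ?gt0_muleNy ?lte_fin//= ?mulr0//.
by rewrite mulrBr.
Qed.

Lemma cint_affine (c d : R) h : 0 < c -> cmeas h ->
  cint h = ofR c * cint (fun x => h (c * x + d)).
Proof.
move=> c0 [h1 h2]; apply: eqC; rewrite !reimE mul0r ?subr0 ?addr0;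
 exact: Rintegral_affine.
Qed.

Lemma cint_shift (d : R) h : cmeas h -> cint (fun x => h (x + d)) = cint h.
Proof.
move=> mh; rewrite (cint_affine d ltr01 mh) ofR1 mul1r; congr cint.
by apply/funext => x; rewrite mul1r.
Qed.

Lemma integrable_affine (c d : R) (f : R -> R) : 0 < c ->
  mu.-integrable setT (EFin \o f) -> mu.-integrable setT (EFin \o (fun x => f (c * x + d))).
Proof.
move=> c0 /integrableP[mf iF].
have mf' : measurable_fun setT f by exact/measurable_EFinP.
apply/integrableP; split.
  by apply/measurable_EFinP; apply: (measurableT_comp mf'); exact: measurable_affine.
have ma : measurable_fun setT (fun x : R => `|(EFin \o f) x|%E) by exact: measurableT_comp.
move: iF; rewrite (ge0_integral_affine d c0 ma) //.
set A := (\int[mu]_x _)%E => H.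
have A0 : (0 <= A)%E by exact: integral_ge0.
change (A < +oo)%E.
case: A H A0 => [r _ _|H _|//]; first exact: ltry.
by move: H; rewrite gt0_muley.
Qed.

Lemma Rintegral_opp (f : R -> R) : measurable_fun setT f ->
  Rintegral mu setT (fun x => f (- x)) = Rintegral mu setT f.
Proof.
move=> mf.
have mfE : measurable_fun setT (EFin \o f) by exact/measurable_EFinP.
rewrite /Rintegral; congr fine; rewrite integralE [RHS]integralE; congr (_ - _)%E.
  rewrite [RHS]ge0_integralN//; last exact: measurable_funepos.
  by apply: eq_integral => x _; rewrite !funeposE.
rewrite [RHS]ge0_integralN//; last exact: measurable_funeneg.
by apply: eq_integral => x _; rewrite !funenegE.
Qed.

Lemma cint_opp h : cmeas h -> cint (fun x => h (- x)) = cint h.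
Proof. by move=> [h1 h2]; apply: eqC; rewrite !reimE; exact: Rintegral_opp. Qed.

Lemma integrable_opp (f : R -> R) :
  mu.-integrable setT (EFin \o f) -> mu.-integrable setT (EFin \o (fun x => f (- x))).
Proof.
move=> /integrableP[mf iF].
have mf' : measurable_fun setT f by exact/measurable_EFinP.
apply/integrableP; split.
  by apply/measurable_EFinP; apply: (measurableT_comp mf').
have ma : measurable_fun setT (fun x : R => `|(EFin \o f) x|%E) by exact: measurableT_comp.
by move: iF; rewrite (ge0_integralN ma).
Qed.

Lemma cintegrable_opp h : cintegrable h -> cintegrable (fun x => h (- x)).
Proof. by move=> [h1 h2]; split; [exact: (integrable_opp h1)|exact: (integrable_opp h2)]. Qed.

(** The Cauchy kernel without its factor 1/pi: the common majorant of contour integrals, densities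
    and superposition weights. *)
Definition cauchyK (x : R) : R := (1 + x ^+ 2)^-1.

Lemma cauchyK_gt0 x : 0 < cauchyK x.
Proof. by rewrite invr_gt0 ltr_pwDl// sqr_ge0. Qed.
Lemma cauchyK_ge0 x : 0 <= cauchyK x. Proof. exact/ltW/cauchyK_gt0. Qed.

Lemma measurable_cauchyK : measurable_fun setT cauchyK.
Proof. by apply: continuous_measurable_fun; exact: continuous_oneDsqrV. Qed.

Lemma integrable_cauchyK : mu.-integrable setT (EFin \o cauchyK).
Proof.
apply/integrableP; split; first by apply/measurable_EFinP; exact: measurable_cauchyK.
have -> : (\int[mu]_x `|(EFin \o cauchyK) x| = \int[mu]_x (cauchyK x)%:E)%E.
  by apply: eq_integral => x _ /=; rewrite ger0_norm// cauchyK_ge0.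
rewrite ge0_symfun_integralT; [| | |].
- by rewrite -set_itvcy integral0y_oneDsqr -EFinM ltry.
- exact: cauchyK_ge0.
- exact: continuous_oneDsqrV.
- by move=> x; rewrite /cauchyK /= sqrrN.
Qed.

Lemma expRN_le_cauchyK (x : R) : expR (- x ^+ 2) <= cauchyK x.
Proof. by rewrite expRN /cauchyK lef_pV2 ?posrE ?expR_gt0 ?ltr_pwDl ?sqr_ge0// expR_ge1Dx. Qed.
End ChangeOfVariable.

(** * Goursat's theorem and contour shifts *)

Section SegmentIntegral.
Context {R : realType}.
Notation mu := (@lebesgue_measure R).
Implicit Types h g : R -> Cplx R.

(** The interval is half-open so that adjacent restrictions add up at every point, with no null set
    to discard. *)
Definition rst (a b : R) h : R -> Cplx R := fun x => if (a <= x) && (x < b) then h x else 0.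
Definition segint a b h := cint (rst a b h).

Lemma rst_indic a b h : rst a b h = fun x => ofR (\1_`[a, b[ x) * h x.
Proof.
apply/funext => x; rewrite /rst indicE; case: ifPn => H.
  by rewrite mem_set ?mul1r// /= in_itv.
by rewrite memNset ?mul0r// /= in_itv /=; apply/negP.
Qed.

Lemma cmeas_rst a b h : cmeas h -> cmeas (rst a b h).
Proof.
move=> mh; rewrite rst_indic; apply: cmeasM => //; apply: cmeas_ofR.
exact: measurable_indic.
Qed.

Lemma integrable_indic_co (a b : R) : mu.-integrable setT (EFin \o (\1_`[a, b[ : R -> R)).
Proof.
apply/integrableP; split; first by apply/measurable_EFinP; exact: measurable_indic.
have -> : (\int[mu]_x `|(EFin \o (\1_`[a, b[ : R -> R)) x| = \int[mu]_x (\1_`[a, b[ x)%:E)%E.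
  by apply: eq_integral => x _ /=; rewrite ger0_norm.
rewrite (_ : integral _ _ _ = mu `[a, b[%classic); last by rewrite integral_indic// setIT.
rewrite lebesgue_measure_itv /=; case: ifP => _; last exact: ltry.
by rewrite -EFinB ltry.
Qed.

Lemma Rintegral_indic_co (a b : R) : a <= b -> Rintegral mu setT (\1_`[a, b[ : R -> R) = b - a.
Proof.
move=> ab; rewrite /Rintegral (_ : integral _ _ _ = mu `[a, b[%classic); last first.
  by rewrite integral_indic// setIT.
rewrite lebesgue_measure_itv /= lte_fin.
by move: ab; rewrite le_eqVlt => /predU1P[->|->]; rewrite ?ltxx ?subrr.
Qed.

Lemma cintegrable_rst a b h : cintegrable h -> cintegrable (rst a b h).
Proof.
move=> /cintegrableP[mh ih]; apply: cintegrable_le ih; first exact: cmeas_rst.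
by move=> x; rewrite /rst; case: ifP => //; rewrite cmod0 cmod_ge0.
Qed.

Lemma cintegrable_rst_bnd a b h M : cmeas (rst a b h) -> (forall x, a <= x < b -> cmod (h x) <= M) ->
  cintegrable (rst a b h).
Proof.
move=> mh hM; apply: (@cintegrable_le _ _ (fun x => M * \1_`[a, b[ x) mh) => [x|].
  rewrite /rst indicE; case: ifPn => H; first by rewrite mem_set ?mulr1 ?hM//= in_itv.
  by rewrite memNset ?mulr0 ?cmod0// /= in_itv /=; apply/negP.
by rewrite /comp; under eq_fun do rewrite EFinM; apply: integrableZl => //; exact: integrable_indic_co.
Qed.

Lemma cmod_segint a b h M : a <= b -> cintegrable (rst a b h) ->
  (forall x, a <= x < b -> cmod (h x) <= M) -> cmod (segint a b h) <= M * (b - a).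
Proof.
move=> ab ih hM; rewrite -(Rintegral_indic_co ab) -RintegralZl//; last exact: integrable_indic_co.
apply: (@cmod_cint_dom _ _ (fun x => M * \1_`[a, b[ x)); first by have /cintegrableP[] := ih.
  move=> x; rewrite /rst indicE; case: ifPn => H; first by rewrite mem_set ?mulr1 ?hM//= in_itv.
  by rewrite memNset ?mulr0 ?cmod0// /= in_itv /=; apply/negP.
by rewrite /comp; under eq_fun do rewrite EFinM; apply: integrableZl => //; exact: integrable_indic_co.
Qed.

Lemma rst_split a m b h : a <= m -> m <= b -> rst a b h = fun x => rst a m h x + rst m b h x.
Proof.
move=> am mb; apply/funext => x; rewrite /rst.
case: (ltP x m) => xm /=.
  by rewrite (lt_le_trans xm mb) andbT addr0.
by rewrite (le_trans am xm) andbF add0r.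
Qed.

Lemma cintegrable_rst_sub a b c d h : a <= c -> d <= b -> cintegrable (rst a b h) ->
  cintegrable (rst c d h).
Proof.
move=> ac db /(cintegrable_rst c d); congr cintegrable; apply/funext => x; rewrite /rst.
case: ifP => // /andP[cx xd]; by rewrite (le_trans ac cx) (lt_le_trans xd db).
Qed.

Lemma segint_split a m b h : a <= m -> m <= b -> cintegrable (rst a b h) ->
  segint a b h = segint a m h + segint m b h.
Proof.
move=> am mb ih; rewrite /segint (rst_split h am mb) cintD//.
  exact: cintegrable_rst_sub ih.
exact: cintegrable_rst_sub ih.
Qed.

Lemma rstD a b h g : rst a b (fun x => h x + g x) = fun x => rst a b h x + rst a b g x.
Proof. by apply/funext => x; rewrite /rst; case: ifP; rewrite ?addr0. Qed.
Lemma rstZ a b c h : rst a b (fun x => c * h x) = fun x => c * rst a b h x.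
Proof. by apply/funext => x; rewrite /rst; case: ifP; rewrite ?mulr0. Qed.

Lemma cintegrable_rst_cst a b c : cintegrable (rst a b (fun=> c)).
Proof. by apply: cintegrable_rst_bnd (fun x _ => lexx (cmod c)); apply: cmeas_rst; exact: cmeas_cst. Qed.
Lemma cintegrable_rst_id a b : cintegrable (rst a b (fun x => ofR x)).
Proof.
apply: (@cintegrable_rst_bnd _ _ _ (`|a| + `|b|)).
  by apply: cmeas_rst; apply: cmeas_ofR.
move=> x /andP[ax xb]; rewrite cmod_ofR ler_norml; apply/andP; split.
  by have := ler_norm (- a); have := normr_ge0 b; rewrite normrN; lra.
by have := ler_norm b; have := normr_ge0 a; lra.
Qed.

Lemma segint_cst a b c : a <= b -> segint a b (fun=> c) = c * ofR (b - a).
Proof.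
move=> ab; rewrite /segint (_ : rst _ _ _ = fun x => c * ofR (\1_`[a, b[ x)).
  rewrite cintZ; last first.
    by split; [exact: integrable_indic_co|rewrite [X in integrable _ _ X](_ : _ = cst 0%E) //; exact: integrable0].
  congr (_ * _); apply: eqC; rewrite !reimE; first exact: Rintegral_indic_co.
  by rewrite Rintegral_cst// mul0r.
by rewrite rst_indic; apply/funext => x; rewrite mulrC.
Qed.

Lemma segint_affine a b (al be : Cplx R) : a <= b ->
  segint a b (fun x => al + be * ofR x) = al * ofR (b - a) + be * segint a b (fun x => ofR x).
Proof.
move=> ab; have i1 := cintegrable_rst_cst a b al; have i2 := cintegrableZ be (cintegrable_rst_id a b).
rewrite /segint rstD rstZ cintD// cintZ//; last exact: cintegrable_rst_id.
by rewrite -/(segint _ _ _) segint_cst.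
Qed.

Lemma cintegrable_rst_cont a b h : {within `[a, b], continuous h} -> cintegrable (rst a b h).
Proof.
have key (f : R -> R) : {within `[a, b], continuous f} ->
    mu.-integrable setT (EFin \o (fun x => if (a <= x) && (x < b) then f x else 0)).
  move=> cf; have ci : mu.-integrable `[a, b] (EFin \o f).
    by apply: continuous_compact_integrable => //; exact: segment_compact.
  have ci' : mu.-integrable `[a, b[ (EFin \o f).
    by apply: (integrableS _ _ _ ci) => //; exact: subset_itv_co_cc.
  have mab : measurable (`[a, b[%classic : set (measurableTypeR R)) by [].
  have := (@integrable_mkcond _ _ _ mu _ (EFin \o f) mab).1 ci'.
  congr (mu.-integrable _ _); apply/funext => x; rewrite /= /restrict /= patchE.
  have -> : (x \in `[a, b[%classic) = (a <= x < b).
    by apply/idP/idP; rewrite inE /= in_itv.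
  by case: ifP.
move=> ch; split.
  rewrite (_ : (fun x => _) = EFin \o (fun x => if (a <= x) && (x < b) then reC (h x) else 0)).
    by apply: key => x; exact: (continuous_comp (ch x) (@continuous_reC R _)).
  by apply/funext => x /=; rewrite /rst; case: ifP.
rewrite (_ : (fun x => _) = EFin \o (fun x => if (a <= x) && (x < b) then imC (h x) else 0)).
  by apply: key => x; exact: (continuous_comp (ch x) (@continuous_imC R _)).
by apply/funext => x /=; rewrite /rst; case: ifP.
Qed.

End SegmentIntegral.

Section ComplexDerivative.
Context {R : realType}.
Implicit Types (F : Cplx R -> Cplx R) (z u : Cplx R).

Lemma gt0_ofR (e : Cplx R) : 0 < e -> exists2 r : R, 0 < r & e = ofR r.
Proof.
case: e => a b; rewrite ltcE /= => /andP[/eqP -> a0]; by exists a.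
Qed.

Lemma nbhsCP z (P : set (Cplx R)) :
  nbhs z P <-> exists2 d : R, 0 < d & forall u, cmod (u - z) < d -> P u.
Proof.
split => [/nbhs_normP[e /= e0 eP]|[d d0 dP]].
  have [d d0 eE] := gt0_ofR e0; exists d => // u ud; apply: eP.
  by rewrite /ball_ /= normCE eE ofR_lt cmodB.
apply/nbhs_normP; exists (ofR d) => /=; first by rewrite -ofR0 ofR_lt.
by move=> u; rewrite /ball_ /= normCE ofR_lt cmodB; exact: dP.
Qed.

Lemma continuousCP F z : {for z, continuous F} <->
  forall e : R, 0 < e -> exists2 d : R, 0 < d & forall u, cmod (u - z) < d -> cmod (F u - F z) < e.
Proof.
split => [cF e e0|H].
  have /cF/nbhsCP[d d0 H] : nbhs (F z) [set u | cmod (u - F z) < e].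
    by apply/nbhsCP; exists e.
  by exists d.
move=> P /nbhsCP[e e0 eP]; apply/nbhsCP; have [d d0 dP] := H e e0.
by exists d => // u /dP/eP.
Qed.

Lemma derivableC_continuous F z : derivable F z 1 -> {for z, continuous F}.
Proof. by move=> /derivable1_diffP/differentiable_continuous. Qed.

(** Differentiability as a first-order expansion without quotient, the form that Goursat's argument
    consumes. *)
Lemma derivableC_approx F z : derivable F z 1 ->
  exists D : Cplx R, forall e : R, 0 < e -> exists2 d : R, 0 < d &
    forall u, cmod (u - z) < d -> cmod (F u - (F z + D * (u - z))) <= e * cmod (u - z).
Proof.
move=> /cvg_ex[D HD]; exists D => e e0.
have /HD/= : nbhs D [set u | cmod (u - D) < e] by apply/nbhsCP; exists e.
rewrite /nbhs /= /dnbhs /within /= => /nbhsCP[d d0 dP]; exists d => // u ud.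
have [->|uz] := eqVneq u z; first by rewrite subrr mulr0 addr0 subrr cmod0 mulr0.
have uz0 : u - z != 0 by rewrite subr_eq0.
have := dP (u - z); rewrite subr0 => /(_ ud uz0).
rewrite -[_%:A]/(_ * 1) mulr1 subrK => /ltW H.
have -> : F u - (F z + D * (u - z)) = ((u - z)^-1 *: (F u - F z) - D) * (u - z).
  by rewrite -[_ *: _]/(_ * _) mulrBl mulrAC mulVf// mul1r opprD addrA.
by rewrite cmodM ler_wpM2r// cmod_ge0.
Qed.

Lemma cmod_mkC_le (x y : R) : cmod (mkC x y) <= `|x| + `|y|.
Proof. exact: cmod_le_reim. Qed.

Lemma mkCB (x y x' y' : R) : mkC x y - mkC x' y' = mkC (x - x') (y - y').
Proof. by apply: eqC; rewrite !reimE. Qed.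

Lemma continuous_hline F (c x : R) : {for mkC x c, continuous F} ->
  {for x, continuous (fun x => F (mkC x c))}.
Proof.
move=> /continuousCP cF P /nbhsCP[e e0 eP]; have [d d0 dP] := cF e e0.
apply/nbhs_normP; exists d => //= t; rewrite /ball_ /= distrC => td.
apply: eP; apply: dP; rewrite mkCB subrr; apply: le_lt_trans td.
by rewrite (le_trans (cmod_mkC_le _ _))// normr0 addr0.
Qed.

Lemma continuous_vline F (c x : R) : {for mkC c x, continuous F} ->
  {for x, continuous (fun x => F (mkC c x))}.
Proof.
move=> /continuousCP cF P /nbhsCP[e e0 eP]; have [d d0 dP] := cF e e0.
apply/nbhs_normP; exists d => //= t; rewrite /ball_ /= distrC => td.
apply: eP; apply: dP; rewrite mkCB subrr; apply: le_lt_trans td.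
by rewrite (le_trans (cmod_mkC_le _ _))// normr0 add0r.
Qed.

End ComplexDerivative.

Section Goursat.
Context {R : realType}.
Variable F : Cplx R -> Cplx R.

(** The counterclockwise integral over the boundary of the rectangle with corners (a, c) and (b, d):
    bottom minus top, plus i times right minus left. *)
Definition rectint (a b c d : R) : Cplx R :=
  segint a b (fun x => F (mkC x c)) - segint a b (fun x => F (mkC x d))
  + iC * (segint c d (fun y => F (mkC b y)) - segint c d (fun y => F (mkC a y))).

Definition rect_holo (a b c d : R) :=
  forall x y, a <= x <= b -> c <= y <= d -> derivable F (mkC x y) 1.

Lemma rect_holo_sub a b c d a' b' c' d' : rect_holo a b c d ->
  a <= a' -> b' <= b -> c <= c' -> d' <= d -> rect_holo a' b' c' d'.
Proof.
move=> H aa bb cc dd x y /andP[ax xb] /andP[cy yd]; apply: H; apply/andP; split;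
 by [exact: le_trans ax|exact: le_trans bb|exact: le_trans cy|exact: le_trans dd].
Qed.

Lemma rect_holo_h a b c d y : rect_holo a b c d -> c <= y <= d ->
  cintegrable (rst a b (fun x => F (mkC x y))).
Proof.
move=> H yy; apply: cintegrable_rst_cont; apply: continuous_in_subspaceT => x.
rewrite inE /= in_itv /= => xx; apply: continuous_hline.
exact: derivableC_continuous (H _ _ xx yy).
Qed.

Lemma rect_holo_v a b c d x : rect_holo a b c d -> a <= x <= b ->
  cintegrable (rst c d (fun y => F (mkC x y))).
Proof.
move=> H xx; apply: cintegrable_rst_cont; apply: continuous_in_subspaceT => y.
rewrite inE /= in_itv /= => yy; apply: continuous_vline.
exact: derivableC_continuous (H _ _ xx yy).
Qed.

(** Sides shared by neighbouring pieces are traversed in opposite directions and cancel. *)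
Lemma rectint_split a m b c n d : a <= m -> m <= b -> c <= n -> n <= d -> rect_holo a b c d ->
  rectint a b c d = (rectint a m c n + rectint m b c n) + (rectint a m n d + rectint m b n d).
Proof.
move=> am mb cn nd H; have ab := le_trans am mb; have cd := le_trans cn nd.
rewrite /rectint.
rewrite (segint_split am mb (rect_holo_h H (y := c) _)) ?lexx//.
rewrite (segint_split am mb (rect_holo_h H (y := d) _)) ?lexx ?cd//.
rewrite (segint_split cn nd (rect_holo_v H (x := a) _)) ?lexx//.
rewrite (segint_split cn nd (rect_holo_v H (x := b) _)) ?lexx ?ab//.
by ring.
Qed.

End Goursat.

Section GoursatTheorem.
Context {R : realType}.
Variable F : Cplx R -> Cplx R.

(** On each side the integrand is affine in the real parameter. The integrals of the identity over
    opposite sides cancel, so their values are never computed. *)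
Lemma rectint_affine (al be : Cplx R) a b c d : a <= b -> c <= d ->
  rectint (fun z => al + be * z) a b c d = 0.
Proof.
move=> ab cd; rewrite /rectint.
have E1 y : (fun x => al + be * mkC x y) = (fun x => (al + be * iC * ofR y) + be * ofR x).
  by apply/funext => x; rewrite mkCE; ring.
have E2 x : (fun y => al + be * mkC x y) = (fun y => (al + be * ofR x) + (be * iC) * ofR y).
  by apply/funext => y; rewrite mkCE; ring.
by rewrite !E1 !E2 !segint_affine// !ofRD !ofRN; ring.
Qed.

(** Subtracting the affine function leaves the boundary integral unchanged by [rectint_affine]; what
    remains is at most [e] times the perimeter. *)
Lemma rectint_small al be a b c d e : a <= b -> c <= d -> rect_holo F a b c d ->
  (forall x y, a <= x <= b -> c <= y <= d ->
    cmod (F (mkC x y) - (al + be * mkC x y)) <= e) ->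
  cmod (rectint F a b c d) <= e * (2 * (b - a) + 2 * (d - c)).
Proof.
move=> ab cd H He.
have Ha : rect_holo (fun z => al + be * z) a b c d.
  by move=> x y _ _; apply: derivableD => //; apply: derivableM.
have sB (h g : R -> Cplx R) a' b' : cintegrable (rst a' b' h) -> cintegrable (rst a' b' g) ->
    cintegrable (rst a' b' (fun x => h x - g x)) /\
    segint a' b' (fun x => h x - g x) = segint a' b' h - segint a' b' g.
  move=> ih ig; have -> : rst a' b' (fun x => h x - g x) = fun x => rst a' b' h x - rst a' b' g x.
    by apply/funext => x; rewrite /rst; case: ifP; rewrite ?subr0.
  by rewrite /segint; split; [exact: cintegrableB|rewrite -cintB// ; congr cint;
    apply/funext => x; rewrite /rst; case: ifP; rewrite ?subr0].
have aa : a <= a <= b by rewrite lexx. have bb : a <= b <= b by rewrite lexx andbT.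
have cc : c <= c <= d by rewrite lexx. have dd : c <= d <= d by rewrite lexx andbT.
pose r z := F z - (al + be * z).
have [i1 e1] := sB _ _ _ _ (rect_holo_h H cc) (rect_holo_h Ha cc).
have [i2 e2] := sB _ _ _ _ (rect_holo_h H dd) (rect_holo_h Ha dd).
have [i3 e3] := sB _ _ _ _ (rect_holo_v H bb) (rect_holo_v Ha bb).
have [i4 e4] := sB _ _ _ _ (rect_holo_v H aa) (rect_holo_v Ha aa).
have -> : rectint F a b c d = rectint r a b c d.
  rewrite -[LHS]subr0 -(rectint_affine al be ab cd) /rectint e1 e2 e3 e4.
  move: (segint _ _ _) (segint _ _ _) (segint _ _ _) (segint _ _ _) (segint _ _ _)
    (segint _ _ _) (segint _ _ _) (segint _ _ _) => t1 t2 t3 t4 t5 t6 t7 t8; ring.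
have b1 : cmod (segint a b (fun x => r (mkC x c))) <= e * (b - a).
  by apply: cmod_segint => // x /andP[ax xb]; apply: He => //; rewrite ax ltW.
have b2 : cmod (segint a b (fun x => r (mkC x d))) <= e * (b - a).
  by apply: cmod_segint => // x /andP[ax xb]; apply: He => //; rewrite ax ltW.
have b3 : cmod (segint c d (fun y => r (mkC b y))) <= e * (d - c).
  by apply: cmod_segint => // x /andP[ax xb]; apply: He => //; rewrite ax ltW.
have b4 : cmod (segint c d (fun y => r (mkC a y))) <= e * (d - c).
  by apply: cmod_segint => // x /andP[ax xb]; apply: He => //; rewrite ax ltW.
apply: le_trans (cmodD _ _) _; rewrite cmodM cmod_i mul1r.
apply: le_trans (lerD (cmodBD _ _) (cmodBD _ _)) _.
have -> : e * (2 * (b - a) + 2 * (d - c)) = (e * (b - a) + e * (b - a)) + (e * (d - c) + e * (d - c)).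
  by ring.
exact: (lerD (lerD b1 b2) (lerD b3 b4)).
Qed.

Lemma nested_interval_point (l u : nat -> R) : (forall n, l n <= l n.+1) ->
  (forall n, u n.+1 <= u n) -> (forall n, l n <= u n) -> exists x, forall n, l n <= x <= u n.
Proof.
move=> hl hu lu.
have ml : {homo l : m n / (m <= n)%N >-> m <= n}.
  by apply: homo_leq => //; exact: le_trans.
have mu n m : (n <= m)%N -> u m <= u n.
  by elim: m => [|m IH]; [rewrite leqn0 => /eqP ->|rewrite leq_eqVlt => /predU1P[->//|/IH]; exact: le_trans].
have lun m n : l m <= u n.
  case: (leqP m n) => mn; first exact: le_trans (ml _ _ mn) (lu n).
  exact: le_trans (lu m) (mu _ _ (ltnW mn)).
exists (sup (range l)) => n; apply/andP; split.
  by apply: ub_le_sup; [exists (u 0%N) => _ [m _ <-]|exists n].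
by apply: ge_sup; [exists (l 0%N), 0%N|move=> _ [m _ <-]].
Qed.

Lemma quarter_real (B q1 q2 q3 q4 : R) : B <= (q1 + q2) + (q3 + q4) ->
  B <= 4 * q1 \/ B <= 4 * q2 \/ B <= 4 * q3 \/ B <= 4 * q4.
Proof.
move=> h; case: (leP B (4 * q1)) => h1; first by left.
case: (leP B (4 * q2)) => h2; first by right; left.
case: (leP B (4 * q3)) => h3; first by right; right; left.
by right; right; right; lra.
Qed.

(** The four quarters sum to the whole, so one of them carries at least a quarter of the modulus. *)
Lemma rectint_quarter x y L K : 0 <= L -> 0 <= K ->
  rect_holo F x (x + (L + L)) y (y + (K + K)) ->
  exists x' y', [/\ x' = x \/ x' = x + L, y' = y \/ y' = y + K &
    cmod (rectint F x (x + (L + L)) y (y + (K + K))) <=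
    4 * cmod (rectint F x' (x' + L) y' (y' + K))].
Proof.
move=> L0 K0 H.
have xL : x <= x + L by rewrite lerDl. have yK : y <= y + K by rewrite lerDl.
have xLL : x + L <= x + (L + L) by rewrite addrA lerDl.
have yKK : y + K <= y + (K + K) by rewrite addrA lerDl.
have sp := rectint_split xL xLL yK yKK H.
rewrite !(addrA x) !(addrA y) in sp *.
have h := cmodD (rectint F x (x + L) y (y + K) + rectint F (x + L) (x + L + L) y (y + K))
  (rectint F x (x + L) (y + K) (y + K + K) + rectint F (x + L) (x + L + L) (y + K) (y + K + K)).
rewrite -sp in h.
have /quarter_real := le_trans h (lerD (cmodD _ _) (cmodD _ _)).
case=> [h'|[h'|[h'|h']]].
- by exists x, y; split; [left|left|].
- by exists (x + L), y; split; [right|left|].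
- by exists x, (y + K); split; [left|right|].
- by exists (x + L), (y + K); split; [right|right|].
Qed.

Theorem goursat_rect a b c d : a <= b -> c <= d -> rect_holo F a b c d ->
  rectint F a b c d = 0.
Proof.
move=> ab cd H; pose L n := (b - a) / 2 ^+ n; pose K n := (d - c) / 2 ^+ n.
have L2 n : L n = L n.+1 + L n.+1 by rewrite /L exprS; field.
have K2 n : K n = K n.+1 + K n.+1 by rewrite /K exprS; field.
have L0 n : 0 <= L n by rewrite /L divr_ge0 ?subr_ge0 ?exprn_ge0.
have K0 n : 0 <= K n by rewrite /K divr_ge0 ?subr_ge0 ?exprn_ge0.
pose B n (p : R * R) := rectint F p.1 (p.1 + L n) p.2 (p.2 + K n).
pose Inv n (p : R * R) := [/\ a <= p.1, p.1 + L n <= b, c <= p.2, p.2 + K n <= d &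
   cmod (rectint F a b c d) <= 4 ^+ n * cmod (B n p)].
pose St n (p p' : R * R) := [/\ p.1 <= p'.1, p'.1 + L n.+1 <= p.1 + L n,
   p.2 <= p'.2 & p'.2 + K n.+1 <= p.2 + K n].
(* The invariant is a premise under the existential quantifier, so that [choice] yields a total map
   on indexed corners. *)
have step (np : nat * (R * R)) : exists p' : R * R, Inv np.1 np.2 ->
    Inv np.1.+1 p' /\ St np.1 np.2 p'.
  case: np => n [x y]; apply/not_existsP => nex.
  have /= hI : Inv n (x, y) by apply: contrapT => hn; apply: (nex (x, y)).
  case: (hI) => /= h1 h2 h3 h4 h5.
  have L1 := L0 n.+1; have K1 := K0 n.+1; have eL := L2 n; have eK := K2 n.
  have hs : rect_holo F x (x + (L n.+1 + L n.+1)) y (y + (K n.+1 + K n.+1)).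
    by rewrite -eL -eK; exact: rect_holo_sub H _ _ _ _.
  have [x' [y' [xx yy hB]]] := rectint_quarter L1 K1 hs.
  apply: (nex (x', y')) => _.
  have Sp : St n (x, y) (x', y').
    clear -eL eK L1 K1 xx yy; rewrite /St /= eL eK.
    by case: xx yy => [->|->] [->|->]; split; lra.
  split => //; case: Sp => /= s1 s2 s3 s4; split.
  - exact: le_trans h1 s1.
  - exact: le_trans s2 h2.
  - exact: le_trans h3 s3.
  - exact: le_trans s4 h4.
  - apply: le_trans h5 _; rewrite exprSr -mulrA ler_wpM2l ?exprn_ge0//.
    by rewrite /B /= eL eK.
have [f fP] := choice step.
pose p := fix p n := if n is m.+1 then f (m, p m) else (a, c).
have pI n : Inv n (p n).
  elim: n => [|n IH]; last by have [] := fP (n, p n) IH.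
  by rewrite /Inv /B /L /K /= expr0 !divr1 !subrKC !lexx mul1r.
have pS n : St n (p n) (p n.+1) by have [] := fP (n, p n) (pI n).
have [x0 x0P] := @nested_interval_point (fun n => (p n).1) (fun n => (p n).1 + L n)
  (fun n => let: And4 h _ _ _ := pS n in h) (fun n => let: And4 _ h _ _ := pS n in h)
  (fun n => ltac:(by rewrite lerDl)).
have [y0 y0P] := @nested_interval_point (fun n => (p n).2) (fun n => (p n).2 + K n)
  (fun n => let: And4 _ _ h _ := pS n in h) (fun n => let: And4 _ _ _ h := pS n in h)
  (fun n => ltac:(by rewrite lerDl)).
have z0h : derivable F (mkC x0 y0) 1.
  by apply: H; [have := x0P 0%N|have := y0P 0%N]; rewrite /L /K /= expr0 !divr1 !subrKC.
have [D HD] := derivableC_approx z0h.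
pose S := (b - a) + (d - c); have S0 : 0 <= S by rewrite addr_ge0// subr_ge0.
(* On the n-th rectangle the affine error is at most [e * (S / 2 ^+ n)] and the perimeter is
   [2 * S / 2 ^+ n]; the factor [4 ^+ n] of the invariant cancels both powers of 2. *)
have bound e : 0 < e -> cmod (rectint F a b c d) <= e * (2 * S ^+ 2).
  move=> e0; have [del del0 dP] := HD e e0.
  have [n nP] : exists n, S / 2 ^+ n < del.
    have := @cvg_geometric R S 2^-1; rewrite ger0_norm// => /(_ ltac:(lra)).
    move=> /cvgrPdist_lt/(_ _ del0)[N _ NP]; exists N; have := NP N (leqnn N).
    rewrite /geometric /= sub0r normrN; apply: le_lt_trans; rewrite exprVn; exact: ler_norm.
  have [h1 h2 h3 h4 h5] := pI n; apply: le_trans h5 _.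
  have near x y : (p n).1 <= x <= (p n).1 + L n -> (p n).2 <= y <= (p n).2 + K n ->
     cmod (mkC x y - mkC x0 y0) <= S / 2 ^+ n.
    move=> xx yy; rewrite mkCB; apply: le_trans (cmod_mkC_le _ _) _.
    have -> : S / 2 ^+ n = L n + K n by rewrite /S mulrDl.
    have /andP[? ?] := x0P n; have /andP[? ?] := y0P n.
    move: xx yy => /andP[? ?] /andP[? ?].
    by apply: lerD; rewrite ler_norml; apply/andP; split; lra.
  have small := @rectint_small (F (mkC x0 y0) - D * mkC x0 y0) D (p n).1 ((p n).1 + L n)
     (p n).2 ((p n).2 + K n) (e * (S / 2 ^+ n)).
  have : cmod (B n (p n)) <= e * (S / 2 ^+ n) * (2 * L n + 2 * K n).
    have eL : (p n).1 + L n - (p n).1 = L n by ring.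
    have eK : (p n).2 + K n - (p n).2 = K n by ring.
    rewrite eL eK in small.
    have a1 : (p n).1 <= (p n).1 + L n by rewrite lerDl.
    have a2 : (p n).2 <= (p n).2 + K n by rewrite lerDl.
    apply: (small a1 a2 (rect_holo_sub H h1 h2 h3 h4)) => x y xx yy; have nxy := near x y xx yy.
    have := dP (mkC x y) (le_lt_trans nxy nP).
    rewrite (_ : F (mkC x0 y0) + _ = F (mkC x0 y0) - D * mkC x0 y0 + D * mkC x y); last by ring.
    by move=> hh; apply: le_trans hh _; rewrite ler_wpM2l// ltW.
  have p2 : (2 ^+ n : R) != 0 by rewrite expf_neq0.
  move=> hB; apply: le_trans (ler_wpM2l _ hB) _; first by rewrite exprn_ge0.
  rewrite le_eqVlt; apply/orP; left; apply/eqP.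
  have -> : (4 : R) ^+ n = 2 ^+ n * 2 ^+ n by rewrite -exprMn; congr (_ ^+ _); ring.
  by rewrite /L /K /S; field.
apply: cmod_eq0; apply/eqP; rewrite eq_le cmod_ge0 andbT.
apply/ler_addgt0Pr => e e0; rewrite add0r.
(* The added 1 covers degenerate rectangles, for which [S] may be 0. *)
have S1 : 0 < 2 * S ^+ 2 + 1 by rewrite ltr_wpDl// mulr_ge0// sqr_ge0.
apply: le_trans (bound (e / (2 * S ^+ 2 + 1)) _) _; first by rewrite divr_gt0.
by rewrite mulrAC ler_pdivrMr// ler_pM2l// lerDl.
Qed.

End GoursatTheorem.

Lemma cvgC_unique (R : realType) (u : nat -> Cplx R) (l l' : Cplx R) :
  u n @[n --> \oo] --> l -> u n @[n --> \oo] --> l' -> l = l'.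
Proof. exact: norm_cvg_unique. Qed.

(** * Shift of horizontal contours *)

Section ContourShift.
Context {R : realType}.
Notation mu := (@lebesgue_measure R).
Variables (F : Cplx R -> Cplx R) (a K : R).
Hypothesis hF : forall x y, `|y| < a -> derivable F (mkC x y) 1.
Hypothesis bF : forall x y, `|y| < a -> cmod (F (mkC x y)) <= K * cauchyK x.

Lemma integrable_KcauchyK (k : R) : mu.-integrable setT (EFin \o (fun x => k * cauchyK x)).
Proof.
rewrite /comp; under eq_fun do rewrite EFinM.
by apply: integrableZl => //; exact: integrable_cauchyK.
Qed.

Lemma cvg_cauchyK_nat : cauchyK (n%:R : R) @[n --> \oo] --> (0 : R).
Proof.
apply: (@squeeze_cvgr _ _ _ _ (cst 0) (@harmonic R)).
- apply: nearW => n; rewrite cauchyK_ge0 /= /cauchyK /harmonic.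
  have q0 : 0 < 1 + (n%:R : R) ^+ 2 by rewrite ltr_pwDl// sqr_ge0.
  rewrite lef_pV2 ?posrE//.
  rewrite -natr1 addrC lerD2l -natrX ler_nat; case: n q0 => // n _.
  by rewrite expnS expn1 leq_pmull.
- exact: cvg_cst.
- exact: cvg_harmonic.
Qed.

Lemma cmeas_line y : `|y| < a -> cmeas (fun x => F (mkC x y)).
Proof.
move=> ya; apply: continuous_cmeas => x; apply: continuous_hline.
exact: (derivableC_continuous (@hF x y ya)).
Qed.

Lemma cintegrable_line y : `|y| < a -> cintegrable (fun x => F (mkC x y)).
Proof.
move=> ya; apply: (cintegrable_le (cmeas_line ya) (fun x => @bF x y ya)).
exact: integrable_KcauchyK.
Qed.

Lemma cvg_segint (h : R -> Cplx R) : cintegrable h ->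
  segint (- n%:R) n%:R h @[n --> \oo] --> cint h.
Proof.
move=> /cintegrableP[mh ih].
have [|x|n x|_ //] := @cint_dct _ (fun n => rst (- n%:R) n%:R h) h (fun x => cmod (h x)) _ _ _ ih.
- by move=> n; exact: cmeas_rst.
- apply: cvg_near_cst; have [N NP] : exists N : nat, `|x| < N%:R.
    by exists (Num.bound `|x|); rewrite archi_boundP.
  exists N => // n /= Nn; rewrite /rst.
  have : `|x| < n%:R by apply: lt_le_trans NP _; rewrite ler_nat.
  by rewrite ltr_norml => /andP[/ltW -> ->].
- by rewrite /rst; case: ifP => // _; rewrite cmod0 cmod_ge0.
Qed.

(** Goursat on the rectangle over [[-n, n]] between the two heights: each vertical side contributes
    at most [K * cauchyK n%:R * (y2 - y1)], which vanishes in the limit. *)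
Lemma contour_shift_le y1 y2 : y1 <= y2 -> `|y1| < a -> `|y2| < a ->
  cint (fun x => F (mkC x y1)) = cint (fun x => F (mkC x y2)).
Proof.
move=> y12 ya1 ya2.
have yy y : y1 <= y <= y2 -> `|y| < a.
  move: ya1 ya2; rewrite !ltr_norml => /andP[? ?] /andP[? ?] /andP[? ?].
  by apply/andP; split; lra.
have c1 := cvg_segint (cintegrable_line ya1).
have c2 := cvg_segint (cintegrable_line ya2).
apply/eqP; rewrite -subr_eq0; apply/eqP.
have c3 : segint (- n%:R) n%:R (fun x => F (mkC x y1)) - segint (- n%:R) n%:R (fun x => F (mkC x y2))
  @[n --> \oo] --> cint (fun x => F (mkC x y1)) - cint (fun x => F (mkC x y2)) by apply: (cvgB c1 c2).
apply: (cvgC_unique c3); apply/cvgCP.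
have rh n : rect_holo F (- n%:R) n%:R y1 y2.
  by move=> x y _ /yy; exact: hF.
have nn (n : nat) : (- n%:R : R) <= n%:R by rewrite -subr_ge0 opprK addr_ge0 ?ler0n.
have vb (n : nat) x : `|x| = n%:R -> cmod (segint y1 y2 (fun y => F (mkC x y))) <= K * cauchyK n%:R * (y2 - y1).
  move=> xn; apply: cmod_segint => //.
    apply: (@rect_holo_v _ F (- n%:R) n%:R); first exact: rh.
    by rewrite -ler_norml xn.
  move=> y /andP[h1 h2]; have := @bF x y (yy y _); rewrite h1 ltW// => /(_ isT).
  have -> // : cauchyK x = cauchyK n%:R.
  by rewrite /cauchyK -(real_normK (num_real x)) xn.
apply: (@squeeze_cvgr _ _ _ _ (cst 0) (fun n => (2 * K * (y2 - y1)) * cauchyK n%:R)).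
- apply: nearW => n; rewrite cmod_ge0 /=; change (cmod (segint (- n%:R) n%:R (fun x => F (mkC x y1)) -
    segint (- n%:R) n%:R (fun x => F (mkC x y2)) - 0) <= 2 * K * (y2 - y1) * cauchyK n%:R).
  have := goursat_rect (nn n) y12 (rh n); rewrite /rectint => /eqP.
  rewrite addr_eq0 subr0 => /eqP ->; rewrite cmodN cmodM cmod_i mul1r.
  apply: le_trans (cmodBD _ _) _.
  have b1 := vb n n%:R (ger0_norm (ler0n _ _)).
  have b2 := vb n (- n%:R) (etrans (normrN _) (ger0_norm (ler0n _ _))).
  apply: le_trans (lerD b1 b2) _; rewrite le_eqVlt; apply/orP; left; apply/eqP; ring.
- exact: cvg_cst.
- rewrite -[X in _ --> X](mulr0 (2 * K * (y2 - y1))).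
  by apply: cvgMr; exact: cvg_cauchyK_nat.
Qed.

Theorem contour_shift y1 y2 : `|y1| < a -> `|y2| < a ->
  cint (fun x => F (mkC x y1)) = cint (fun x => F (mkC x y2)).
Proof.
move=> h1 h2; case: (leP y1 y2) => [y12|/ltW y21]; first exact: contour_shift_le.
by apply/esym; exact: contour_shift_le.
Qed.
End ContourShift.

(** * Complex differentiability of the exponential *)

Section CexpDerivative.
Context {R : realType}.
Implicit Types z u : Cplx R.

Lemma real_deriv0_approx (f : R -> R) (D : R) : is_derive (0 : R) (1 : R) f D ->
  forall e, 0 < e -> exists2 d : R, 0 < d & forall x, `|x| < d -> `|f x - f 0 - D * x| <= e * `|x|.
Proof.
move=> [/cvg_ex[D' HD'] fD] e e0.
have DD : D' = D by rewrite -fD; apply/esym/cvg_lim.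
rewrite {}DD in HD'; move/cvgrPdist_lt/(_ _ e0) : HD'.
rewrite /nbhs /= /dnbhs /within /= => /nbhs_normP[d /= d0 dP]; exists d => // x xd.
have [->|x0] := eqVneq x 0; first by rewrite mulr0 subr0 subrr normr0 mulr0.
have := dP x; rewrite /ball_ /= sub0r normrN => /(_ xd x0).
rewrite -[_%:A]/(_ * 1) mulr1 addr0 => /ltW H.
have -> : f x - f 0 - D * x = (x^-1 * (f x - f 0) - D) * x.
  by rewrite mulrBl mulrAC mulVf// mul1r.
by rewrite normrM ler_wpM2r// distrC.
Qed.

(** Combines the real derivatives of exp, cos and sin at 0 componentwise; the functional equation
    [cexpD] then carries differentiability from 0 to every point. *)
Lemma cexp_approx0 (e : R) : 0 < e -> exists2 d : R, 0 < d &
  forall h : Cplx R, cmod h < d -> cmod (cexp h - 1 - h) <= e * cmod h.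
Proof.
(* With [c = cmod h < e1], the two components are at most [4 * e1 * c] and [3 * e1 * c + 2 * c * c],
   together at most [9 * e1 * c], which leaves slack below [12 * e1 * c]. The cap 1 gives [c <= 1],
   used for [|E| <= 3]. *)
move=> e0; pose e1 := Num.min (e / 12) 1.
have e10 : 0 < e1 by rewrite lt_min ltr01 andbT divr_gt0.
have e11 : e1 <= 1 by rewrite ge_min lexx orbT.
have e12 : 12 * e1 <= e by rewrite mulrC -ler_pdivlMr// ge_min lexx.
clearbody e1.
have [d1 d10 H1] := real_deriv0_approx (is_derive_expR (0:R)) e10.
have [d2 d20 H2] := real_deriv0_approx (is_derive_cos (0:R)) e10.
have [d3 d30 H3] := real_deriv0_approx (is_derive_sin (0:R)) e10.
exists (Num.min (Num.min d1 d2) (Num.min d3 e1)); first by rewrite !lt_min d10 d20 d30.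
move=> h; rewrite !lt_min => /andP[/andP[h1 h2] /andP[h3 h4]].
have re := cmod_re h; have im := cmod_im h.
have {}H1 := H1 _ (le_lt_trans re h1).
have {}H2 := H2 _ (le_lt_trans im h2).
have {}H3 := H3 _ (le_lt_trans im h3).
apply: le_trans (cmod_le_reim _) _.
rewrite !(reCD, reCN, imCD, imCN, reC1, imC1) reC_cexp imC_cexp subr0.
move: H1 H2 H3; rewrite expR0 cos0 sin0 oppr0 mul0r !subr0 !mul1r addr0.
move: re im; move: (reC h) (imC h) h4 (cmod_ge0 h) => a b.
move: (cmod h) => c h4 c0 ac bc.
set E := expR a; set Co := cos b; set Si := sin b => H1 H2 H3.
have e1a : e1 * `|a| <= e1 * c by rewrite ler_wpM2l// ltW.
have e1b : e1 * `|b| <= e1 * c by rewrite ler_wpM2l// ltW.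
have c1 : c <= 1 by exact: ltW (lt_le_trans h4 e11).
have a1 : e1 * c <= 1 by rewrite -[leRHS](mulr1 1); apply: ler_pM => //; exact: ltW.
have Eb : `|E - 1| <= 2 * c.
  have -> : E - 1 = (E - 1 - a) + a by ring.
  apply: le_trans (ler_normD _ _) _; have : e1 * c <= c by rewrite ler_piMl//. lra.
have E3 : `|E| <= 3.
  have -> : E = (E - 1) + 1 by ring.
  by apply: le_trans (ler_normD _ _) _; rewrite normr1; lra.
have T1 : `|E * Co - 1 - a| <= e1 * c + 3 * (e1 * c).
  have -> : E * Co - 1 - a = (E - 1 - a) + E * (Co - 1) by ring.
  apply: le_trans (ler_normD _ _) _; rewrite normrM; apply: lerD; first exact: le_trans H1 e1a.
  by apply: ler_pM => //; exact: le_trans H2 e1b.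
have T2 : `|E * Si - b| <= 3 * (e1 * c) + 2 * c * c.
  have -> : E * Si - b = E * (Si - b) + (E - 1) * b by ring.
  apply: le_trans (ler_normD _ _) _; rewrite !normrM; apply: lerD.
    by apply: ler_pM => //; exact: le_trans H3 e1b.
  by apply: ler_pM.
have cc : c * c <= e1 * c by rewrite ler_wpM2r// ltW.
have ee : 12 * (e1 * c) <= e * c by rewrite mulrA ler_wpM2r.
apply: le_trans (lerD T1 T2) _; nra.
Qed.

Lemma derivable_cexp z : derivable (@cexp R) z 1.
Proof.
apply/cvg_ex; exists (cexp z).
suff H : forall P, nbhs (cexp z) P -> \forall h \near (0 : Cplx R)^',
    P (h^-1 *: (cexp (h *: (1 : Cplx R) + z) - cexp z)) by exact: H.
move=> P /nbhsCP[e e0 eP].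
have M0 : 0 < cmod (cexp z) by rewrite cmod_cexp expR_gt0.
have e20 : 0 < e / (2 * cmod (cexp z)) by rewrite divr_gt0// mulr_gt0.
have [d d0 dP] := cexp_approx0 e20.
rewrite /nbhs /= /dnbhs /within /=; apply/nbhsCP; exists d => // h; rewrite subr0 => hd h0.
apply: eP; rewrite -[_ *: (_ - _)]/(_ * (_ - _)) -[h *: _]/(h * 1) mulr1 cexpD.
have -> : h^-1 * (cexp h * cexp z - cexp z) - cexp z = cexp z * (cexp h - 1 - h) * h^-1.
  by field.
rewrite (cmodM (cexp z * _)) (cmodM (cexp z)) cmodV; have hm : 0 < cmod h.
  by rewrite lt_neqAle cmod_ge0 andbT eq_sym; apply: contra_neq h0 => /cmod_eq0.
rewrite ltr_pdivrMr//; apply: le_lt_trans (ler_wpM2l (ltW M0) (dP h hd)) _.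
rewrite mulrA ltr_pM2r//.
have -> : cmod (cexp z) * (e / (2 * cmod (cexp z))) = e / 2.
  by move: (cmod (cexp z)) M0 => c c0; field; rewrite gt_eqF.
by rewrite ltr_pdivrMr// ltr_pMr// ltr1n.
Qed.

Lemma derivable_cexp_comp (p : Cplx R -> Cplx R) z : derivable p z 1 ->
  derivable (fun u => cexp (p u)) z 1.
Proof.
move=> /derivable1_diffP dp; apply/derivable1_diffP; apply: (differentiable_comp dp).
exact/derivable1_diffP/derivable_cexp.
Qed.

Lemma derivable_gaussC_comp (p : Cplx R -> Cplx R) z : derivable p z 1 ->
  derivable (fun u => gaussC (p u)) z 1.
Proof.
by move=> dp; apply: derivable_cexp_comp; apply: derivableN; exact: derivableM.
Qed.

End CexpDerivative.

(** * Fourier inversion *)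

Section FourierInversion.
Context {R : realType}.
Notation mu := (@lebesgue_measure R).
Implicit Types h g : R -> Cplx R.

Lemma cint_ofR (f : R -> R) : cint (fun x => ofR (f x)) = ofR (Rintegral mu setT f).
Proof.
apply: eqC; first by [].
by rewrite /cint imC_mk imC_of (@Rintegral_cst _ _ _ mu setT measurableT 0) mul0r.
Qed.

Lemma cintegrable_ofR (f : R -> R) : mu.-integrable setT (EFin \o f) -> cintegrable (fun x => ofR (f x)).
Proof. by move=> fi; split => //; exact: integrable0. Qed.

Lemma integrable_iter_dom (h : R -> R -> Cplx R) (A B : R -> R) :
  cmeas (fun p : R * R => h p.1 p.2) -> (forall x y, cmod (h x y) <= A x * B y) ->
  (forall x, 0 <= A x) -> mu.-integrable setT (EFin \o A) -> mu.-integrable setT (EFin \o B) ->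
  (\int[mu]_x \int[mu]_y (cmod (h x y))%:E < +oo)%E.
Proof.
move=> mh hAB A0 iA iB.
have mB : measurable_fun setT B by apply/measurable_EFinP; exact: measurable_int iB.
have mA : measurable_fun setT A by apply/measurable_EFinP; exact: measurable_int iA.
pose J := (\int[mu]_y `|(EFin \o B) y|)%E.
have Jfin : (J < +oo)%E by have /integrableP[] := iB.
have J0 : (0 <= J)%E by exact: integral_ge0.
have Jn : J \is a fin_num by rewrite ge0_fin_numE.
have mc : measurable_fun setT (fun p : R * R => (cmod (h p.1 p.2))%:E).
  by apply/measurable_EFinP; exact: measurable_cmod.
have mBa : measurable_fun setT (fun y : R => `|(EFin \o B) y|%E) by exact/measurableT_comp/measurable_EFinP.
apply: (@le_lt_trans _ _ (\int[mu]_x ((A x)%:E * J))%E).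
  apply: ge0_le_integral => //.
  - by move=> x _; apply: integral_ge0 => y _; rewrite lee_fin cmod_ge0.
  - by apply: (measurable_tonelli mc) => p; rewrite lee_fin cmod_ge0.
  - by apply: emeasurable_funM; [exact/measurable_EFinP|exact: measurable_cst].
  move=> x _; rewrite /J -ge0_integralZl//; last by rewrite lee_fin.
  apply: ge0_le_integral => //.
  - by move=> y _; rewrite lee_fin cmod_ge0.
  - exact: (measurableT_comp mc (pair1_measurable x)).
  - by apply: emeasurable_funM => //; exact: measurable_cst.
  - move=> y _ /=; rewrite lee_fin; apply: le_trans (hAB x y) _.
    by rewrite ler_wpM2l// ler_norm.
have -> : (\int[mu]_x ((A x)%:E * J) = \int[mu]_x ((fine J)%:E * (EFin \o A) x))%E.
  by apply: eq_integral => x _; rewrite fineK// muleC.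
have := integrable_fin_num measurableT (integrableZl measurableT (fine J) iA).
by rewrite fin_numElt => /andP[_].
Qed.

Lemma integrable_gauss : mu.-integrable setT (EFin \o (fun x : R => expR (- x ^+ 2))).
Proof. exact: integrableT_gauss. Qed.

Lemma Rintegral_gauss : Rintegral mu setT (fun x : R => expR (- x ^+ 2)) = Num.sqrt pi.
Proof. by have /(congr1 fine) := @integralT_gauss R. Qed.

Lemma gaussC_mk (x y : R) : gaussC (mkC x y) =
  ofR (expR (- x ^+ 2)) * cexp (iC * ofR x * ofR (- (2 * y))) * ofR (expR (y ^+ 2)).
Proof.
rewrite /gaussC -!cexp_ofR -!cexpD; congr cexp.
by apply: eqC; rewrite !reimE; ring.
Qed.

(** Completing the square is a contour shift: on the line of height [- (u / 2)] the Gaussian equals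
    the integrand times [expR (u ^+ 2 / 4)]. *)
Lemma gauss_FT (u : R) : cint (fun x => ofR (expR (- x ^+ 2)) * cexp (iC * ofR x * ofR u)) =
  ofR (Num.sqrt pi * expR (- (u ^+ 2 / 4))).
Proof.
(* Any half-width beyond [|u| / 2] would do. *)
pose a := `|u| / 2 + 1.
have hd x y : `|y| < a -> derivable (@gaussC R) (mkC x y) 1.
  by move=> _; exact: derivable_gaussC_comp.
have hb x y : `|y| < a -> cmod (gaussC (mkC x y)) <= expR (a ^+ 2) * cauchyK x.
  move=> ya; rewrite cmod_gaussC !reimE expRD ler_pM ?expR_ge0//.
    by rewrite ler_expR -(real_normK (num_real y)) ler_sqr ?nnegrE//; [exact: ltW|exact: le_trans (normr_ge0 _) (ltW ya)].
  exact: expRN_le_cauchyK.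
have a0 : `|0 : R| < a by rewrite normr0 /a; have := normr_ge0 u; lra.
have au : `|- (u / 2)| < a by rewrite normrN normrM (ger0_norm (_ : 0 <= 2^-1))// /a ltrDl.
have := contour_shift hd hb a0 au.
have -> : (fun x : R => gaussC (mkC x 0)) = fun x : R => ofR (expR (- x ^+ 2)).
  apply/funext => x; rewrite gaussC_mk mulr0 oppr0 expr0n expR0 ofR0 mulr0 cexp0 ofR1 !mulr1 //.
have -> : (fun x : R => gaussC (mkC x (- (u / 2)))) =
    fun x : R => (ofR (expR (- x ^+ 2)) * cexp (iC * ofR x * ofR u)) * ofR (expR (u ^+ 2 / 4)).
  apply/funext => x; rewrite gaussC_mk; congr (_ * cexp (_ * ofR _) * ofR (expR _)).
    by field.
  by field.
rewrite cint_ofR Rintegral_gauss cintZr; last first.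
  apply: (cintegrable_le _ _ integrable_gauss).
    apply: cmeasM; first exact: (cmeas_ofR (@measurable_gauss_fun R)).
    apply: cmeas_cexp; apply: cmeasM; last exact: cmeas_cst.
    by apply: cmeasM; [exact: cmeas_cst|exact: cmeas_ofR].
  move=> x; rewrite (cmodM (ofR _)) cmod_ofR cmod_cexp ger0_norm ?expR_ge0//.
  by rewrite !reimE !(mul0r, mulr0, mul1r, subr0, addr0) expR0 mulr1.
move=> E; rewrite ofRM E -mulrA -ofRM -expRD subrr expR0 ofR1 mulr1 //.
Qed.

Lemma cmeas_phase (u : R) : cmeas (fun x : R => cexp (iC * ofR x * ofR u)).
Proof.
apply: cmeas_cexp; apply: cmeasM; last exact: cmeas_cst.
by apply: cmeasM; [exact: cmeas_cst|exact: cmeas_ofR].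
Qed.

Lemma cmod_phase (x u : R) : cmod (cexp (iC * ofR x * ofR u)) = 1.
Proof. by rewrite cmod_cexp !reimE !(mul0r, mulr0, mul1r, subr0, addr0) expR0. Qed.

Lemma gauss_FT_scaled (k u : R) : 0 < k ->
  cint (fun x => ofR (expR (- (k * x) ^+ 2)) * cexp (iC * ofR x * ofR u)) =
  ofR (k^-1 * Num.sqrt pi * expR (- ((u / k) ^+ 2 / 4))).
Proof.
move=> k0; have kn : ofR k != 0 :> Cplx R by apply/eqP => /(congr1 (@reC R)) /= k0'; move: k0; rewrite k0' ltxx.
have m : cmeas (fun x : R => ofR (expR (- x ^+ 2)) * cexp (iC * ofR x * ofR (u / k))).
  by apply: cmeasM; [exact: (cmeas_ofR (@measurable_gauss_fun R))|exact: cmeas_phase].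
have := cint_affine 0 k0 m; rewrite gauss_FT => E.
apply: (mulfI kn); rewrite -ofRM !mulrA divff ?gt_eqF// mul1r E; congr (_ * cint _).
apply/funext => x; rewrite addr0; congr (_ * cexp _).
apply: eqC; rewrite !reimE; field; by rewrite gt_eqF.
Qed.

End FourierInversion.

(** * Functions whose integrals over all intervals vanish *)

Section ZeroAE.
Context {R : realType}.
Notation mu := (@lebesgue_measure R).

(** Lebesgue differentiation: the primitive of [f] truncated to [[-n, n[] is identically 0, and its
    derivative equals the truncated function almost everywhere. *)
Lemma real_ae0_of_interval (f : R -> R) :
  (forall a b, mu.-integrable setT (EFin \o (fun x => \1_`[a, b[ x * f x))) ->
  (forall a b, a <= b -> Rintegral mu setT (fun x => \1_`[a, b[ x * f x) = 0) ->
  {ae mu, forall x, f x = 0}.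
Proof.
move=> fi f0.
have H (n : nat) : {ae mu, forall x : R, `|x| < n%:R -> f x = 0}.
  pose fn x := \1_`[- n%:R, n%:R[ x * f x.
  have ifn : mu.-integrable setT (EFin \o fn) by exact: fi.
  have ify y : mu.-integrable `]-oo, y] (EFin \o fn).
    by apply: (integrableS _ _ _ ifn).
  have lf : locally_integrable setT fn by apply: open_integrable_locally => //; exact: openT.
  have F0 x : Rintegral mu `]-oo, x] fn = 0.
    have -> : Rintegral mu `]-oo, x] fn = Rintegral mu `]-oo, x[ fn.
      by rewrite -Rintegral_itv_bndo_bndc//; exact: (integrableS _ _ _ ifn).
    rewrite Rintegral_mkcond.
    case: (leP x (- n%:R)) => xn.
      rewrite (_ : _ \_ _ = cst 0); first by rewrite Rintegral_cst// mul0r.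
      apply/funext => y; rewrite /restrict /= patchE; case: ifPn => //; rewrite inE /= in_itv /= => yx.
      rewrite /fn indicE memNset ?mul0r//= in_itv /= => /andP[h _].
      by have := lt_le_trans yx xn; rewrite ltNge h.
    rewrite -[RHS](f0 (- n%:R) (Num.min x n%:R)); last first.
      by rewrite le_min (ltW xn) -subr_ge0 opprK addr_ge0 ?ler0n.
    congr Rintegral; apply/funext => y; rewrite /restrict /= patchE.
    have -> : (y \in `]-oo, x[%classic) = (y < x) by apply/idP/idP; rewrite inE /= in_itv.
    rewrite /fn !indicE; case: ifPn => yx.
      congr ((nat_of_bool _)%:R * _); apply/idP/idP; rewrite !inE /= !in_itv /= lt_min yx //.
    by rewrite memNset ?mul0r//= in_itv /= lt_min (negbTE yx) andbF.
  have := FTC1Ny ify lf; apply: ae_imp => x [_].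
  rewrite (_ : (fun _ => _) = cst 0); last by apply/funext => y; exact: F0.
  rewrite derive1_cst => /esym; rewrite /fn => h xn.
  move: h; rewrite indicE mem_set ?mul1r//= in_itv /=.
  by move: xn; rewrite ltr_norml => /andP[/ltW -> ->].
have := ae_foralln H; apply: ae_imp => x Hx.
by apply: (Hx (Num.bound `|x|)); exact: archi_boundP.
Qed.

Lemma cplx_ae0_of_interval (f : R -> Cplx R) :
  (forall a b, cintegrable (rst a b f)) ->
  (forall a b, a <= b -> segint a b f = 0) ->
  {ae mu, forall x, f x = 0}.
Proof.
move=> fi f0.
have h1 : {ae mu, forall x, reC (f x) = 0}.
  have E a b x : \1_`[a, b[ x * reC (f x) = reC (rst a b f x).
    by rewrite rst_indic reCM imC_of reC_of mul0r subr0.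
  apply: real_ae0_of_interval => a b.
    have [+ _] := fi a b; congr (mu.-integrable _ _); apply/funext => x /=.
    by rewrite E.
  move=> ab; have := congr1 (@reC R) (f0 a b ab); rewrite /segint /cint reC_mk reC0 => E0; rewrite -[RHS]E0.
  by congr Rintegral; apply/funext => x; rewrite E.
have h2 : {ae mu, forall x, imC (f x) = 0}.
  have E a b x : \1_`[a, b[ x * imC (f x) = imC (rst a b f x).
    by rewrite rst_indic imCM imC_of reC_of mul0r addr0.
  apply: real_ae0_of_interval => a b.
    have [_] := fi a b; congr (mu.-integrable _ _); apply/funext => x /=.
    by rewrite E.
  move=> ab; have := congr1 (@imC R) (f0 a b ab); rewrite /segint /cint imC_mk imC0 => E0; rewrite -[RHS]E0.
  by congr Rintegral; apply/funext => x; rewrite E.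
by apply: ae_imp2 h1 h2 => x r i; apply: eqC.
Qed.

Lemma ae_neq (a : R) : {ae mu, forall x, x <> a}.
Proof.
exists [set a]; split => //; first exact: lebesgue_measure_set1.
by move=> x /= /contrapT.
Qed.
End ZeroAE.

Lemma itv_perturb (R : realType) (a b p t : R) : `|t| < `|p - a| -> `|t| < `|p - b| ->
  (a <= t + p < b) = (a <= p < b).
Proof.
move=> ta tb; apply/idP/idP => /andP[h1 h2]; apply/andP; move: ta tb;
  case: (ler0P (p - a)) => ha; case: (ler0P (p - b)) => hb;
  rewrite !ltr_norml => /andP[? ?] /andP[? ?]; split; lra.
Qed.

(** * Inversion almost everywhere by Gaussian summation *)

Section Inversion.
Context {R : realType}.
Notation mu := (@lebesgue_measure R).
Variable g : R -> Cplx R.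
Hypothesis ig : cintegrable g.
Let h (x : R) := cint (fun s => cexp (- (iC * ofR x * ofR s)) * g s).
Hypothesis ih : cintegrable h.
Let q (s : R) := cint (fun x => h x * cexp (iC * ofR x * ofR s)).

Let mg : cmeas g. Proof. by have /cintegrableP[] := ig. Qed.
Let mh : cmeas h. Proof. by have /cintegrableP[] := ih. Qed.
Let ng : mu.-integrable setT (EFin \o (fun p => cmod (g p))).
Proof. by have /cintegrableP[] := ig. Qed.
Let nh : mu.-integrable setT (EFin \o (fun p => cmod (h p))).
Proof. by have /cintegrableP[] := ih. Qed.

(** [gs k] is the summability factor, tending to 1 as [k] tends to 0, and [N k] is its Fourier
    transform, an approximate identity of total mass 2 pi. *)
Let gs (k x : R) := expR (- (k * x) ^+ 2).
Let N (k u : R) := k^-1 * Num.sqrt pi * expR (- ((u / k) ^+ 2 / 4)).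

Lemma expRN_sqr_le1 (x : R) : expR (- x ^+ 2) <= 1.
Proof. by rewrite -expR0 ler_expR oppr_le0 sqr_ge0. Qed.

Let igs k : 0 < k -> mu.-integrable setT (EFin \o gs k).
Proof.
move=> k0; have := integrable_affine 0 k0 (@integrable_gauss R).
by congr (mu.-integrable _ _); apply/funext => x /=; rewrite addr0.
Qed.

Let mgs k : measurable_fun setT (gs k).
Proof.
apply: (measurableT_comp (@measurable_gauss_fun R)).
exact: measurable_funM.
Qed.

Let mN k : measurable_fun setT (N k).
Proof.
apply: measurable_funM => //; apply: measurableT_comp => //; apply: measurableT_comp => //.
by apply: measurable_funM => //; apply: measurable_funX; exact: measurable_funM.
Qed.

Let N_bound k u : 0 < k -> 0 <= N k u <= k^-1 * Num.sqrt pi.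
Proof.
move=> k0; have c0 : 0 <= k^-1 * Num.sqrt pi by apply: mulr_ge0; [rewrite invr_ge0 ltW|exact: sqrtr_ge0].
apply/andP; split; first by apply: mulr_ge0; [exact: c0|exact: expR_ge0].
apply: ler_piMr => //; rewrite -[leRHS]expR0 ler_expR oppr_le0 divr_ge0//; exact: sqr_ge0.
Qed.

Let cmeas_ph2 : cmeas (fun p : R * R => cexp (- (iC * ofR p.1 * ofR p.2))).
Proof.
apply: cmeas_cexp; apply: cmeasN; apply: cmeasM; last exact: cmeas_ofR.
by apply: cmeasM; [exact: cmeas_cst|exact: cmeas_ofR].
Qed.

Let J k s := cint (fun x => h x * cexp (iC * ofR x * ofR s) * ofR (gs k x)).

Let cmod_phN (x s : R) : cmod (cexp (- (iC * ofR x * ofR s))) = 1.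
Proof. by rewrite cmod_cexp !reimE !(mul0r, mulr0, mul1r, subr0, addr0, oppr0) expR0. Qed.

(** The Gaussian factor makes the double integral absolutely convergent, so Fubini turns the
    regularized inverse transform into the convolution of [g] with [N k]. *)
Let J_conv k s : 0 < k -> J k s = cint (fun p => g p * ofR (N k (s - p))).
Proof.
move=> k0.
pose H x p := cexp (- (iC * ofR x * ofR p)) * g p * (cexp (iC * ofR x * ofR s) * ofR (gs k x)).
have mH : cmeas (fun p : R * R => H p.1 p.2).
  apply: cmeasM; first by apply: cmeasM; [exact: cmeas_ph2|exact: (cmeas_comp mg)].
  apply: (@cmeas_comp _ _ _ _ _ (fun x => cexp (iC * ofR x * ofR s) * ofR (gs k x)) fst) => //.
  by apply: cmeasM; [exact: cmeas_phase|exact: (cmeas_ofR (mgs k))].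
have bH : (\int[mu]_x \int[mu]_y (cmod (H x y))%:E < +oo)%E.
  apply: (integrable_iter_dom mH (A := gs k) (B := fun p => cmod (g p))) => //.
  - move=> x y; rewrite /H (cmodM (cexp _ * _)) (cmodM (cexp _)) cmod_phN mul1r.
    by rewrite (cmodM (cexp _)) cmod_phase mul1r cmod_ofR ger0_norm ?expR_ge0// mulrC.
  - by move=> x; exact: expR_ge0.
  - exact: igs.
transitivity (cint (fun x => cint (H x))).
  congr cint; apply/funext => x; rewrite /H -mulrA cintZr//.
  apply: (cintegrable_le _ _ ng); first by apply: cmeasM => //; exact: (cmeas_comp cmeas_ph2 (pair1_measurable x)).
  by move=> y; rewrite (cmodM (cexp _)) cmod_phN mul1r.
rewrite (cfubini mH bH); congr cint; apply/funext => p.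
rewrite /N -gauss_FT_scaled// -cintZ; last first.
  apply: (cintegrable_le _ _ (igs k0)); first by apply: cmeasM; [exact: (cmeas_ofR (mgs k))|exact: cmeas_phase].
  by move=> x; rewrite (cmodM (ofR _)) cmod_phase mulr1 cmod_ofR ger0_norm ?expR_ge0.
congr cint; apply/funext => x; rewrite /H.
have -> : cexp (iC * ofR x * ofR (s - p)) = cexp (- (iC * ofR x * ofR p)) * cexp (iC * ofR x * ofR s).
  by rewrite -cexpD; congr cexp; rewrite ofRD ofRN; ring.
by rewrite /gs; ring.
Qed.

Section interval.
Variables a b : R.
Hypothesis ab : a <= b.
Let psi (s : R) : R := \1_`[a, b[ s.
Let Psi k p := Rintegral mu setT (fun s => psi s * N k (s - p)).

Let psi01 s : 0 <= psi s <= 1.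
Proof. by rewrite /psi indicE; case: (_ \in _) => /=; lra. Qed.
Let mpsi : measurable_fun setT psi. Proof. exact: measurable_indic. Qed.
Let ipsi : mu.-integrable setT (EFin \o psi). Proof. exact: integrable_indic_co. Qed.

(** The substitution [s = 2 * k * u + p] moves [k] from the kernel into the indicator, leaving a
    Gaussian majorant that does not depend on [k]. *)
Let Psi_E k p : 0 < k -> Psi k p =
  Rintegral mu setT (fun u => 2 * Num.sqrt pi * (psi (2 * k * u + p) * expR (- u ^+ 2))).
Proof.
move=> k0; have k20 : 0 < 2 * k by rewrite mulr_gt0.
rewrite /Psi (Rintegral_affine p k20); last first.
  apply: measurable_funM => //; apply: (measurableT_comp (mN k)); exact: measurable_funB.
have iu : mu.-integrable setT (EFin \o (fun u => psi (2 * k * u + p) * expR (- u ^+ 2))).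
  apply: le_integrable (@integrable_gauss R) => //.
    apply/measurable_EFinP; apply: measurable_funM; last exact: measurable_gauss_fun.
    by apply: (measurableT_comp mpsi); exact: measurable_affine.
  move=> u _ /=; rewrite lee_fin; have /andP[p0 p1] := psi01 (2 * k * u + p).
  by rewrite normrM ger0_norm// ler_piMl.
rewrite RintegralZl//.
have -> : (fun x => psi (2 * k * x + p) * N k (2 * k * x + p - p)) =
    fun x : R => (k^-1 * Num.sqrt pi) * (psi (2 * k * x + p) * expR (- x ^+ 2)).
  apply/funext => x; rewrite /N mulrCA; congr (_ * (_ * expR _)).
  by field; rewrite gt_eqF.
rewrite RintegralZl// !mulrA; congr (_ * _ * _).
by rewrite mulfK// gt_eqF.
Qed.

Let Psi_C k p : 0 < k -> ofR (Psi k p) =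
  cint (fun u => ofR (2 * Num.sqrt pi * (psi (2 * k * u + p) * expR (- u ^+ 2)))).
Proof. by move=> k0; rewrite Psi_E// cint_ofR. Qed.

Let iG : mu.-integrable setT (EFin \o (fun u : R => 2 * Num.sqrt pi * expR (- u ^+ 2))).
Proof.
rewrite /comp; under eq_fun do rewrite EFinM.
by apply: integrableZl => //; exact: integrable_gauss.
Qed.

Let mF k p : cmeas (fun u : R => ofR (2 * Num.sqrt pi * (psi (2 * k * u + p) * expR (- u ^+ 2)))).
Proof.
apply: cmeas_ofR; apply: measurable_funM => //; apply: measurable_funM; last exact: measurable_gauss_fun.
by apply: (measurableT_comp mpsi); exact: measurable_affine.
Qed.

Let bndF k p u : cmod (ofR (2 * Num.sqrt pi * (psi (2 * k * u + p) * expR (- u ^+ 2)))) <=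
  2 * Num.sqrt pi * expR (- u ^+ 2).
Proof.
have /andP[p0 p1] := psi01 (2 * k * u + p).
have s0 : 0 <= 2 * Num.sqrt (pi : R) by rewrite mulr_ge0 ?sqrtr_ge0.
rewrite cmod_ofR normrM (ger0_norm s0) ler_wpM2l// normrM ger0_norm//.
by rewrite (ger0_norm (expR_ge0 _)) ler_piMl// expR_ge0.
Qed.

Let Rint2pi : Rintegral mu setT (fun u : R => 2 * Num.sqrt pi * expR (- u ^+ 2)) = 2 * pi.
Proof.
rewrite RintegralZl//; last exact: integrable_gauss.
by rewrite Rintegral_gauss -mulrA -expr2 sqr_sqrtr// pi_ge0.
Qed.

Let Psi_bound k p : 0 < k -> cmod (ofR (Psi k p)) <= 2 * pi.
Proof.
move=> k0; rewrite Psi_C// -Rint2pi; apply: cmod_cint_dom; [exact: mF|exact: bndF|exact: iG].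
Qed.

Let kn (n : nat) : R := n.+1%:R^-1.
Let kn0 n : 0 < kn n. Proof. by rewrite invr_gt0. Qed.

(** For fixed [u], [2 * kn n * u + p] is eventually closer to [p] than both endpoints are, so the
    integrand of [Psi_E] is eventually constant in [n]. *)
Let Psi_lim p : p <> a -> p <> b -> ofR (Psi (kn n) p) @[n --> \oo] --> ofR (psi p * (2 * pi)).
Proof.
move=> pa pb.
have -> : ofR (psi p * (2 * pi)) = cint (fun u => ofR (psi p * (2 * Num.sqrt pi * expR (- u ^+ 2)))).
  by rewrite cint_ofR RintegralZl// Rint2pi.
rewrite (_ : (fun n => _) = fun n => cint (fun u =>
   ofR (2 * Num.sqrt pi * (psi (2 * kn n * u + p) * expR (- u ^+ 2))))); last first.
  by apply/funext => n; rewrite Psi_C.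
apply: (cint_dct _ _ (fun n u => bndF (kn n) p u) iG).2 => [n|u]; first exact: mF.
apply: cvg_near_cst.
pose d := Num.min `|p - a| `|p - b|.
have d0 : 0 < d by rewrite lt_min !normr_gt0 !subr_eq0; apply/andP; split; apply/eqP.
have : 2 * u * kn n @[n --> \oo] --> (0 : R).
  rewrite -[X in _ --> X](mulr0 (2 * u)); apply: cvgMr; exact: cvg_harmonic.
move=> /cvgrPdist_lt/(_ _ d0); apply: filterS => n; rewrite sub0r normrN => hn.
suff -> : psi (2 * kn n * u + p) = psi p by congr ofR; ring.
rewrite mulrAC; move: (2 * u * kn n) hn => t; rewrite lt_min /psi !indicE => /andP[ta tb].
congr (nat_of_bool _)%:R.
have E x : (x \in `[a, b[%classic) = (a <= x < b).
  by apply/idP/idP; rewrite inE /= in_itv.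
by rewrite !E itv_perturb.
Qed.

(** One number with two limits: [J] tends boundedly to [q], while Fubini moves the indicator onto
    the kernel and leaves [g] against [Psi]. Testing on intervals spares any pointwise convergence
    of the convolution with [g]. *)
Let T n := cint (fun s => ofR (psi s) * J (kn n) s).

Let psi_rst (f : R -> Cplx R) : (fun s => ofR (psi s) * f s) = rst a b f.
Proof. by rewrite rst_indic. Qed.

Let mJ k : cmeas (J k).
Proof.
apply: (@cmeas_cint _ (fun s x => h x * cexp (iC * ofR x * ofR s) * ofR (gs k x))).
apply: cmeasM; last exact: (cmeas_ofR (measurableT_comp (mgs k) measurable_snd)).
apply: cmeasM; first exact: (cmeas_comp mh measurable_snd).
apply: cmeas_cexp; apply: cmeasM; last exact: (cmeas_ofR measurable_fst).
by apply: cmeasM; [exact: cmeas_cst|exact: (cmeas_ofR measurable_snd)].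
Qed.

Let nJ k x s : cmod (h x * cexp (iC * ofR x * ofR s) * ofR (gs k x)) <= cmod (h x).
Proof.
rewrite (cmodM (h x * _)) (cmodM (h x)) cmod_phase mulr1 cmod_ofR ger0_norm ?expR_ge0//.
by rewrite ler_piMr ?cmod_ge0// expRN_sqr_le1.
Qed.

Let J_bound k s : cmod (J k s) <= Rintegral mu setT (fun x => cmod (h x)).
Proof.
apply: cmod_cint_dom => [|x|//]; last exact: nJ.
apply: cmeasM; last exact: (cmeas_ofR (mgs k)).
by apply: cmeasM => //; exact: cmeas_phase.
Qed.

Let J_lim s : J (kn n) s @[n --> \oo] --> q s.
Proof.
apply: (cint_dct _ _ (fun n x => nJ (kn n) x s) nh).2 => [n|x].
  apply: cmeasM; last exact: (cmeas_ofR (mgs _)).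
  by apply: cmeasM => //; exact: cmeas_phase.
rewrite -[X in _ --> X]mulr1; apply: cvgMr.
apply/cvgC_reim; split; last exact: cvg_cst.
rewrite reC1 -expR0.
have h0 : kn n * x @[n --> \oo] --> (0 : R).
  by rewrite -[X in _ --> X](mul0r x); apply: cvgMl; exact: cvg_harmonic.
have h1 : - (kn n * x) ^+ 2 @[n --> \oo] --> (0 : R).
  by rewrite -[X in _ --> X]oppr0 -[X in - X](mulr0 0); apply: cvgN; exact: (cvgM h0 h0).
exact: (cvg_comp _ _ h1 (@continuous_expR R 0)).
Qed.

Let T_lim1 : T n @[n --> \oo] --> segint a b q.
Proof.
rewrite /segint -psi_rst.
pose M := Rintegral mu setT (fun x => cmod (h x)).
apply: (@cint_dct _ (fun n s => ofR (psi s) * J (kn n) s) _ (fun s => M * psi s) _ _ _ _).2.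
- by move=> n; apply: cmeasM; [exact: cmeas_ofR|exact: mJ].
- by move=> s; apply: cvgMr; exact: J_lim.
- move=> n s; have /andP[p0 p1] := psi01 s.
  by rewrite (cmodM (ofR _)) cmod_ofR ger0_norm// mulrC ler_wpM2r//; exact: J_bound.
- by rewrite /comp; under eq_fun do rewrite EFinM; exact: integrableZl.
Qed.

Let T_E n : T n = cint (fun p => g p * ofR (Psi (kn n) p)).
Proof.
pose c := (kn n)^-1 * Num.sqrt pi.
pose H s p := ofR (psi s) * (g p * ofR (N (kn n) (s - p))).
have mNp : measurable_fun setT (fun p : R * R => N (kn n) (p.1 - p.2)).
  by apply: (measurableT_comp (mN _)); apply: measurable_funB.
have mH : cmeas (fun p : R * R => H p.1 p.2).
  apply: cmeasM; first exact: (cmeas_ofR (measurableT_comp mpsi measurable_fst)).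
  by apply: cmeasM; [exact: (cmeas_comp mg measurable_snd)|exact: cmeas_ofR].
have bg p s : cmod (g p * ofR (N (kn n) (s - p))) <= c * cmod (g p).
  have /andP[n0 n1] := N_bound (s - p) (kn0 n).
  by rewrite (cmodM (g p)) cmod_ofR ger0_norm// mulrC ler_wpM2r// cmod_ge0.
have icg : mu.-integrable setT (EFin \o (fun p => c * cmod (g p))).
  by rewrite /comp; under eq_fun do rewrite EFinM; exact: integrableZl.
have bH : (\int[mu]_x \int[mu]_y (cmod (H x y))%:E < +oo)%E.
  apply: (integrable_iter_dom mH (A := psi) (B := fun p => c * cmod (g p))) => //.
  move=> s p; have /andP[p0 p1] := psi01 s.
    by rewrite /H (cmodM (ofR _)) cmod_ofR ger0_norm// ler_wpM2l.
transitivity (cint (fun s => cint (H s))).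
  congr cint; apply/funext => s; rewrite J_conv// /H cintZ//.
  apply: (cintegrable_le _ (fun p => bg p s) icg); apply: cmeasM => //; apply: cmeas_ofR.
  by apply: (measurableT_comp (mN _)); exact: measurable_funB.
rewrite (cfubini mH bH); congr cint; apply/funext => p.
rewrite -cint_ofR -cintZ; last first.
  apply: cintegrable_ofR; apply: le_integrable (integrableZl measurableT c ipsi) => //.
    apply/measurable_EFinP; apply: measurable_funM => //.
    by apply: (measurableT_comp (mN _)); exact: measurable_funB.
  move=> s _ /=; rewrite lee_fin; have /andP[p0 p1] := psi01 s.
  have /andP[n0 n1] := N_bound (s - p) (kn0 n).
  rewrite (normrM (psi s) (N _ _)) (ger0_norm n0) (normrM c) mulrC ler_wpM2r//; exact: le_trans n1 (ler_norm _).
by congr cint; apply/funext => s; rewrite /H ofRM; ring.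
Qed.

Let T_lim2 : T n @[n --> \oo] --> ofR (2 * pi) * segint a b g.
Proof.
(* [Psi] is controlled in the limit only off the endpoints, while [cint_dct] asks for convergence
   everywhere; zeroing [g] at two points reconciles them. *)
pose g' p := if (p == a) || (p == b) then 0 else g p.
have gg' : {ae mu, forall p, g' p = g p}.
  by apply: ae_imp2 (ae_neq a) (ae_neq b) => p /eqP pa /eqP pb; rewrite /g' (negbTE pa) (negbTE pb).
have mg' : cmeas g'.
  rewrite (_ : g' = fun p => ofR (\1_(~` [set a; b]) p) * g p).
    by apply: cmeasM => //; apply: cmeas_ofR; apply: measurable_indic; apply: measurableC; apply: measurableU; exact: measurable_set1.
  apply/funext => p; rewrite /g' indicE; case: ifPn => hp.
    by rewrite memNset ?mul0r//= => /(_ _)[]; case/orP: hp => /eqP ->; [left|right].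
  rewrite mem_set ?mul1r//= => -[] E; move: hp; by rewrite E eqxx ?orbT.
have mPsi k : 0 < k -> cmeas (fun p => ofR (Psi k p)).
  move=> k0; rewrite (_ : (fun p => _) = fun p => cint (fun u =>
     ofR (2 * Num.sqrt pi * (psi (2 * k * u + p) * expR (- u ^+ 2))))); last first.
    by apply/funext => p; rewrite Psi_C.
  apply: cmeas_cint; apply: cmeas_ofR; apply: measurable_funM => //; apply: measurable_funM.
    apply: (measurableT_comp mpsi); apply: measurable_funD; last exact: measurable_fst.
    by apply: measurable_funM => //; exact: measurable_snd.
  exact: (measurableT_comp (@measurable_gauss_fun R) measurable_snd).
have igp : cintegrable (fun p => ofR (psi p) * g p) by rewrite psi_rst; exact: cintegrable_rst.
rewrite (_ : T = fun n => cint (fun p => g' p * ofR (Psi (kn n) p))); last first.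
  apply/funext => n; rewrite T_E; apply: cint_ae; [| |].
  - by apply: cmeasM => //; exact: mPsi.
  - by apply: cmeasM => //; exact: mPsi.
  - by apply: ae_imp gg' => p ->.
have -> : ofR (2 * pi) * segint a b g = cint (fun p => g' p * ofR (psi p * (2 * pi))).
  rewrite /segint -psi_rst -cintZ//; apply: cint_ae.
  - by apply: cmeasM; [exact: cmeas_cst|apply: cmeasM => //; exact: cmeas_ofR].
  - by apply: cmeasM => //; apply: cmeas_ofR; exact: measurable_funM.
  - by apply: ae_imp gg' => p ->; rewrite !ofRM; ring.
apply: (@cint_dct _ _ _ (fun p => 2 * pi * cmod (g p)) _ _ _ _).2.
- by move=> n; apply: cmeasM => //; exact: mPsi.
- move=> p; have [e|e] := boolP ((p == a) || (p == b)).
    rewrite /g' e mul0r; under eq_fun do rewrite mul0r; exact: cvg_cst.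
  apply: cvgMr; move: e; rewrite negb_or => /andP[/eqP pa /eqP pb]; exact: Psi_lim.
- move=> n p; rewrite (cmodM (g' p)) mulrC; apply: ler_pM; rewrite ?cmod_ge0//.
    exact: Psi_bound.
  by rewrite /g'; case: ifP; rewrite // cmod0 cmod_ge0.
- by rewrite /comp; under eq_fun do rewrite EFinM; exact: integrableZl.
Qed.

Lemma inversion_interval : segint a b q = ofR (2 * pi) * segint a b g.
Proof. exact: cvgC_unique T_lim1 T_lim2. Qed.

End interval.

(** Both sides have the same integral over every bounded interval. The bound of [q] by the L^1 norm
    of [h] makes it integrable there. *)
Theorem fourier_inversion_ae : {ae mu, forall s, q s = ofR (2 * pi) * g s}.
Proof.
have mq : cmeas q.
  apply: (@cmeas_cint _ (fun s x => h x * cexp (iC * ofR x * ofR s))).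
  apply: cmeasM; first exact: (cmeas_comp mh measurable_snd).
  apply: cmeas_cexp; apply: cmeasM; last exact: (cmeas_ofR measurable_fst).
  by apply: cmeasM; [exact: cmeas_cst|exact: (cmeas_ofR measurable_snd)].
have iq a b : cintegrable (rst a b q).
  apply: (@cintegrable_rst_bnd _ _ _ _ (Rintegral mu setT (fun x => cmod (h x)))).
    exact: cmeas_rst.
  move=> s _; apply: cmod_cint_dom => [|x|//]; last by rewrite (cmodM (h x)) cmod_phase mulr1.
  by apply: cmeasM => //; exact: cmeas_phase.
have igz := cintegrableZ (ofR (- (2 * pi))) ig.
suff : {ae mu, forall s, q s + ofR (- (2 * pi)) * g s = 0}.
  by apply: ae_imp => s; rewrite ofRN mulNr => /eqP; rewrite subr_eq0 => /eqP.
apply: cplx_ae0_of_interval => a b.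
  by rewrite rstD; apply: cintegrableD => //; exact: cintegrable_rst.
move=> ab; rewrite /segint rstD cintD//; last exact: cintegrable_rst.
rewrite -/(segint a b q) inversion_interval// rstZ cintZ; last exact: cintegrable_rst.
by rewrite -/(segint a b g) -mulrDl -ofRD subrr mul0r.
Qed.

End Inversion.

(** * Cauchy--Schwarz, null sets and sequential continuity *)

Section SquareBounds.
Context {R : realType}.
Notation mu := (@lebesgue_measure R).

Lemma measurable_tonelliT d (T : measurableType d) (f : T * R -> \bar R) : measurable_fun setT f ->
  (forall p, 0 <= f p)%E -> measurable_fun setT (fun x : T => \int[mu]_y f (x, y))%E.
Proof. by move=> mf f0; exact: (measurable_fun_fubini_tonelli_F (m2 := mu) f mf f0). Qed.

Lemma cmeas_cintT d (T : measurableType d) (h : T -> R -> Cplx R) :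
  cmeas (fun p : T * R => h p.1 p.2) -> cmeas (fun x => cint (h x)).
Proof.
have key (f : T -> R -> R) : measurable_fun setT (fun p : T * R => f p.1 p.2) ->
    measurable_fun setT (fun x => Rintegral mu setT (f x)).
  move=> mf; rewrite /Rintegral; apply: measurableT_comp => //.
  have mf' : measurable_fun setT (fun p : T * R => (f p.1 p.2)%:E) by exact/measurable_EFinP.
  under eq_fun do rewrite integralE.
  apply: emeasurable_funB.
    have H := measurable_tonelliT (measurable_funepos mf').
    have {H} := H (fun p => funepos_ge0 (fun p : T * R => (f p.1 p.2)%:E) p).
    move=> H; refine (eq_ind _ _ H _ _); apply/funext => x; apply: eq_integral => y _.
    by rewrite !funeposE.
  have H := measurable_tonelliT (measurable_funeneg mf').
  have {H} := H (fun p => funeneg_ge0 (fun p : T * R => (f p.1 p.2)%:E) p).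
  move=> H; refine (eq_ind _ _ H _ _); apply/funext => x; apply: eq_integral => y _.
  by rewrite !funenegE.
by move=> [h1 h2]; split; [exact: (key _ h1)|exact: (key _ h2)].
Qed.

(** An infinite right-hand side makes the bound trivial; otherwise [h] is integrable and
    [cmod_cint_le] applies. *)
Lemma cmod_cint_lee (h : R -> Cplx R) : cmeas h ->
  ((cmod (cint h))%:E <= \int[mu]_x (cmod (h x))%:E)%E.
Proof.
move=> mh; have mc : measurable_fun setT (EFin \o (fun x => cmod (h x))).
  by apply/measurable_EFinP; exact: measurable_cmod.
have I0 : (0 <= \int[mu]_x (cmod (h x))%:E)%E.
  by apply: integral_ge0 => x _; rewrite lee_fin cmod_ge0.
have [fin|inf] := ltP (\int[mu]_x (cmod (h x))%:E)%E +oo%E; last first.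
  by rewrite (le_trans _ inf)// leey.
have ic : mu.-integrable setT (EFin \o (fun x => cmod (h x))).
  apply/integrableP; split => //; apply: le_lt_trans fin; rewrite le_eqVlt; apply/orP; left.
  by apply/eqP; apply: eq_integral => x _ /=; rewrite ger0_norm ?cmod_ge0.
have ih : cintegrable h by apply/cintegrableP.
have := cmod_cint_le ih; rewrite -lee_fin => /le_trans; apply.
by rewrite /Rintegral fineK// ge0_fin_numE.
Qed.

(* Cauchy--Schwarz, from [2 F <= l P + Q / l] with [l] equal to the integral of [F] over [A]. *)
Lemma sq_integral_le (F P Q : R -> R) (A : R) :
  measurable_fun setT F -> measurable_fun setT P -> measurable_fun setT Q ->
  (forall x, 0 <= F x) -> (forall x, 0 <= P x) -> (forall x, 0 <= Q x) ->
  (forall x, F x ^+ 2 <= P x * Q x) -> 0 < A -> (\int[mu]_x (P x)%:E <= A%:E)%E ->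
  ((\int[mu]_x (F x)%:E) ^+ 2 <= A%:E * \int[mu]_x (Q x)%:E)%E.
Proof.
move=> mF mP mQ F0 P0 Q0 FPQ A0 PA.
have IQ0 : (0 <= \int[mu]_x (Q x)%:E)%E by apply: integral_ge0 => x _; rewrite lee_fin.
have IF0 : (0 <= \int[mu]_x (F x)%:E)%E by apply: integral_ge0 => x _; rewrite lee_fin.
have IP0 : (0 <= \int[mu]_x (P x)%:E)%E by apply: integral_ge0 => x _; rewrite lee_fin.
have key l : 0 < l -> (\int[mu]_x (F x)%:E <= (l / 2)%:E * \int[mu]_x (P x)%:E + (l^-1 / 2)%:E * \int[mu]_x (Q x)%:E)%E.
  move=> l0.
  rewrite -!ge0_integralZl//; try by [apply/measurable_EFinP|move=> x _; rewrite lee_fin|rewrite lee_fin; apply: divr_ge0 => //; rewrite ?invr_ge0 ltW].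
  have q1 x : (0 <= (l / 2)%:E * (P x)%:E)%E by rewrite -EFinM lee_fin mulr_ge0// divr_ge0// ltW.
  have q2 x : (0 <= (l^-1 / 2)%:E * (Q x)%:E)%E by rewrite -EFinM lee_fin mulr_ge0// divr_ge0// ?invr_ge0 ltW.
  have m1 : measurable_fun setT (fun x => (l / 2)%:E * (P x)%:E)%E.
    by apply: emeasurable_funM; [exact: measurable_cst|exact/measurable_EFinP].
  have m2 : measurable_fun setT (fun x => (l^-1 / 2)%:E * (Q x)%:E)%E.
    by apply: emeasurable_funM; [exact: measurable_cst|exact/measurable_EFinP].
  rewrite -ge0_integralD//.
  apply: ge0_le_integral => //.
  - by move=> x _; rewrite lee_fin.
  - exact/measurable_EFinP.
  - exact: emeasurable_funD.
  move=> x _; rewrite -!EFinM -EFinD lee_fin.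
  have := FPQ x; have := F0 x; have := P0 x; have := Q0 x; move: (F x) (P x) (Q x) => f p q0' *.
  have h : (2 * f) ^+ 2 <= (l * p + l^-1 * q0') ^+ 2.
    have -> : (l * p + l^-1 * q0') ^+ 2 = (l * p - l^-1 * q0') ^+ 2 + 4 * (p * q0').
      by field; rewrite gt_eqF.
    rewrite exprMn; have := sqr_ge0 (l * p - l^-1 * q0'); lra.
  have pos : 0 <= l * p + l^-1 * q0' by rewrite addr_ge0// mulr_ge0// ?invr_ge0 ltW.
  move: h; rewrite ler_sqr ?nnegrE ?mulr_ge0// => h.
  have -> : l / 2 * p + l^-1 / 2 * q0' = (l * p + l^-1 * q0') / 2 by ring.
  by rewrite ler_pdivlMr// mulrC.
have [Qfin|] := ltP (\int[mu]_x (Q x)%:E)%E +oo%E; last first.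
  by rewrite leye_eq => /eqP ->; rewrite gt0_muley ?lte_fin// leey.
have Pn : (\int[mu]_x (P x)%:E)%E \is a fin_num by rewrite ge0_fin_numE//; exact: le_lt_trans PA (ltry _).
have Qn : (\int[mu]_x (Q x)%:E)%E \is a fin_num by rewrite ge0_fin_numE.
have Fn : (\int[mu]_x (F x)%:E)%E \is a fin_num.
  rewrite ge0_fin_numE//; apply: le_lt_trans (key 1 ltr01) _.
  by rewrite -(fineK Pn) -(fineK Qn) -!EFinM -EFinD ltry.
move: key PA IQ0 IF0 IP0; rewrite -(fineK Pn) -(fineK Qn) -(fineK Fn).
move: (fine _) (fine _) (fine _) => q p f key; rewrite !lee_fin => PA q0 f0 p0.
move: f0; rewrite le_eqVlt => /predU1P[<-|f0]; first by rewrite mul0r mulr_ge0// ltW.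
have l0 : 0 < f / A by rewrite divr_gt0.
have := key _ l0; rewrite -!EFinM -EFinD lee_fin => h.
have h2 : f / A / 2 * p <= f / 2.
  rewrite (_ : f / A / 2 * p = (f / 2) * (p / A)); last by ring.
  have a1 : p / A <= 1 by rewrite ler_pdivrMr// mul1r.
  have a2 : 0 <= f / 2 by rewrite divr_ge0// ltW.
  exact: ler_piMr.
have h3 : f / 2 <= (f / A)^-1 / 2 * q by lra.
move: h3; rewrite invf_div (_ : A / f / 2 * q = (A * q / 2) / f); last by field; rewrite gt_eqF.
rewrite ler_pdivlMr//; lra.
Qed.

(** Converts dominated convergence, stated for sequences, into epsilon-delta continuity: failures at
    the radii 1/(n+1) are collected into a sequence by [choice]. *)
Lemma seq_continuity (D : set (Cplx R)) (F : Cplx R -> Cplx R) (z : Cplx R) :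
  (forall u : nat -> Cplx R, (forall n, D (u n)) -> u n @[n --> \oo] --> z ->
     F (u n) @[n --> \oo] --> F z) ->
  forall e : R, 0 < e -> exists2 d : R, 0 < d &
    forall u, D u -> cmod (u - z) < d -> cmod (F u - F z) < e.
Proof.
move=> H e e0; apply: contrapT => nex.
have bad (n : nat) : exists u, [/\ D u, cmod (u - z) < n.+1%:R^-1 & e <= cmod (F u - F z)].
  apply: contrapT => nu; apply: nex; exists n.+1%:R^-1; first by rewrite invr_gt0.
  by move=> u Du ud; rewrite ltNge; apply/negP => h; apply: nu; exists u.
have [u uP] := choice bad.
have uz : u n @[n --> \oo] --> z.
  apply/cvgCP; apply: (@squeeze_cvgr _ _ _ _ (cst 0) (@harmonic R)).
  - by apply: nearW => n; rewrite cmod_ge0 /=; have [_ /ltW h _] := uP n.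
  - exact: cvg_cst.
  - exact: cvg_harmonic.
have Du n : D (u n) by have [] := uP n.
have /cvgCP/cvgrPdist_lt/(_ _ e0)[N _ NP] := H u Du uz.
have := NP N (leqnn N); rewrite /= sub0r normrN ger0_norm ?cmod_ge0//.
by have [_ _ h] := uP N; rewrite ltNge h.
Qed.

(** A nonzero value would persist on an interval of positive measure. *)
Lemma ae0_continuous (f : R -> Cplx R) : continuous f -> {ae mu, forall x, f x = 0} ->
  forall x, f x = 0.
Proof.
move=> cf [N [mN N0 sN]] x; apply: contrapT => fx.
have e0 : 0 < cmod (f x).
  by rewrite lt_neqAle cmod_ge0 andbT eq_sym; apply/eqP => /cmod_eq0.
have /cf/nbhs_normP[d /= d0 dP] : nbhs (f x) [set u | cmod (u - f x) < cmod (f x)].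
  by apply/nbhsCP; exists (cmod (f x)).
have sub : `]x - d, x + d[ `<=` N.
  move=> y; rewrite /= in_itv /= => /andP[h1 h2]; apply: sN => /= fy.
  have xy : `|x - y| < d by rewrite ltr_norml; apply/andP; split; lra.
  by have := dP y xy; rewrite /= fy sub0r cmodN ltxx.
have : (mu `](x - d)%R, (x + d)%R[%classic <= mu N)%E by apply: le_measure; rewrite ?inE.
rewrite N0 lebesgue_measure_itv /= lte_fin ifT; last by lra.
by rewrite -EFinB lee_fin; lra.
Qed.

End SquareBounds.

Lemma measurable_inv_pos (R : realType) d (T : measurableType d) (f : T -> R) : (forall x, 0 < f x) ->
  measurable_fun setT f -> measurable_fun setT (fun x => (f x)^-1).
Proof.
move=> f0 mf; rewrite (_ : (fun x => _) = fun x => expR (- ln (f x))).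
  by apply: measurableT_comp => //; apply: measurableT_comp => //; exact: measurableT_comp.
by apply/funext => x; rewrite expRN lnK// posrE.
Qed.

(** * The Fourier kernel on strips *)

Section FourierKernel.
Context {R : realType}.

Definition ker (z : Cplx R) (s : R) : Cplx R := cexp (- (iC * z * ofR s)).
Definition hat (g : R -> Cplx R) (z : Cplx R) : Cplx R := cint (fun s => ker z s * g s).

Lemma cmod_ker z s : cmod (ker z s) = expR (imC z * s).
Proof. by rewrite cmod_cexp !reimE; congr expR; ring. Qed.

Lemma ker_le w z s : `|imC z| <= w -> cmod (ker z s) <= expR (w * `|s|).
Proof.
move=> zw; rewrite cmod_ker ler_expR; apply: le_trans (ler_norm _) _.
by rewrite normrM ler_wpM2r.
Qed.

Lemma kerD z u s : ker (z + u) s = ker z s * ker u s.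
Proof. by rewrite /ker -cexpD; congr cexp; ring. Qed.
Lemma kerDs z s t : ker z (s + t) = ker z s * ker z t.
Proof. by rewrite /ker -cexpD ofRD; congr cexp; ring. Qed.
Lemma cmeas_ker2 d (T : measurableType d) (p : T -> Cplx R) (q : T -> R) :
  cmeas p -> measurable_fun setT q -> cmeas (fun t => ker (p t) (q t)).
Proof.
move=> mp mq; apply: cmeas_cexp; apply: cmeasN; apply: cmeasM; last exact: cmeas_ofR.
by apply: cmeasM => //; exact: cmeas_cst.
Qed.

Lemma cmeas_ker z : cmeas (ker z).
Proof. by apply: cmeas_ker2 => //; exact: cmeas_cst. Qed.

Lemma ker_seq_cvg (u : nat -> Cplx R) s : u n @[n --> \oo] --> (0 : Cplx R) -> ker (u n) s @[n --> \oo] --> (1 : Cplx R).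
Proof.
move=> u0.
have h0 : iC * u n @[n --> \oo] --> iC * (0 : Cplx R) by exact: cvgMr.
have h1 : iC * u n * ofR s @[n --> \oo] --> iC * 0 * ofR s by exact: cvgMl.
have h : - (iC * u n * ofR s) @[n --> \oo] --> - (iC * 0 * ofR s) by exact: cvgN.
move: h; rewrite mulr0 mul0r oppr0 => h; have := cvg_comp _ _ h (@continuous_cexp R 0).
by rewrite cexp0.
Qed.

End FourierKernel.

(** * The weighted space of densities *)

Section Weight.
Context {R : realType}.
Notation mu := (@lebesgue_measure R).
Variables (w : R) (v : R -> R).
Hypothesis w0 : 0 <= w.
Hypothesis sv : strongly_admissible v.

Lemma mv : measurable_fun setT v. Proof. by case: sv => -[]. Qed.
Lemma v_ge1 s : 1 <= v s. Proof. by case: sv => -[_ []]. Qed.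
Lemma v_gt0 s : 0 < v s. Proof. exact: lt_le_trans ltr01 (v_ge1 s). Qed.
(** Enlarging the constant to [1 + |K|] provides the bound [1 <= K] on which the convolution
    estimates rely. *)
Lemma v_quasi : exists2 K : R, 1 <= K & forall s t, v (s + t) <= K * (v s + v t).
Proof.
have [[_ [_ [K HK]]] _] := sv; exists (1 + `|K|); first by rewrite lerDl.
move=> s t; apply: le_trans (HK s t) _; apply: ler_wpM2r.
  by apply: addr_ge0; apply: ltW; exact: v_gt0.
by apply: le_trans (ler_norm _) _; rewrite lerDr.
Qed.

(** The squared L^2 norm of 1/v, plus 1 so that it is a positive constant in Cauchy--Schwarz. *)
Definition vcst : R := fine (\int[mu]_s ((v s)^-1 ^+ 2)%:E) + 1.

Lemma vcst_ge1 : 1 <= vcst.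
Proof. by rewrite /vcst lerDr fine_ge0// integral_ge0// => s _; rewrite lee_fin sqr_ge0. Qed.
Lemma vcst_gt0 : 0 < vcst. Proof. exact: lt_le_trans ltr01 vcst_ge1. Qed.

Lemma mvV2 : measurable_fun setT (fun s => (v s)^-1 ^+ 2).
Proof. by apply: measurable_funX; apply: measurable_inv_pos; [exact: v_gt0|exact: mv]. Qed.

Lemma integrable_vV2 : mu.-integrable setT (EFin \o (fun s => (v s)^-1 ^+ 2)).
Proof.
have [_ fin] := sv; apply/integrableP; split; first by apply/measurable_EFinP; exact: mvV2.
apply: le_lt_trans fin; rewrite le_eqVlt; apply/orP; left; apply/eqP.
by apply: eq_integral => x _ /=; rewrite ger0_norm ?sqr_ge0.
Qed.

Lemma vcst_le : (\int[mu]_s ((v s)^-1 ^+ 2)%:E <= vcst%:E)%E.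
Proof.
have f := integrable_fin_num measurableT integrable_vV2.
by rewrite -(fineK f) lee_fin /vcst lerDl.
Qed.

Definition Wt s : R := v s * expR (w * `|s|).
Lemma Wt_gt0 s : 0 < Wt s. Proof. by rewrite mulr_gt0 ?v_gt0 ?expR_gt0. Qed.
Lemma mWt : measurable_fun setT Wt.
Proof.
apply: measurable_funM; first exact: mv.
by apply: measurableT_comp => //; apply: measurable_funM => //; exact: measurableT_comp.
Qed.

(** Kept in the extended reals so that estimates can be stated before finiteness is known. [nW]
    carries information only under [L2W], since [fine] sends infinity to 0. *)
Definition nsq (g : R -> Cplx R) := (\int[mu]_s ((Wt s * cmod (g s)) ^+ 2)%:E)%E.
Definition L2W g := cmeas g /\ (nsq g < +oo)%E.
Definition nW g : R := Num.sqrt (fine (nsq g)).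

Lemma nsq_ge0 g : (0 <= nsq g)%E.
Proof. by apply: integral_ge0 => s _; rewrite lee_fin sqr_ge0. Qed.
Lemma nW_ge0 g : 0 <= nW g. Proof. exact: sqrtr_ge0. Qed.
Lemma nW_sq g : L2W g -> nsq g = (nW g ^+ 2)%:E.
Proof.
move=> [_ fin]; have fn : nsq g \is a fin_num by rewrite ge0_fin_numE ?nsq_ge0.
rewrite /nW sqr_sqrtr ?fineK//; exact/fine_ge0/nsq_ge0.
Qed.
Lemma nW_le g M : 0 <= M -> (nsq g <= (M ^+ 2)%:E)%E -> nW g <= M.
Proof.
move=> M0 h; rewrite -[leRHS]ger0_norm// -sqrtr_sqr ler_wsqrtr// -lee_fin fineK//.
rewrite ge0_fin_numE ?nsq_ge0//; exact: le_lt_trans h (ltry _).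
Qed.

Lemma cmod_W g s : cmod (ofR (v s * expR (w * `|s|)) * g s) = Wt s * cmod (g s).
Proof. by rewrite cmodM cmod_ofR ger0_norm// ltW ?Wt_gt0. Qed.

Lemma L2norm_W g : L2norm (fun s => ofR (v s * expR (w * `|s|)) * g s) = nW g.
Proof.
rewrite /L2norm /nW /nsq; congr (Num.sqrt (fine _)).
by apply: eq_integral => s _; rewrite cmod_W.
Qed.

Lemma isL2_W g : isL2 (fun s => ofR (v s * expR (w * `|s|)) * g s) <-> L2W g.
Proof.
have E : (\int[mu]_x (cmod (ofR (v x * expR (w * `|x|)) * g x) ^+ 2)%:E = nsq g)%E.
  by apply: eq_integral => s _; rewrite cmod_W.
rewrite /isL2 E; split => -[mg fin]; split => //.
  have mW : cmeas (fun s => ofR (Wt s)^-1).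
    by apply: cmeas_ofR; apply: measurable_inv_pos; [exact: Wt_gt0|exact: mWt].
  have := cmeasM mW mg; congr cmeas; apply/funext => s.
  by rewrite mulrA -ofRM mulVf ?mul1r// gt_eqF// Wt_gt0.
by apply: cmeasM => //; exact: (cmeas_ofR mWt).
Qed.

Lemma W2_repP f g : W2_rep w v f g <-> L2W g /\ forall z, strip w z -> f z = hat g z.
Proof. by rewrite /W2_rep isL2_W. Qed.

Lemma mnsq g : cmeas g -> measurable_fun setT (fun s => (Wt s * cmod (g s)) ^+ 2).
Proof.
by move=> mg; apply: measurable_funX; apply: measurable_funM; [exact: mWt|exact: measurable_cmod].
Qed.

Lemma mexpw : measurable_fun setT (fun s : R => expR (w * `|s|)).
Proof. by apply: measurableT_comp => //; apply: measurable_funM => //; exact: measurableT_comp. Qed.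

(** Cauchy--Schwarz for the splitting of the majorant as [(m / v) * (Wt * cmod g)]. Taking [m = 1]
    gives the embedding into weighted L^1; a small [m] gives equicontinuity of transforms. *)
Lemma integral_m_le (F m : R -> R) g A : cmeas g -> measurable_fun setT F -> measurable_fun setT m ->
  (forall s, 0 <= F s <= m s * (expR (w * `|s|) * cmod (g s))) -> 0 < A ->
  (\int[mu]_s ((m s / v s) ^+ 2)%:E <= A%:E)%E ->
  ((\int[mu]_s (F s)%:E) ^+ 2 <= A%:E * nsq g)%E.
Proof.
move=> mg mF mm hF A0 hA; apply: (sq_integral_le _ _ (mnsq mg) _ _ _ _ A0 hA) => //.
- by apply: measurable_funX; apply: measurable_funM => //; apply: measurable_inv_pos; [exact: v_gt0|exact: mv].
- by move=> s; case/andP: (hF s).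
- by move=> s; exact: sqr_ge0.
- by move=> s; exact: sqr_ge0.
move=> s; have /andP[f0 fm] := hF s; rewrite -exprMn.
have -> : m s / v s * (Wt s * cmod (g s)) = m s * (expR (w * `|s|) * cmod (g s)).
  by rewrite /Wt; field; rewrite gt_eqF// v_gt0.
by rewrite ler_sqr ?nnegrE// (le_trans f0 fm).
Qed.

Lemma L1_sq g : cmeas g ->
  ((\int[mu]_s (expR (w * `|s|) * cmod (g s))%:E) ^+ 2 <= vcst%:E * nsq g)%E.
Proof.
move=> mg; apply: (@integral_m_le _ (cst 1)) => //.
- by apply: measurable_funM; [exact: mexpw|exact: measurable_cmod].
- by move=> s; rewrite mul1r lexx mulr_ge0 ?expR_ge0 ?cmod_ge0.
- exact: vcst_gt0.
- by under eq_integral do rewrite div1r; exact: vcst_le.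
Qed.

Lemma sq_lee_real (X : \bar R) (c : R) : (0 <= X)%E -> 0 <= c -> (X ^+ 2 <= (c ^+ 2)%:E)%E -> (X <= c%:E)%E.
Proof.
case: X => [x| |] //; first by rewrite !lee_fin => x0 c0; rewrite -expr2 ler_sqr.
Qed.

(** Makes [hat g] an absolutely convergent integral on the whole closed strip, where the kernel is
    at most [expR (w * |s|)]. *)
Lemma L1_norm g : L2W g -> mu.-integrable setT (EFin \o (fun s => expR (w * `|s|) * cmod (g s))) /\
  Rintegral mu setT (fun s => expR (w * `|s|) * cmod (g s)) <= Num.sqrt vcst * nW g.
Proof.
move=> Lg; have [mg _] := Lg.
have I0 : (0 <= \int[mu]_s (expR (w * `|s|) * cmod (g s))%:E)%E.
  by apply: integral_ge0 => s _; rewrite lee_fin mulr_ge0 ?expR_ge0 ?cmod_ge0.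
have h : (\int[mu]_s (expR (w * `|s|) * cmod (g s))%:E <= (Num.sqrt vcst * nW g)%:E)%E.
  apply: sq_lee_real => //; first by rewrite mulr_ge0 ?sqrtr_ge0 ?nW_ge0.
  apply: le_trans (L1_sq mg) _.
  have c0 := ltW vcst_gt0.
  by rewrite (nW_sq Lg) -EFinM lee_fin exprMn (sqr_sqrtr c0).
split; last by rewrite /Rintegral -lee_fin fineK// ge0_fin_numE//; exact: le_lt_trans h (ltry _).
apply/integrableP; split.
  by apply/measurable_EFinP; apply: measurable_funM; [exact: mexpw|exact: measurable_cmod].
apply: le_lt_trans (ltry (Num.sqrt vcst * nW g)); apply: le_trans h; rewrite le_eqVlt; apply/orP; left; apply/eqP.
by apply: eq_integral => s _ /=; rewrite ger0_norm// mulr_ge0 ?expR_ge0 ?cmod_ge0.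
Qed.

Lemma ker_dom z g s : `|imC z| <= w -> cmod (ker z s * g s) <= expR (w * `|s|) * cmod (g s).
Proof. by move=> zw; rewrite cmodM ler_wpM2r ?cmod_ge0// ker_le. Qed.

Lemma cmeas_kerM z (g : R -> Cplx R) : cmeas g -> cmeas (fun s => ker z s * g s).
Proof. by move=> mg; apply: cmeasM => //; exact: cmeas_ker. Qed.

Lemma hat_integrable z g : `|imC z| <= w -> L2W g -> cintegrable (fun s => ker z s * g s).
Proof.
move=> zw Lg; have [iL _] := L1_norm Lg.
apply: (cintegrable_le _ (fun s => ker_dom g s zw) iL); apply: cmeas_kerM; exact: Lg.1.
Qed.

Lemma hat_bound z g : `|imC z| <= w -> L2W g -> cmod (hat g z) <= Num.sqrt vcst * nW g.
Proof.
move=> zw Lg; have [iL bL] := L1_norm Lg; apply: le_trans bL.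
apply: (cmod_cint_dom _ (fun s => ker_dom g s zw) iL); apply: cmeas_kerM; exact: Lg.1.
Qed.

Lemma L2W_integrable g : L2W g -> cintegrable g.
Proof.
move=> Lg; have [iL _] := L1_norm Lg; apply: (cintegrable_le Lg.1 _ iL) => s.
by rewrite ler_peMl ?cmod_ge0// -expR0 ler_expR mulr_ge0.
Qed.

Lemma hatD g h z : `|imC z| <= w -> L2W g -> L2W h -> hat (fun s => g s + h s) z = hat g z + hat h z.
Proof.
move=> zw Lg Lh; rewrite /hat -cintD; [|exact: hat_integrable|exact: hat_integrable].
by congr cint; apply/funext => s; rewrite mulrDr.
Qed.

(** Equicontinuity over a ball of densities: uniform continuity of a function in the Hormander space
    uses a different localization near each point, so [d] may depend on the norm bound only. A
    sequence of violations would have relative kernel differences at most 2 and tending to 0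
    pointwise, against which Cauchy--Schwarz with the majorant [4 / v ^ 2] gives a contradiction. *)
Lemma hat_modulus (M e : R) : 0 < e -> exists2 d : R, 0 < d &
  forall g, L2W g -> nW g <= M -> forall z u, `|imC z| <= w -> `|imC u| <= w ->
    cmod (z - u) < d -> cmod (hat g z - hat g u) < e.
Proof.
move=> e0; apply: contrapT => nex.
have bad (n : nat) : exists p : (R -> Cplx R) * (Cplx R * Cplx R),
   [/\ L2W p.1, nW p.1 <= M, `|imC p.2.1| <= w, `|imC p.2.2| <= w &
   cmod (p.2.1 - p.2.2) < n.+1%:R^-1 /\ e <= cmod (hat p.1 p.2.1 - hat p.1 p.2.2)].
  apply: contrapT => nu; apply: nex; exists n.+1%:R^-1; first by rewrite invr_gt0.
  move=> g Lg gM z u zw uw zu; rewrite ltNge; apply/negP => h; apply: nu.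
  by exists (g, (z, u)).
have [p pP] := choice bad.
(* The kernel difference at the two points, relative to [expR (w * |s|)]. *)
pose m n s := cmod (ker ((p n).2.1 - (p n).2.2) s - 1) * (cmod (ker (p n).2.2 s) * expR (- (w * `|s|))).
have mm n : measurable_fun setT (m n).
  apply: measurable_funM.
    by apply: measurable_cmod; apply: cmeasB; [exact: cmeas_ker|exact: cmeas_cst].
  apply: measurable_funM; first by apply: measurable_cmod; exact: cmeas_ker.
  under eq_fun do rewrite expRN.
  by apply: measurable_inv_pos; [move=> s; exact: expR_gt0|exact: mexpw].
have kE n s : cmod (ker (p n).2.1 s - ker (p n).2.2 s) = m n s * expR (w * `|s|).
  rewrite /m -!mulrA -expRD addNr expR0 mulr1 -cmodM mulrBl mul1r.
  by congr cmod; rewrite -kerD subrK.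
have m0 n s : 0 <= m n s by rewrite !mulr_ge0 ?cmod_ge0 ?expR_ge0.
have m2 n s : m n s <= 2.
  rewrite -(ler_pM2r (expR_gt0 (w * `|s|))) -kE; apply: le_trans (cmodBD _ _) _.
  have [_ _ h1 h2 _] := pP n; have := ker_le s h1; have := ker_le s h2; lra.
have u0 : (p n).2.1 - (p n).2.2 @[n --> \oo] --> (0 : Cplx R).
  apply/cvgCP; apply: (@squeeze_cvgr _ _ _ _ (cst 0) (@harmonic R)).
  - by apply: nearW => n; rewrite cmod_ge0 subr0 /=; have [_ _ _ _ [/ltW h _]] := pP n.
  - exact: cvg_cst.
  - exact: cvg_harmonic.
have mlim s : m n s @[n --> \oo] --> (0 : R).
  apply: (@squeeze_cvgr _ _ _ _ (cst 0) (fun n => cmod (ker ((p n).2.1 - (p n).2.2) s - 1))).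
  - apply: nearW => n; rewrite m0 /= /m ler_piMr ?cmod_ge0//.
    by rewrite expRN ler_pdivrMr ?expR_gt0// mul1r ker_le//; have [] := pP n.
  - exact: cvg_cst.
  - by have /cvgCP := ker_seq_cvg s u0.
pose A n := Rintegral mu setT (fun s => (m n s / v s) ^+ 2).
have mA n : measurable_fun setT (fun s => (m n s / v s) ^+ 2).
  by apply: measurable_funX; apply: measurable_funM => //; apply: measurable_inv_pos; [exact: v_gt0|exact: mv].
have iD : mu.-integrable setT (EFin \o (fun s => 4 * (v s)^-1 ^+ 2)).
  by rewrite /comp; under eq_fun do rewrite EFinM; apply: integrableZl => //; exact: integrable_vV2.
have bD n s : (m n s / v s) ^+ 2 <= 4 * (v s)^-1 ^+ 2.
  rewrite exprMn ler_wpM2r ?sqr_ge0//; have -> : (4 : R) = 2 ^+ 2 by ring.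
  by rewrite ler_sqr ?nnegrE ?m0 ?m2.
have iA n : mu.-integrable setT (EFin \o (fun s => (m n s / v s) ^+ 2)).
  apply: le_integrable (iD) => //; first by apply/measurable_EFinP; exact: mA.
  move=> s _ /=; rewrite lee_fin ger0_norm ?sqr_ge0//; exact: le_trans (bD n s) (ler_norm _).
have A0 : A n @[n --> \oo] --> (0 : R).
  have [|s|n s|_ cA] := @cint_dct _ (fun n s => ofR ((m n s / v s) ^+ 2)) (fun=> ofR 0)
    (fun s => 4 * (v s)^-1 ^+ 2) _ _ _ iD.
  - by move=> n; exact: cmeas_ofR.
  - apply/cvgC_reim; split; last exact: cvg_cst.
    rewrite !reC_of -[X in _ --> X](mulr0 0) -(mul0r (v s)^-1).
    have h : m n s / v s @[n --> \oo] --> 0 * (v s)^-1 by exact: cvgMl.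
    exact: (cvgM h h).
  - by rewrite cmod_ofR ger0_norm ?sqr_ge0.
  move: cA; rewrite (_ : (fun n => cint _) = fun n => ofR (A n)).
    move=> /cvgC_reim[+ _]; rewrite cint_ofR (@Rintegral_cst _ _ _ mu setT measurableT 0) mul0r; exact.
  by apply/funext => n; rewrite cint_ofR.
(* The added 1 avoids division by 0 and the factor 2 makes the final inequality
   [e ^+ 2 <= c0 * M ^+ 2] absurd. *)
have c0 : 0 < e ^+ 2 / (2 * (M ^+ 2 + 1)).
  by rewrite divr_gt0 ?exprn_gt0// mulr_gt0// ltr_wpDl// sqr_ge0.
move/cvgrPdist_lt/(_ _ c0) : A0 => [N _ NP]; have := NP N (leqnn N); rewrite /= sub0r normrN => AN.
have [Lg gM zw uw [zu eh]] := pP N.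
have AN' : A N < e ^+ 2 / (2 * (M ^+ 2 + 1)) := le_lt_trans (ler_norm _) AN.
have hA : (\int[mu]_s ((m N s / v s) ^+ 2)%:E <= (e ^+ 2 / (2 * (M ^+ 2 + 1)))%:E)%E.
  by rewrite -(fineK (integrable_fin_num measurableT (iA N))) lee_fin ltW.
have := @integral_m_le (fun s => cmod (ker (p N).2.1 s - ker (p N).2.2 s) * cmod ((p N).1 s)) (m N) (p N).1 _
  Lg.1 _ (mm N) _ c0 hA.
have md : cmeas (fun s => ker (p N).2.1 s - ker (p N).2.2 s) by apply: cmeasB; exact: cmeas_ker.
have mF : measurable_fun setT (fun s => cmod (ker (p N).2.1 s - ker (p N).2.2 s) * cmod ((p N).1 s)).
  by apply: measurable_funM; apply: measurable_cmod => //; exact: Lg.1.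
move=> /(_ mF) H.
have {}H := H (fun s => ltac:(rewrite mulr_ge0 ?cmod_ge0//= kE mulrA //)).
have eI : (e%:E <= \int[mu]_s (cmod (ker (p N).2.1 s - ker (p N).2.2 s) * cmod ((p N).1 s))%:E)%E.
  apply: (@le_trans _ _ (cmod (hat (p N).1 (p N).2.1 - hat (p N).1 (p N).2.2))%:E); first by rewrite lee_fin.
  rewrite /hat -cintB; [|exact: hat_integrable|exact: hat_integrable].
  apply: le_trans (cmod_cint_lee _) _.
    by apply: cmeasB; apply: cmeas_kerM; exact: Lg.1.
  by rewrite le_eqVlt; apply/orP; left; apply/eqP; apply: eq_integral => s _; rewrite -mulrBl cmodM.
have : ((e ^+ 2)%:E <= (e ^+ 2 / (2 * (M ^+ 2 + 1)))%:E * (M ^+ 2)%:E)%E.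
  have nM : (nsq (p N).1 <= (M ^+ 2)%:E)%E.
    rewrite nW_sq// lee_fin ler_sqr ?nnegrE ?nW_ge0//; exact: le_trans (nW_ge0 _) gM.
  apply: le_trans (lee_wpmul2l _ nM); last by rewrite lee_fin ltW.
  apply: le_trans H; rewrite EFin_expe !expe2; apply: lee_pmul => //; rewrite lee_fin ltW//.
rewrite -EFinM lee_fin; apply/negP; rewrite -ltNge.
have M1 : 0 < M ^+ 2 + 1 by rewrite ltr_wpDl// sqr_ge0.
rewrite -mulrA gtr_pMr ?exprn_gt0// mulrC ltr_pdivrMr ?mulr_gt0// mul1r.
have := sqr_ge0 M; lra.
Qed.

End Weight.

(** * Superpositions and convolutions *)

Section Superposition.
Context {R : realType}.
Notation mu := (@lebesgue_measure R).
Variables (w : R) (v : R -> R).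
Hypothesis w0 : 0 <= w.
Hypothesis sv : strongly_admissible v.

Lemma ofR_inv (x : R) : ofR x^-1 = (ofR x)^-1 :> Cplx R.
Proof.
have [->|x0] := eqVneq x 0; first by rewrite invr0 ofR0 invr0.
have x0' : ofR x != 0 :> Cplx R by apply: contra_neq x0 => /(congr1 (@reC R)).
by apply: (mulfI x0'); rewrite -ofRM !divff.
Qed.

Lemma ofR2pi_neq0 : ofR (2 * pi) != 0 :> Cplx R.
Proof.
have : 2 * pi != 0 :> R by rewrite mulf_neq0// gt_eqF// pi_gt0.
by apply: contra_neq => /(congr1 (@reC R)).
Qed.

Lemma invFT_E (H : Cplx R -> Cplx R) s : cintegrable (fun x => H (ofR x)) ->
  invFT H s = (ofR (2 * pi))^-1 * cint (fun x => H (ofR x) * cexp (iC * ofR x * ofR s)).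
Proof.
move=> iH; rewrite /invFT -cintZ; last first.
  have [mH nH] := (cintegrableP _).1 iH; apply: (cintegrable_le _ _ nH).
    by apply: cmeasM => //; exact: cmeas_phase.
  by move=> x; rewrite (cmodM (H _)) cmod_phase mulr1.
by congr cint; apply/funext => x; rewrite ofR_inv mulrA.
Qed.

Lemma invFT_unique (g : R -> Cplx R) (H : Cplx R -> Cplx R) : cintegrable g ->
  (forall x, H (ofR x) = hat g (ofR x)) -> cintegrable (fun x => H (ofR x)) ->
  {ae mu, forall s, invFT H s = g s}.
Proof.
move=> ig Hg iH.
have E : (fun x => H (ofR x)) = (fun x : R => cint (fun s => cexp (- (iC * ofR x * ofR s)) * g s)).
  by apply/funext => x; rewrite Hg.
have ih := iH; rewrite E in ih.
have := fourier_inversion_ae ig ih; apply: ae_imp => s h.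
rewrite invFT_E//; have -> : (fun x => H (ofR x) * cexp (iC * ofR x * ofR s)) = (fun x : R =>
  cint (fun s => cexp (- (iC * ofR x * ofR s)) * g s) * cexp (iC * ofR x * ofR s)).
  by apply/funext => x; rewrite Hg.
by rewrite h mulrA mulVf ?mul1r// ofR2pi_neq0.
Qed.

Lemma nsq_ae (g h : R -> Cplx R) : cmeas g -> cmeas h -> {ae mu, forall s, g s = h s} ->
  nsq w v g = nsq w v h.
Proof.
move=> mg mh gh; rewrite /nsq.
have m1 : measurable_fun setT (fun s => ((Wt w v s * cmod (g s)) ^+ 2)%:E) by apply/measurable_EFinP; exact: mnsq.
have m2 : measurable_fun setT (fun s => ((Wt w v s * cmod (h s)) ^+ 2)%:E) by apply/measurable_EFinP; exact: mnsq.
apply: (@ae_eq_integral _ _ _ mu setT _ _ measurableT m1 m2).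
by apply: ae_imp gh => s -> _.
Qed.

Lemma hat_ae (g h : R -> Cplx R) z : cmeas g -> cmeas h -> {ae mu, forall s, g s = h s} ->
  hat g z = hat h z.
Proof.
move=> mg mh gh; apply: cint_ae; [exact: cmeas_kerM|exact: cmeas_kerM|].
by apply: ae_imp gh => s ->.
Qed.

(** Trades a first power for squares, which is what the Schur test controls, in the extended reals
    where [X] may be infinite. *)
Lemma ereal_cX_le (X : \bar R) (c : R) : 0 < c -> (0 <= X)%E ->
  (c%:E * X <= (c ^+ 2)%:E + X ^+ 2)%E.
Proof.
move=> c0; case: X => [x| |] // x0; last first.
  by rewrite expe2 mulyy addey// leey.
rewrite -EFin_expe -EFinM -EFinD lee_fin; rewrite lee_fin in x0.
have := sqr_ge0 (c - x); have : 0 <= c * x by rewrite mulr_ge0// ltW.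
by rewrite sqrrB; lra.
Qed.

Lemma cfubini_ae (h : R -> R -> Cplx R) : cmeas (fun p : R * R => h p.1 p.2) ->
  (\int[mu]_x \int[mu]_y (cmod (h x y))%:E < +oo)%E -> {ae mu, forall x, cintegrable (h x)}.
Proof.
move=> mh ioo.
have mc : measurable_fun setT (fun p : R * R => (cmod (h p.1 p.2))%:E).
  by apply/measurable_EFinP; exact: measurable_cmod.
have F0 x : (0 <= \int[mu]_y (cmod (h x y))%:E)%E.
  by apply: integral_ge0 => y _; rewrite lee_fin cmod_ge0.
have mF : measurable_fun setT (fun x => \int[mu]_y (cmod (h x y))%:E)%E.
  by apply: (measurable_tonelli mc) => p; rewrite lee_fin cmod_ge0.
have iF : mu.-integrable setT (fun x => \int[mu]_y (cmod (h x y))%:E)%E.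
  apply/integrableP; split => //; apply: le_lt_trans ioo.
  by rewrite le_eqVlt; apply/orP; left; apply/eqP; apply: eq_integral => x _; rewrite gee0_abs.
have H0 : {ae mu, forall x : R, setT x -> (\int[mu]_y (cmod (h x y))%:E)%E \is a fin_num} by exact: integrable_ae.
apply: ae_imp H0 => x /(_ Logic.I) fx; have mhx : cmeas (h x) by exact: (cmeas_comp mh (pair1_measurable x)).
apply/cintegrableP; split => //; apply/integrableP; split.
  by apply/measurable_EFinP; exact: measurable_cmod.
move: fx; rewrite ge0_fin_numE//; apply: le_lt_trans; rewrite le_eqVlt; apply/orP; left; apply/eqP.
by apply: eq_integral => y _ /=; rewrite ger0_norm ?cmod_ge0.
Qed.

Section SP.
Variables (k : R -> R -> Cplx R) (P Q : R -> R -> R) (A B : R).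
Hypothesis mk : cmeas (fun p : R * R => k p.1 p.2).
Hypothesis mP : forall s, measurable_fun setT (fun r => P r s).
Hypothesis mQ : measurable_fun setT (fun p : R * R => Q p.1 p.2).
Hypothesis P0 : forall r s, 0 <= P r s.
Hypothesis Q0 : forall r s, 0 <= Q r s.
Hypothesis kPQ : forall r s, (Wt w v s * cmod (k r s)) ^+ 2 <= P r s * Q r s.
Hypothesis A0 : 0 < A.
Hypothesis PA : forall s, (\int[mu]_r (P r s)%:E <= A%:E)%E.
Hypothesis QB : (\int[mu]_r \int[mu]_s (Q r s)%:E <= B%:E)%E.

Let X s := (\int[mu]_r (Wt w v s * cmod (k r s))%:E)%E.
Let q s := (\int[mu]_r (Q r s)%:E)%E.

Let mkl s : cmeas (fun r => k r s).
Proof. exact: (cmeas_comp mk (pair2_measurable s)). Qed.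
Let mQl s : measurable_fun setT (fun r => Q r s).
Proof. exact: (measurableT_comp mQ (pair2_measurable s)). Qed.
Let X0 s : (0 <= X s)%E.
Proof. by apply: integral_ge0 => r _; rewrite lee_fin mulr_ge0 ?cmod_ge0 ?ltW ?Wt_gt0. Qed.
Let q0 s : (0 <= q s)%E.
Proof. by apply: integral_ge0 => r _; rewrite lee_fin. Qed.

Let Xq s : (X s ^+ 2 <= A%:E * q s)%E.
Proof.
apply: (sq_integral_le _ _ (mQl s) _ _ _ _ A0 (PA s)) => //.
- by apply: measurable_funM => //; exact: measurable_cmod.
- by move=> r; rewrite mulr_ge0 ?cmod_ge0 ?ltW ?Wt_gt0.
Qed.

Let swapped (f : R -> R -> R) : measurable_fun setT (fun p : R * R => f p.1 p.2) ->
  measurable_fun setT (fun p : R * R => (f p.2 p.1)%:E).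
Proof.
move=> mf; apply/measurable_EFinP.
have ms : measurable_fun setT (fun p : R * R => (p.2, p.1)).
  by apply: measurable_fun_pair; [exact: measurable_snd|exact: measurable_fst].
exact: (measurableT_comp mf ms).
Qed.

Let mq : measurable_fun setT q.
Proof. by apply: (measurable_tonelli (swapped mQ)) => p; rewrite lee_fin. Qed.

Let qB : (\int[mu]_s q s <= B%:E)%E.
Proof.
apply: le_trans QB; rewrite le_eqVlt; apply/orP; left; apply/eqP.
by rewrite /q (tonelli (swapped mQ))// => p; rewrite lee_fin.
Qed.

Let kk s := cint (fun r => k r s).

Let mkk : cmeas kk.
Proof.
apply: (@cmeas_cint _ (fun s r => k r s)).
apply: (cmeas_comp mk (p := fun p : R * R => (p.2, p.1))).
by apply: measurable_fun_pair; [exact: measurable_snd|exact: measurable_fst].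
Qed.

(** A Schur test: Cauchy--Schwarz in [r] for fixed [s], the integral of [P] being at most [A]
    uniformly in [s]; Tonelli then integrates [Q]. *)
Lemma superpose_nsq : (nsq w v kk <= (A * B)%:E)%E.
Proof.
apply: (@le_trans _ _ (\int[mu]_s (A%:E * q s))%E); last first.
  rewrite ge0_integralZl//; last by rewrite lee_fin ltW.
  by rewrite EFinM; apply: lee_wpmul2l => //; rewrite lee_fin ltW.
apply: ge0_le_integral => //.
- by move=> s _; rewrite lee_fin sqr_ge0.
- by apply/measurable_EFinP; exact: mnsq.
- by apply: emeasurable_funM => //; exact: measurable_cst.
move=> s _; apply: le_trans (Xq s).
have W0 : 0 <= Wt w v s by rewrite ltW// Wt_gt0.
have : ((Wt w v s * cmod (kk s))%:E <= X s)%E.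
  have -> : X s = ((Wt w v s)%:E * \int[mu]_r (cmod (k r s))%:E)%E.
    have mce : measurable_fun setT (fun r : R => (cmod (k r s))%:E).
      by apply/measurable_EFinP; exact: measurable_cmod.
    by rewrite -ge0_integralZl//; solve [exact: mce|move=> r _; rewrite lee_fin cmod_ge0//].
  by rewrite EFinM; apply: lee_wpmul2l; [rewrite lee_fin|exact: cmod_cint_lee].
have yy : (+oo ^+ 2 = +oo :> \bar R)%E by rewrite expe2 mulyy.
move: (X s) (X0 s) => [x| |] // x0; last by move=> _; rewrite yy leey.
rewrite lee_fin -EFin_expe lee_fin => h; rewrite lee_fin in x0.
by rewrite ler_sqr ?nnegrE// mulr_ge0 ?cmod_ge0.
Qed.

Lemma superpose_L2W : L2W w v kk.
Proof. by split => //; apply: le_lt_trans superpose_nsq (ltry _). Qed.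

(** Fubini, whose hypothesis holds because the kernel is at most [Wt / v]: the inner integral is
    bounded by [X / v <= v ^ (-2) + X ^ 2 <= v ^ (-2) + A * q], integrable in [s]. *)
Lemma superpose_hat z : `|imC z| <= w -> hat kk z = cint (fun r => hat (k r) z).
Proof.
move=> zw; pose H s r := ker z s * k r s.
have mH : cmeas (fun p : R * R => H p.1 p.2).
  apply: cmeasM; first by apply: cmeas_ker2; [exact: cmeas_cst|exact: measurable_fst].
  apply: (cmeas_comp mk (p := fun p : R * R => (p.2, p.1))).
  by apply: measurable_fun_pair; [exact: measurable_snd|exact: measurable_fst].
have bH : (\int[mu]_s \int[mu]_r (cmod (H s r))%:E < +oo)%E.
  apply: (@le_lt_trans _ _ (\int[mu]_s (((v s)^-1 ^+ 2)%:E + A%:E * q s))%E).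
    apply: ge0_le_integral => //.
    - by move=> s _; apply: integral_ge0 => r _; rewrite lee_fin cmod_ge0.
    - have mc : measurable_fun setT (fun p : R * R => (cmod (H p.1 p.2))%:E).
        by apply/measurable_EFinP; exact: measurable_cmod.
      by apply: (measurable_tonelli mc) => p; rewrite lee_fin cmod_ge0.
    - apply: emeasurable_funD; first by apply/measurable_EFinP; exact: (mvV2 sv).
      by apply: emeasurable_funM => //; exact: measurable_cst.
    move=> s _; have vi : 0 < (v s)^-1 by rewrite invr_gt0 (v_gt0 sv).
    have := ereal_cX_le vi (X0 s) => h.
    have := le_trans h (leeD (lexx _) (Xq s)); apply: le_trans.
    have mWe : measurable_fun setT (fun r : R => (Wt w v s * cmod (k r s))%:E).
      by apply/measurable_EFinP; apply: measurable_funM => //; exact: measurable_cmod.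
    have mHe : measurable_fun setT (fun r : R => (cmod (H s r))%:E).
      by apply/measurable_EFinP; apply: measurable_cmod; exact: (cmeas_comp mH (pair1_measurable s)).
    have Wk0 r : 0 <= Wt w v s * cmod (k r s) by rewrite mulr_ge0 ?cmod_ge0// ltW// (Wt_gt0 w sv).
    have -> : ((v s)^-1%:E * X s = \int[mu]_r ((v s)^-1%:E * (Wt w v s * cmod (k r s))%:E))%E.
      by rewrite ge0_integralZl//; solve [exact: mWe|move=> r _; rewrite lee_fin; exact: Wk0|rewrite lee_fin ltW//].
    apply: ge0_le_integral => //.
    - by move=> r _; rewrite lee_fin cmod_ge0.
    - by apply: emeasurable_funM => //; exact: measurable_cst.
    move=> r _; rewrite -EFinM lee_fin /H (cmodM (ker _ _)) mulrA /Wt mulrA mulVf ?gt_eqF ?(v_gt0 sv)//.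
    by rewrite mul1r ler_wpM2r ?cmod_ge0// ker_le.
  rewrite ge0_integralD//; last 4 first.
  - by move=> s _; rewrite lee_fin sqr_ge0.
  - by apply/measurable_EFinP; exact: (mvV2 sv).
  - by move=> s _; apply: mule_ge0 => //; rewrite lee_fin ltW.
  - by apply: emeasurable_funM => //; exact: measurable_cst.
  apply: (@le_lt_trans _ _ ((vcst v)%:E + A%:E * B%:E)%E); last by rewrite -EFinM -EFinD ltry.
  apply: leeD; first exact: vcst_le.
  rewrite ge0_integralZl//; last by rewrite lee_fin ltW.
  by apply: lee_wpmul2l => //; rewrite lee_fin ltW.
transitivity (cint (fun s => cint (H s))); last exact: (cfubini mH bH).
(* For fixed [s] the integrability in [r] is known only almost everywhere, and for [H s]; dividing
   by the nonvanishing kernel transfers it to [k]. *)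
apply: cint_ae; [exact: cmeas_kerM|exact: cmeas_cint|].
apply: ae_imp (cfubini_ae mH bH) => s iH.
rewrite -cintZ// /kk.
have := cintegrableZ (ker z s)^-1 iH; congr cintegrable; apply/funext => r.
by rewrite /H mulrA mulVf ?mul1r// cexp_neq0.
Qed.
End SP.
End Superposition.

(** * Convolution in the weighted space *)

Section Convolution.
Context {R : realType}.
Notation mu := (@lebesgue_measure R).
Variables (w : R) (v : R -> R).
Hypothesis w0 : 0 <= w.
Hypothesis sv : strongly_admissible v.
Variable K : R.
Hypothesis K1 : 1 <= K.
Hypothesis vK : forall s t, v (s + t) <= K * (v s + v t).
Local Notation W := (Wt w v).
Implicit Types a g : R -> Cplx R.

Let v0 := v_gt0 sv.
Let v1 := v_ge1 sv.
Let W0 := Wt_gt0 w sv.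

Lemma expw_sub (q s : R) : expR (w * `|s|) <= expR (w * `|q|) * expR (w * `|s - q|).
Proof.
rewrite -expRD ler_expR -mulrDr ler_wpM2l//.
by have := ler_normD q (s - q); rewrite subrKC.
Qed.

(** Each summand carries [v] on one argument only, so one factor of a convolution can be measured in
    L^1 and the other in L^2. *)
Lemma Wt_sub (q s : R) : W s <= K * (W q * expR (w * `|s - q|) + expR (w * `|q|) * W (s - q)).
Proof.
have h := vK q (s - q); rewrite subrKC in h.
apply: (@le_trans _ _ (K * (v q + v (s - q)) * (expR (w * `|q|) * expR (w * `|s - q|)))).
  by rewrite /Wt; apply: ler_pM => //; [exact: ltW (v0 s)|exact: expw_sub].
by rewrite /Wt le_eqVlt; apply/orP; left; apply/eqP; ring.
Qed.

(** A coarser form through [1 <= v], enough when one factor has an integrable weighted majorant. *)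
Lemma Wt_submul (q s : R) : W s <= 2 * K * (W q * W (s - q)).
Proof.
apply: le_trans (Wt_sub q s) _; rewrite /Wt.
have a1 : v q * expR (w * `|q|) * expR (w * `|s - q|) <= v q * expR (w * `|q|) * (v (s - q) * expR (w * `|s - q|)).
  by rewrite ler_wpM2l ?mulr_ge0 ?expR_ge0 ?(ltW (v0 _))// ler_peMl ?expR_ge0.
have a2 : expR (w * `|q|) * (v (s - q) * expR (w * `|s - q|)) <= v q * expR (w * `|q|) * (v (s - q) * expR (w * `|s - q|)).
  by rewrite ler_wpM2r ?mulr_ge0 ?expR_ge0 ?(ltW (v0 _))// ler_peMl ?expR_ge0.
have -> : 2 * K * (v q * expR (w * `|q|) * (v (s - q) * expR (w * `|s - q|))) =
  K * (v q * expR (w * `|q|) * (v (s - q) * expR (w * `|s - q|)) + v q * expR (w * `|q|) * (v (s - q) * expR (w * `|s - q|))) by ring.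
by rewrite ler_wpM2l ?lerD// (le_trans ler01).
Qed.

Definition conv (a g : R -> Cplx R) : R -> Cplx R := fun s => cint (fun q => a q * g (s - q)).

Lemma measurable_sub2 : measurable_fun setT (fun p : R * R => p.2 - p.1).
Proof. by apply: measurable_funB; [exact: measurable_snd|exact: measurable_fst]. Qed.

Lemma cmeas_conv_kernel a g : cmeas a -> cmeas g ->
  cmeas (fun p : R * R => a p.1 * g (p.2 - p.1)).
Proof.
move=> ma mg; apply: cmeasM; first exact: (cmeas_comp ma measurable_fst).
exact: (cmeas_comp mg measurable_sub2).
Qed.

Lemma conv_kernel_hat a g z : `|imC z| <= w -> L2W w v g -> forall q,
  hat (fun s => a q * g (s - q)) z = ker z q * a q * hat g z.
Proof.
move=> zw Lg q; have mg := Lg.1.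
have m1 : cmeas (fun s : R => ker z (s + q) * (a q * g s)).
  apply: cmeasM; first by apply: cmeas_ker2; [exact: cmeas_cst|exact: measurable_funD].
  by apply: cmeasM => //; exact: cmeas_cst.
rewrite /hat -(cintZ (ker z q * a q) (hat_integrable sv zw Lg)).
have := cint_shift (- q) m1; rewrite (_ : (fun x => _) = fun s => ker z s * (a q * g (s - q))); last first.
  by apply/funext => s; rewrite subrK.
by move=> ->; congr cint; apply/funext => s; rewrite kerDs; ring.
Qed.

Lemma nsq_translate g q : cmeas g ->
  (\int[mu]_s ((W (s - q) * cmod (g (s - q))) ^+ 2)%:E = nsq w v g)%E.
Proof.
move=> mg; rewrite /nsq.
have mf : measurable_fun setT (fun s => ((W s * cmod (g s)) ^+ 2)%:E) by apply/measurable_EFinP; exact: mnsq.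
have := ge0_integral_affine (- q) (ltr01 : (0 : R) < 1) mf; rewrite mul1e => ->.
  by apply: eq_integral => s _; rewrite mul1r.
by move=> s; rewrite lee_fin sqr_ge0.
Qed.

Section small_kernel.
Variables (a g : R -> Cplx R) (be : R -> R) (A : R).
Hypothesis ma : cmeas a.
Hypothesis Lg : L2W w v g.
Hypothesis mbe : measurable_fun setT be.
Hypothesis abe : forall q, W q * cmod (a q) <= be q.
Hypothesis A0 : 0 < A.
Hypothesis beA : (\int[mu]_q (be q)%:E <= A%:E)%E.

Let K0 : 0 < K. Proof. exact: lt_le_trans ltr01 K1. Qed.
Let be0 q : 0 <= be q.
Proof. by apply: le_trans (abe q); rewrite mulr_ge0 ?cmod_ge0// ltW. Qed.

(** Schur data for Young's inequality: the majorant [be] is split evenly between [P] and [Q], and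
    [Q] takes the square of the translated [g]. *)
Let P (q s : R) := 2 * K * be q.
Let Q (q s : R) := 2 * K * be q * (W (s - q) * cmod (g (s - q))) ^+ 2.
Let AA := 2 * K * A.
Let BB := 2 * K * A * nW w v g ^+ 2.

Let cK : 0 <= 2 * K. Proof. by rewrite mulr_ge0// ltW. Qed.
Let mQ : measurable_fun setT (fun p : R * R => Q p.1 p.2).
Proof.
apply: measurable_funM; first by apply: measurable_funM => //; exact: (measurableT_comp mbe measurable_fst).
exact: (measurableT_comp (mnsq w sv Lg.1) measurable_sub2).
Qed.
Let mP s : measurable_fun setT (fun r => P r s). Proof. exact: measurable_funM. Qed.
Let P0 r s : 0 <= P r s. Proof. exact: mulr_ge0. Qed.
Let Q0 r s : 0 <= Q r s. Proof. by apply: mulr_ge0 => //; [exact: mulr_ge0|exact: sqr_ge0]. Qed.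
Let kPQ r s : (W s * cmod (a r * g (s - r))) ^+ 2 <= P r s * Q r s.
Proof.
have -> : P r s * Q r s = (2 * K * be r * (W (s - r) * cmod (g (s - r)))) ^+ 2 by rewrite /P /Q; ring.
have X0 : 0 <= W (s - r) * cmod (g (s - r)) by rewrite mulr_ge0 ?cmod_ge0// ltW.
rewrite ler_sqr ?nnegrE; last 2 first.
- by rewrite mulr_ge0 ?cmod_ge0// ltW.
- by rewrite mulr_ge0// mulr_ge0.
rewrite cmodM; apply: (@le_trans _ _ (2 * K * (W r * W (s - r)) * (cmod (a r) * cmod (g (s - r))))).
  by rewrite ler_wpM2r ?mulr_ge0 ?cmod_ge0// Wt_submul.
rewrite (_ : _ * (_ * _) = (2 * K * (W (s - r) * cmod (g (s - r)))) * (W r * cmod (a r))); last by ring.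
rewrite (_ : 2 * K * be r * _ = (2 * K * (W (s - r) * cmod (g (s - r)))) * be r); last by ring.
by rewrite ler_wpM2l// mulr_ge0.
Qed.
Let AA0 : 0 < AA. Proof. by rewrite /AA !mulr_gt0. Qed.
Let PA s : (\int[mu]_r (P r s)%:E <= AA%:E)%E.
Proof.
rewrite /P /AA EFinM; under eq_integral do rewrite EFinM.
rewrite ge0_integralZl//; [|exact/measurable_EFinP|by move=> r _; rewrite lee_fin].
by apply: lee_wpmul2l.
Qed.
Let QB : (\int[mu]_r \int[mu]_s (Q r s)%:E <= BB%:E)%E.
Proof.
have E r : (\int[mu]_s (Q r s)%:E = (2 * K * nW w v g ^+ 2)%:E * (be r)%:E)%E.
  rewrite /Q; under eq_integral do rewrite EFinM.
  rewrite ge0_integralZl//.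
  - by rewrite nsq_translate ?(nW_sq Lg) -?EFinM; [congr EFin; ring|exact: Lg.1].
  - by apply/measurable_EFinP; apply: (measurableT_comp (mnsq w sv Lg.1)); exact: measurable_funB.
  - by move=> s _; rewrite lee_fin sqr_ge0.
  - by rewrite lee_fin mulr_ge0.
under eq_integral do rewrite E.
have c0 : 0 <= 2 * K * nW w v g ^+ 2 by rewrite mulr_ge0// sqr_ge0.
rewrite ge0_integralZl//; [|exact/measurable_EFinP|by move=> r _; rewrite lee_fin].
have -> : BB = 2 * K * nW w v g ^+ 2 * A by rewrite /BB; ring.
by rewrite (EFinM _ A); apply: lee_wpmul2l.
Qed.

Let mk := cmeas_conv_kernel ma Lg.1.

Lemma conv_L2W : L2W w v (conv a g).
Proof. exact: (superpose_L2W sv mk mP mQ P0 Q0 kPQ AA0 PA QB). Qed.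

Lemma conv_nW : nW w v (conv a g) <= 2 * K * A * nW w v g.
Proof.
apply: nW_le; first by rewrite !mulr_ge0 ?nW_ge0// ltW.
have := superpose_nsq sv mk mP mQ P0 Q0 kPQ AA0 PA QB.
by congr (_ <= _%:E)%E; rewrite /AA /BB; ring.
Qed.

Lemma conv_hat z : `|imC z| <= w -> cintegrable (fun q => ker z q * a q) ->
  hat (conv a g) z = hat a z * hat g z.
Proof.
move=> zw ia; rewrite (superpose_hat sv mk mP mQ P0 Q0 kPQ AA0 PA QB zw).
rewrite [in RHS]/hat -[RHS]cintZr//; congr cint; apply/funext => q.
by rewrite (conv_kernel_hat _ zw Lg).
Qed.
End small_kernel.

Section algebra.
Variables (a g : R -> Cplx R) (M1 M2 : R).
Hypothesis La : L2W w v a.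
Hypothesis Lg : L2W w v g.
Hypothesis M10 : 0 < M1.
Hypothesis M20 : 0 < M2.
Hypothesis aM : nW w v a <= M1.
Hypothesis gM : nW w v g <= M2.

Let e (s : R) := expR (w * `|s|).
Let c := Num.sqrt (vcst v).
(** Dividing by the norm bounds [M1] and [M2] keeps the integral of [P] at most [2 * c] whatever the
    sizes of [a] and [g]; [Q] puts them back, so the final estimate is bilinear. *)
Let P (q s : R) := e q * cmod (a q) / M1 + e (s - q) * cmod (g (s - q)) / M2.
Let Q (q s : R) := 2 * K ^+ 2 * ((W q * cmod (a q)) ^+ 2 * M2 * (e (s - q) * cmod (g (s - q)))
   + M1 * (e q * cmod (a q)) * (W (s - q) * cmod (g (s - q))) ^+ 2).

Let e0 s : 0 <= e s. Proof. exact: expR_ge0. Qed.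
Let c0 : 0 < c. Proof. by rewrite sqrtr_gt0 (vcst_gt0 v). Qed.
Let M1ge : 0 <= M1. Proof. exact: ltW. Qed.
Let M2ge : 0 <= M2. Proof. exact: ltW. Qed.
Let cge : 0 <= c. Proof. exact: ltW. Qed.
Let mea : measurable_fun setT (fun s => e s * cmod (a s)).
Proof. by apply: measurable_funM; [exact: mexpw|apply: measurable_cmod; exact: La.1]. Qed.
Let meg : measurable_fun setT (fun s => e s * cmod (g s)).
Proof. by apply: measurable_funM; [exact: mexpw|apply: measurable_cmod; exact: Lg.1]. Qed.

Let l1 (f : R -> Cplx R) M : L2W w v f -> nW w v f <= M ->
  (\int[mu]_s (e s * cmod (f s))%:E <= (c * M)%:E)%E.
Proof.
move=> Lf fM; have [i1 b1] := L1_norm sv Lf.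
rewrite -(fineK (integrable_fin_num measurableT i1)) lee_fin.
by apply: le_trans b1 _; rewrite ler_wpM2l ?sqrtr_ge0.
Qed.

Let l2 (f : R -> Cplx R) M : L2W w v f -> nW w v f <= M ->
  (nsq w v f <= (M ^+ 2)%:E)%E.
Proof.
move=> Lf fM; rewrite (nW_sq Lf) lee_fin ler_sqr ?nnegrE ?nW_ge0//.
exact: le_trans (nW_ge0 _ _ _) fM.
Qed.

Let mQ : measurable_fun setT (fun p : R * R => Q p.1 p.2).
Proof.
apply: measurable_funM => //; apply: measurable_funD; apply: measurable_funM.
- by apply: measurable_funM => //; exact: (measurableT_comp (mnsq w sv La.1) measurable_fst).
- exact: (measurableT_comp meg measurable_sub2).
- by apply: measurable_funM => //; exact: (measurableT_comp mea measurable_fst).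
- exact: (measurableT_comp (mnsq w sv Lg.1) measurable_sub2).
Qed.
Let mS s : measurable_fun setT (fun r : R => s - r).
Proof. exact: measurable_funB. Qed.
Let mP s : measurable_fun setT (fun r => P r s).
Proof.
apply: measurable_funD; apply: measurable_funM => //.
exact: (measurableT_comp meg (mS s)).
Qed.
Let ea0 (f : R -> Cplx R) s : 0 <= e s * cmod (f s). Proof. by rewrite mulr_ge0 ?cmod_ge0. Qed.
Let Wa0 (f : R -> Cplx R) s : 0 <= W s * cmod (f s). Proof. by rewrite mulr_ge0 ?cmod_ge0// ltW. Qed.
Let P0 r s : 0 <= P r s.
Proof. by rewrite addr_ge0// divr_ge0// ltW. Qed.
Let Q0 r s : 0 <= Q r s.
Proof.
apply: mulr_ge0; first by rewrite mulr_ge0// sqr_ge0.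
apply: addr_ge0; apply: mulr_ge0 => //; rewrite ?sqr_ge0//.
  by rewrite mulr_ge0 ?sqr_ge0// ltW.
by rewrite mulr_ge0// ltW.
Qed.

(* [(x1 y2' + x1' y2)^2 <= 2 (x1'/M1 + y2'/M2) (M2 x1^2 y2' + M1 x1' y2^2)], homogeneous in each factor. *)
Let kPQ r s : (W s * cmod (a r * g (s - r))) ^+ 2 <= P r s * Q r s.
Proof.
have := Wt_sub r s; rewrite /P /Q cmodM -/(e r) -/(e (s - r)).
have := W0 s; have := W0 r; have := W0 (s - r); have := e0 r; have := e0 (s - r).
have := cmod_ge0 (a r); have := cmod_ge0 (g (s - r)).
move: (cmod (a r)) (cmod (g _)) (e r) (e (s - r)) (W (s - r)) (W r) (W s) => x y er es Ws Wr Wss y0 x0 es0 er0 Ws0 Wr0 Wss0 h.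
have K0 : 0 <= K by exact: le_trans ler01 K1.
apply: (@le_trans _ _ ((K * (Wr * es + er * Ws) * (x * y)) ^+ 2)).
  have xy0 : 0 <= x * y by exact: mulr_ge0.
  have le1 : Wss * (x * y) <= K * (Wr * es + er * Ws) * (x * y) by exact: ler_wpM2r.
  have A1 : 0 <= Wss * (x * y) by exact: mulr_ge0 (ltW Wss0) xy0.
  by rewrite ler_sqr ?nnegrE//; exact: le_trans A1 le1.
have -> : (K * (Wr * es + er * Ws) * (x * y)) ^+ 2 = K ^+ 2 * ((Wr * x) * (es * y) + (er * x) * (Ws * y)) ^+ 2 by ring.
have -> : (er * x / M1 + es * y / M2) * (2 * K ^+ 2 * ((Wr * x) ^+ 2 * M2 * (es * y) + M1 * (er * x) * (Ws * y) ^+ 2)) =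
  K ^+ 2 * (2 * (((Wr * x) * (es * y)) ^+ 2 + ((er * x) * (Ws * y)) ^+ 2 +
    (er * x / M1 * (Wr * x) ^+ 2 * M2 * (es * y) + es * y / M2 * M1 * (er * x) * (Ws * y) ^+ 2))).
  by field; rewrite !gt_eqF.
rewrite ler_wpM2l ?sqr_ge0//.
have p1 : 0 <= er * x / M1 * (Wr * x) ^+ 2 * M2 * (es * y).
  by rewrite !mulr_ge0 ?sqr_ge0 ?invr_ge0// ltW.
have p2 : 0 <= es * y / M2 * M1 * (er * x) * (Ws * y) ^+ 2.
  by rewrite !mulr_ge0 ?sqr_ge0 ?invr_ge0// ltW.
have gen (A B p q : R) : 0 <= p -> 0 <= q -> (A + B) ^+ 2 <= 2 * (A ^+ 2 + B ^+ 2 + (p + q)).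
  by have := sqr_ge0 (A - B); rewrite sqrrB sqrrD; lra.
exact: gen p1 p2.
Qed.

Let AA := 2 * c.
Let BB := 4 * K ^+ 2 * c * M1 ^+ 2 * M2 ^+ 2.
Let AA0 : 0 < AA. Proof. by rewrite mulr_gt0. Qed.

Let int_reflect (f : R -> R) s : measurable_fun setT f -> (forall x, 0 <= f x) ->
  (\int[mu]_r (f (s - r))%:E = \int[mu]_r (f r)%:E)%E.
Proof.
move=> mf f0; have mfe : measurable_fun setT (fun x => (f x)%:E) by exact/measurable_EFinP.
have f0e x : (0 <= (f x)%:E)%E by rewrite lee_fin.
have := ge0_integral_affine s (ltr01 : (0 : R) < 1) mfe f0e; rewrite mul1e => ->.
have mg2 : measurable_fun setT (fun x : R => (f (1 * x + s))%:E).
  by apply/measurable_EFinP; apply: (measurableT_comp mf); exact: measurable_affine.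
rewrite (ge0_integralN mg2); last by move=> x; rewrite lee_fin.
by apply: eq_integral => r _; rewrite mul1r addrC.
Qed.

Let PA s : (\int[mu]_r (P r s)%:E <= AA%:E)%E.
Proof.
have i1 : (\int[mu]_r ((e r * cmod (a r)) / M1)%:E <= c%:E)%E.
  under eq_integral do rewrite mulrC EFinM.
  rewrite ge0_integralZl//; [|exact/measurable_EFinP|by move=> r _; rewrite lee_fin|by rewrite lee_fin invr_ge0 ltW].
  apply: le_trans (lee_wpmul2l _ (l1 La aM)) _; first by rewrite lee_fin invr_ge0 ltW.
  by rewrite -EFinM lee_fin mulrCA mulVf ?mulr1// gt_eqF.
have i2 : (\int[mu]_r ((e (s - r) * cmod (g (s - r))) / M2)%:E <= c%:E)%E.
  under eq_integral do rewrite mulrC EFinM.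
  rewrite ge0_integralZl//; last 3 first.
  - by apply/measurable_EFinP; exact: (measurableT_comp meg (mS s)).
  - by move=> r _; rewrite lee_fin.
  - by rewrite lee_fin invr_ge0 ltW.
  rewrite (int_reflect s meg)//.
  apply: le_trans (lee_wpmul2l _ (l1 Lg gM)) _; first by rewrite lee_fin invr_ge0 ltW.
  by rewrite -EFinM lee_fin mulrCA mulVf ?mulr1// gt_eqF.
rewrite /P; under eq_integral do rewrite EFinD.
rewrite ge0_integralD//.
- by rewrite /AA (_ : 2 * c = c + c) ?EFinD; [exact: leeD|ring].
- by move=> r _; rewrite lee_fin divr_ge0// ltW.
- by apply/measurable_EFinP; exact: measurable_funM.
- by move=> r _; rewrite lee_fin divr_ge0// ltW.
- by apply/measurable_EFinP; apply: measurable_funM => //; exact: (measurableT_comp meg (mS s)).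
Qed.

Let int_translate (f : R -> R) q : measurable_fun setT f -> (forall x, 0 <= f x) ->
  (\int[mu]_s (f (s - q))%:E = \int[mu]_s (f s)%:E)%E.
Proof.
move=> mf f0; have mfe : measurable_fun setT (fun x => (f x)%:E) by exact/measurable_EFinP.
have f0e x : (0 <= (f x)%:E)%E by rewrite lee_fin.
have := ge0_integral_affine (- q) (ltr01 : (0 : R) < 1) mfe f0e; rewrite mul1e => ->.
by apply: eq_integral => r _; rewrite mul1r.
Qed.

Let QB : (\int[mu]_r \int[mu]_s (Q r s)%:E <= BB%:E)%E.
Proof.
pose C1 := 2 * K ^+ 2 * M2 * (c * M2); pose C2 := 2 * K ^+ 2 * M1 * M2 ^+ 2.
have K20 : 0 <= 2 * K ^+ 2 by rewrite mulr_ge0// sqr_ge0.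
have C10 : 0 <= C1 by rewrite /C1 (mulr_ge0 (mulr_ge0 K20 M2ge))// mulr_ge0.
have C20 : 0 <= C2 by rewrite /C2 (mulr_ge0 (mulr_ge0 K20 M1ge))// sqr_ge0.
have E r : (\int[mu]_s (Q r s)%:E <= C1%:E * ((W r * cmod (a r)) ^+ 2)%:E + C2%:E * (e r * cmod (a r))%:E)%E.
  have [D1 D1E] : exists D1, D1 = 2 * K ^+ 2 * (W r * cmod (a r)) ^+ 2 * M2 by exists (2 * K ^+ 2 * (W r * cmod (a r)) ^+ 2 * M2).
  have [D2 D2E] : exists D2, D2 = 2 * K ^+ 2 * M1 * (e r * cmod (a r)) by exists (2 * K ^+ 2 * M1 * (e r * cmod (a r))).
  have QE s : Q r s = D1 * (e (s - r) * cmod (g (s - r))) + D2 * (W (s - r) * cmod (g (s - r))) ^+ 2.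
    by rewrite D1E D2E /Q; ring.
  have d1 : 0 <= D1 by rewrite D1E (mulr_ge0 (mulr_ge0 K20 (sqr_ge0 _)) M2ge).
  have d2 : 0 <= D2 by rewrite D2E (mulr_ge0 (mulr_ge0 K20 M1ge) (ea0 _ _)).
  have me1 : measurable_fun setT (fun s : R => (e (s - r) * cmod (g (s - r)))%:E).
    by apply/measurable_EFinP; apply: (measurableT_comp meg); exact: measurable_funB.
  have me2 : measurable_fun setT (fun s : R => ((W (s - r) * cmod (g (s - r))) ^+ 2)%:E).
    by apply/measurable_EFinP; apply: (measurableT_comp (mnsq w sv Lg.1)); exact: measurable_funB.
  under eq_integral do rewrite QE EFinD (EFinM D1) (EFinM D2).
  rewrite ge0_integralD//; last 4 first.
  - by move=> s _; rewrite mule_ge0// lee_fin.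
  - by apply: emeasurable_funM => //; exact: measurable_cst.
  - by move=> s _; rewrite mule_ge0// lee_fin// sqr_ge0.
  - by apply: emeasurable_funM => //; exact: measurable_cst.
  rewrite !ge0_integralZl//; try by [move=> s _; rewrite lee_fin|move=> s _; rewrite lee_fin sqr_ge0].
  rewrite (int_translate r meg)// nsq_translate; last exact: Lg.1.
  apply: leeD.
    apply: le_trans (lee_wpmul2l _ (l1 Lg gM)) _; first by rewrite lee_fin.
    by rewrite -!EFinM lee_fin le_eqVlt; apply/orP; left; apply/eqP; rewrite D1E /C1; ring.
  apply: le_trans (lee_wpmul2l _ (l2 Lg gM)) _; first by rewrite lee_fin.
  by rewrite -!EFinM lee_fin le_eqVlt; apply/orP; left; apply/eqP; rewrite D2E /C2; ring.
have m1 : measurable_fun setT (fun r => ((W r * cmod (a r)) ^+ 2)%:E) by apply/measurable_EFinP; exact: (mnsq w sv La.1).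
have m2 : measurable_fun setT (fun r => (e r * cmod (a r))%:E) by exact/measurable_EFinP.
have mQe : measurable_fun setT (fun p : R * R => (Q p.1 p.2)%:E) by exact/measurable_EFinP.
apply: (@le_trans _ _ (\int[mu]_r (C1%:E * ((W r * cmod (a r)) ^+ 2)%:E + C2%:E * (e r * cmod (a r))%:E))%E).
  apply: ge0_le_integral => //.
  - by move=> r _; apply: integral_ge0 => s _; rewrite lee_fin.
  - by apply: (measurable_tonelli mQe) => p; rewrite lee_fin.
  - by apply: emeasurable_funD; apply: emeasurable_funM => //; exact: measurable_cst.
rewrite ge0_integralD//; last 4 first.
- by move=> s _; rewrite mule_ge0// lee_fin// sqr_ge0.
- by apply: emeasurable_funM => //; exact: measurable_cst.
- by move=> s _; rewrite mule_ge0// lee_fin.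
- by apply: emeasurable_funM => //; exact: measurable_cst.
rewrite !ge0_integralZl//; try by [move=> s _; rewrite lee_fin|move=> s _; rewrite lee_fin sqr_ge0].
apply: (@le_trans _ _ (C1%:E * (M1 ^+ 2)%:E + C2%:E * (c * M1)%:E)%E).
  by apply: leeD; apply: lee_wpmul2l; [rewrite lee_fin|exact: l2|rewrite lee_fin|exact: l1].
by rewrite -!EFinM -EFinD lee_fin le_eqVlt; apply/orP; left; apply/eqP; rewrite /C1 /C2 /BB; ring.
Qed.

Let mk := cmeas_conv_kernel La.1 Lg.1.

Lemma algebra_L2W : L2W w v (conv a g).
Proof. exact: (superpose_L2W sv mk mP mQ P0 Q0 kPQ AA0 PA QB). Qed.

Lemma algebra_nW : nW w v (conv a g) <= 3 * K * c * M1 * M2.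
Proof.
have K0 : 0 <= K by exact: le_trans ler01 K1.
apply: nW_le; first by rewrite !mulr_ge0.
apply: le_trans (superpose_nsq sv mk mP mQ P0 Q0 kPQ AA0 PA QB) _.
rewrite lee_fin /AA /BB.
(* The constant 3 of the statement rounds up the square root of 8. *)
have -> : 2 * c * (4 * K ^+ 2 * c * M1 ^+ 2 * M2 ^+ 2) = 8 * (K * c * M1 * M2) ^+ 2 by ring.
have -> : (3 * K * c * M1 * M2) ^+ 2 = 9 * (K * c * M1 * M2) ^+ 2 by ring.
by have := sqr_ge0 (K * c * M1 * M2); lra.
Qed.

Lemma algebra_hat z : `|imC z| <= w -> hat (conv a g) z = hat a z * hat g z.
Proof.
move=> zw; rewrite (superpose_hat sv mk mP mQ P0 Q0 kPQ AA0 PA QB zw).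
rewrite -[hat a z]/(cint (fun q => ker z q * a q)) -(cintZr (hat g z) (hat_integrable sv zw La)).
by congr cint; apply/funext => q; rewrite (conv_kernel_hat _ zw Lg).
Qed.
End algebra.
End Convolution.

(** * Growth of the weight *)

Section Subexponential.
Context {R : realType}.
Notation mu := (@lebesgue_measure R).
Variable v : R -> R.
Hypothesis sv : strongly_admissible v.

Let v0 := v_gt0 sv.
Let v1 := v_ge1 sv.

(* For large [n] the sets [{|p| <= 1, v p <= n}] and [s - {|p| <= 1, v p <= n}] must meet. *)
Lemma v_bounded_near0 : exists C : R, forall s, `|s| <= 2^-1 -> v s <= C.
Proof.
(* As [|s| <= 1/2], both sets lie in [[-3/2, 3/2]], enclosed in the half-open interval [[-3/2,
   13/8[]. Its length 25/8 is less than twice 7/4, so two sets of measure above 7/4 cannot be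
   disjoint in it. *)
have ab : - (3 / 2) <= 13 / 8 :> R by lra.
have fin (x : R) : 7 / 4 < x -> x + x <= 13 / 8 - - (3 / 2) -> False by lra.
have [K K1 vK] := v_quasi sv.
pose E (n : nat) : set (measurableTypeR R) := `[-1, 1] `&` v @^-1` `]-oo, n%:R].
have mE n : measurable (E n).
  apply: measurableI => //; rewrite -[X in measurable X]setTI; apply: (mv sv) => //.
have ndE : nondecreasing_seq E.
  move=> m n mn; apply/subsetPset => x [/= h1]; rewrite !in_itv /= => h2; split => //=.
  by rewrite in_itv /= (le_trans h2)// ler_nat.
have UE : \bigcup_n E n = `[-1, 1]%classic.
  apply/seteqP; split => [x [n _ []]//|x h]; exists (Num.bound `|v x|) => //; split => //=.
  rewrite in_itv /=; apply: le_trans (ler_norm _) _; apply: ltW; exact: archi_boundP.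
have mU : measurable (\bigcup_n E n) by exact: bigcup_measurable.
have mu2 : mu `[-1, 1]%classic = 2%:E.
  rewrite lebesgue_measure_itv /= lte_fin ifT; last by lra.
  by rewrite -EFinB; congr EFin; ring.
have cvE : (mu \o E) n @[n --> \oo] --> (2%:E : \bar R).
  by rewrite -mu2 -UE; exact: (@nondecreasing_cvg_mu _ _ _ mu E mE mU ndE).
have [n hn] : exists n, ((7 / 4)%:E < mu (E n))%E.
  apply: contrapT => nex; have : (limn (mu \o E) <= (7 / 4)%:E)%E.
    apply: lime_le; first by apply/cvg_ex; exists 2%:E.
    by apply: nearW => n; rewrite leNgt; apply/negP => h; apply: nex; exists n.
  by rewrite (cvg_lim _ cvE)// lee_fin; lra.
exists (K * (n%:R + n%:R)) => s hs.
apply: contrapT => /negP; rewrite -ltNge => vs.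
pose f : R -> R := \1_(E n).
have mf : measurable_fun setT f by apply: measurable_indic; exact: mE.
have f01 p : 0 <= f p <= 1 by rewrite /f indicE; case: (_ \in _) => /=; lra.
have fE p : f p != 0 -> `|p| <= 1 /\ v p <= n%:R.
  rewrite /f indicE; case: (boolP (p \in E n)) => [|_]; last by rewrite eqxx.
  by rewrite inE => -[/=]; rewrite !in_itv /= -ler_norml.
have disj p : f p + f (s - p) <= \1_`[- (3 / 2), 13 / 8[ p.
  have fp := f01 p; have fsp := f01 (s - p).
  have [e1|/fE[h1 h2]] := eqVneq (f p) 0; have [e2|/fE[h3 h4]] := eqVneq (f (s - p)) 0.
  - by rewrite e1 e2 addr0.
  - rewrite e1 add0r indicE mem_set; first by case/andP: fsp.
    move: h3 hs; rewrite /= in_itv /= !ler_norml => /andP[? ?] /andP[? ?].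
    by apply/andP; split; lra.
  - rewrite e2 addr0 indicE mem_set; first by case/andP: fp.
    move: h1; rewrite /= in_itv /= !ler_norml => /andP[? ?].
    by apply/andP; split; lra.
  - have := vK p (s - p); rewrite subrKC => hv.
    have : K * (v p + v (s - p)) <= K * (n%:R + n%:R).
      by rewrite ler_wpM2l ?lerD// (le_trans ler01).
    by have := lt_le_trans vs hv; lra.
have iI : mu.-integrable setT (EFin \o (\1_`[- (3 / 2), 13 / 8[ : R -> R)) by exact: integrable_indic_co.
have iF (u : R -> R) : measurable_fun setT u -> (forall p, 0 <= u p <= f p + f (s - p)) ->
    mu.-integrable setT (EFin \o u).
  move=> mu' hu; apply: le_integrable iI => //; first exact/measurable_EFinP.
  move=> p _ /=; rewrite lee_fin; have /andP[u0 uf] := hu p.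
  by rewrite ger0_norm//; apply: le_trans uf (le_trans (disj p) (ler_norm _)).
have mf2 : measurable_fun setT (fun p : R => f (s - p)) by apply: (measurableT_comp mf); exact: measurable_funB.
have i1 : mu.-integrable setT (EFin \o f).
  by apply: iF => // p; have /andP[p0 _] := f01 p; have /andP[q0 _] := f01 (s - p); rewrite p0 lerDl.
have i2 : mu.-integrable setT (EFin \o (fun p => f (s - p))).
  by apply: iF => // p; have /andP[p0 _] := f01 p; have /andP[q0 _] := f01 (s - p); rewrite q0 lerDr.
have e2 : Rintegral mu setT (fun p => f (s - p)) = Rintegral mu setT f.
  have := Rintegral_affine s (ltr01 : (0 : R) < 1) mf; rewrite mul1r => ->.
  have m' : measurable_fun setT (fun x : R => f (1 * x + s)).
    by apply: (measurableT_comp mf); exact: measurable_affine.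
  rewrite -(Rintegral_opp m'); congr Rintegral; apply/funext => p.
  by rewrite mul1r addrC.
have e1 : Rintegral mu setT f > 7 / 4.
  rewrite /Rintegral /f (_ : integral _ _ _ = mu (E n)); last by rewrite integral_indic// setIT.
  rewrite -lte_fin fineK// ge0_fin_numE//; apply: le_lt_trans (ltry 2).
  by rewrite -mu2; apply: le_measure; rewrite ?inE//; exact: subIsetl.
have i12 : mu.-integrable setT (EFin \o (fun p => f p + f (s - p))).
  by rewrite /comp; under eq_fun do rewrite EFinD; exact: integrableD.
have : Rintegral mu setT (fun p => f p + f (s - p)) <= Rintegral mu setT (\1_`[- (3 / 2), 13 / 8[ : R -> R).
  by apply: le_Rintegral.
rewrite RintegralD// e2 (Rintegral_indic_co ab); exact: fin.
Qed.

(** Halving the argument costs a factor [2 * K], so the bound near 0 spreads to every ball by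
    doubling. *)
Lemma v_locally_bounded (L : R) : exists C : R, forall s, `|s| <= L -> v s <= C.
Proof.
have [K K1 vK] := v_quasi sv; have [C0 HC0] := v_bounded_near0.
have H (n : nat) : exists C : R, forall s, `|s| <= 2 ^+ n / 2 -> v s <= C.
  elim: n => [|n [C HC]]; first by exists C0 => s; rewrite expr0 mul1r; exact: HC0.
  exists (K * (C + C)) => s hs; have -> : s = s / 2 + s / 2 by field.
  have h : v (s / 2) <= C.
    apply: HC; rewrite normrM (ger0_norm (_ : 0 <= 2^-1))// ler_pM2r//.
    by apply: le_trans hs _; rewrite exprS; lra.
  by apply: le_trans (vK _ _) _; rewrite ler_wpM2l ?lerD// (le_trans ler01).
have [C HC] := H (Num.bound `|L|).+1; exists C => s hs; apply: HC.
apply: le_trans hs _; apply: le_trans (ler_norm _) _.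
apply: le_trans (ltW (archi_boundP (normr_ge0 L))) _.
rewrite exprS mulrAC divff// mul1r -natrX ler_nat.
exact/ltnW/ltn_expl.
Qed.

(** Induction on dyadic scales: passing from [s / 2] to [s] multiplies the bound on [v] by [2 * K],
    while the exponential gains [expR (d * |s| / 2)], which is larger once [|s|] exceeds [L]. *)
Lemma v_subexp (d : R) : 0 < d -> exists2 C : R, 0 < C & forall s, v s <= C * expR (d * `|s|).
Proof.
move=> d0; have [K K1 vK] := v_quasi sv.
have K0 : 0 < K := lt_le_trans ltr01 K1.
(* For [t >= L] one has [d * t / 2 >= 2 * K], hence [expR (d * t / 2) >= 2 * K]. *)
pose L := 4 * K / d; have L0 : 0 < L by rewrite divr_gt0// mulr_gt0.
have HL (t : R) : L <= t -> 2 * K <= expR (d * t / 2).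
  move=> Lt; apply: le_trans (expR_ge1Dx _); rewrite /L in Lt.
  have : 4 * K <= d * t by rewrite (mulrC d) -ler_pdivrMr.
  lra.
have [C0 HC0] := v_locally_bounded L.
have C1 : 1 <= C0 by apply: le_trans (v1 0) (HC0 _ _); rewrite normr0 ltW.
have C00 : 0 < C0 := lt_le_trans ltr01 C1.
have H (n : nat) s : `|s| <= 2 ^+ n * L -> v s <= C0 * expR (d * `|s|).
  elim: n s => [|n IH] s hs.
    rewrite expr0 mul1r in hs; apply: le_trans (HC0 _ hs) _.
    by rewrite ler_peMr ?(ltW C00)// -expR0 ler_expR mulr_ge0// ltW.
  case: (leP `|s| L) => sL.
    apply: le_trans (HC0 _ sL) _.
    by rewrite ler_peMr ?(ltW C00)// -expR0 ler_expR mulr_ge0// ltW.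
  have h2 : `|s / 2| = `|s| / 2 by rewrite normrM (ger0_norm (_ : 0 <= 2^-1)).
  have h := IH (s / 2); rewrite h2 in h.
  have {}h := h (ltac:(rewrite ler_pdivrMr//; apply: le_trans hs _; rewrite exprS; lra)).
  have sE : s = s / 2 + s / 2 by field.
  have := vK (s / 2) (s / 2); rewrite -sE => hv; apply: le_trans hv _.
  apply: (@le_trans _ _ (2 * K * (C0 * expR (d * (`|s| / 2))))).
    by rewrite (_ : K * (v (s / 2) + _) = 2 * K * v (s / 2)); [rewrite ler_wpM2l// mulr_ge0// ltW|ring].
  have := HL _ (ltW sL) => hK.
  have -> : d * `|s| = d * `|s| / 2 + d * (`|s| / 2) by field.
  rewrite expRD mulrCA ler_wpM2l ?(ltW C00)// ler_wpM2r ?expR_ge0//.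
exists C0 => // s; apply: (H (Num.bound (`|s| / L))).
have s0 : 0 <= `|s| / L by rewrite divr_ge0// ltW.
rewrite -ler_pdivrMr//; apply: le_trans (ltW (archi_boundP s0)) _.
by rewrite -natrX ler_nat; exact/ltnW/ltn_expl.
Qed.

End Subexponential.

(** * Pointwise inversion for continuous functions *)

Section InversionPointwise.
Context {R : realType}.
Notation mu := (@lebesgue_measure R).

Lemma continuous_cint (h : R -> R -> Cplx R) (b : R -> R) : (forall s, cmeas (h s)) ->
  (forall x, continuous (fun s => h s x)) -> (forall s x, cmod (h s x) <= b x) ->
  mu.-integrable setT (EFin \o b) -> continuous (fun s => cint (h s)).
Proof.
move=> mh ch hb ib s.
have H (u : nat -> Cplx R) : (forall n, setT (u n)) -> u n @[n --> \oo] --> ofR s ->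
    cint (h (reC (u n))) @[n --> \oo] --> cint (h (reC (ofR s))).
  move=> _ us; apply: (cint_dct _ _ (fun n x => hb (reC (u n)) x) ib).2 => [n|x]; first exact: mh.
  have us' : reC (u n) @[n --> \oo] --> s by have /cvgC_reim[] := us.
  exact: (cvg_comp _ _ us' (ch x s)).
move=> P /nbhsCP[e e0 eP].
have [d d0 dP] := @seq_continuity R setT (fun z => cint (h (reC z))) (ofR s) H e e0.
apply/nbhs_normP; exists d => //= t; rewrite /ball_ /= distrC => td.
by apply: eP; apply: (dP (ofR t)) => //; rewrite -ofRN -ofRD cmod_ofR.
Qed.

Lemma continuous_phase (x : R) : continuous (fun s : R => cexp (iC * ofR x * ofR s)).
Proof.
move=> s; apply: (@cvg_comp _ _ _ (fun s : R => iC * ofR x * ofR s) (@cexp R)); last exact: continuous_cexp.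
apply/cvgC_reim; split.
  under eq_fun do rewrite reCM imC_of mulr0 subr0 reC_of.
  rewrite reCM imC_of mulr0 subr0 reC_of; apply: cvgMr; exact: cvg_id.
under eq_fun do rewrite imCM imC_of mulr0 add0r reC_of.
rewrite imCM imC_of mulr0 add0r reC_of; apply: cvgMr; exact: cvg_id.
Qed.

(** The almost everywhere theorem is applied to the reflection of [h], whose transform is [hv]; both
    sides of the identity obtained are continuous, hence equal everywhere. *)
Lemma fourier_inversion_pt (h : R -> Cplx R) : continuous h -> cintegrable h ->
  let hv (s : R) := cint (fun x => h x * cexp (iC * ofR x * ofR s)) in
  cintegrable hv -> forall x, cint (fun s => ker (ofR x) s * hv s) = ofR (2 * pi) * h x.
Proof.
move=> ch ih hv ihv.
have mh : cmeas h by exact: continuous_cmeas.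
pose g s := h (- s).
have ig : cintegrable g by exact: cintegrable_opp.
have gE : (fun x : R => cint (fun s => cexp (- (iC * ofR x * ofR s)) * g s)) = hv.
  apply/funext => x; rewrite /hv.
  have m1 : cmeas (fun s => h s * cexp (iC * ofR s * ofR x)).
    by apply: cmeasM => //; exact: cmeas_phase.
  rewrite -(cint_opp m1); congr cint; apply/funext => s; rewrite mulrC; congr (_ * cexp _).
  by rewrite ofRN; ring.
have ihv' := ihv; rewrite -gE in ihv'.
have hae : {ae mu, forall s, cint (fun x => hv x * cexp (iC * ofR x * ofR s)) = ofR (2 * pi) * g s}.
  have := fourier_inversion_ae ig ihv'; apply: ae_imp => s <-; congr cint; apply/funext => x.
  by congr (_ * _); rewrite -(congr1 (@^~ x) gE).
pose D s := cint (fun x => hv x * cexp (iC * ofR x * ofR s)) + (- ofR (2 * pi)) * g s.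
have [mhv nhv] := (cintegrableP _).1 ihv.
have c1 : continuous (fun s => cint (fun x => hv x * cexp (iC * ofR x * ofR s))).
  apply: (continuous_cint _ _ _ nhv) => [s|x s|s x].
  - by apply: cmeasM => //; exact: cmeas_phase.
  - by apply: cvgMr; exact: continuous_phase.
  - by rewrite (cmodM (hv x)) cmod_phase mulr1.
have cD : continuous D.
  move=> s; apply: cvgD; first exact: c1.
  apply: cvgMr; apply: (@cvg_comp _ _ _ (fun s : R => - s) h); last exact: ch.
  by apply: cvgN; exact: cvg_id.
have D0 : {ae mu, forall s, D s = 0}.
  by apply: ae_imp hae => s E; rewrite /D E mulNr subrr.
move=> x; have /eqP := ae0_continuous cD D0 (- x).
rewrite /D mulNr subr_eq0 /g opprK => /eqP <-; congr cint; apply/funext => s.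
by rewrite mulrC /ker; congr (_ * cexp _); rewrite ofRN; ring.
Qed.

End InversionPointwise.

(** * Densities of holomorphic functions *)

Section HoloKernel.
Context {R : realType}.
Notation mu := (@lebesgue_measure R).
Variables (w w' : R) (v : R -> R).
Hypothesis w0 : 0 <= w.
Hypothesis ww' : w < w'.
Hypothesis sv : strongly_admissible v.

(** The quadratic Taylor bound [expR X >= 1 + X ^+ 2 / 2] at [X = d * |s|]. *)
Lemma expRN_abs_le_cauchyK (d : R) : 0 < d -> forall s, expR (- (d * `|s|)) <= (1 + 2 / d ^+ 2) * cauchyK s.
Proof.
move=> d0 s; rewrite expRN /cauchyK; have s0 : 0 < 1 + s ^+ 2 by rewrite ltr_pwDl// sqr_ge0.
rewrite ler_pdivlMr// mulrC ler_pdivrMr ?expR_gt0//.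
have X0 : 0 <= d * `|s| by rewrite mulr_ge0// ltW.
have := expR_ge1Dxn 1 X0; rewrite exprMn real_normK ?num_real// => h.
have c0 : 0 <= 1 + 2 / d ^+ 2 by rewrite addr_ge0// divr_ge0// sqr_ge0.
apply: le_trans (ler_wpM2l c0 h).
have -> : (2`!)%:R = 2 :> R by [].
have -> : (1 + 2 / d ^+ 2) * (1 + d ^+ 2 * s ^+ 2 / 2) = 1 + s ^+ 2 + (2 / d ^+ 2 + d ^+ 2 * s ^+ 2 / 2).
  by field; rewrite gt_eqF.
rewrite lerDl; apply: addr_ge0; first by apply: divr_ge0 => //; exact: sqr_ge0.
by apply: divr_ge0 => //; apply: mulr_ge0; exact: sqr_ge0.
Qed.

Definition cauchyJ : R := Rintegral mu setT cauchyK.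
Lemma cauchyJ_ge0 : 0 <= cauchyJ.
Proof. by apply: Rintegral_ge0 => x _; exact: cauchyK_ge0. Qed.

Lemma integrable_cauchyK_shift (A t : R) : mu.-integrable setT (EFin \o (fun x => A * cauchyK (x - t))).
Proof.
have := integrable_affine (- t) ltr01 (integrable_KcauchyK A).
by congr (mu.-integrable _ _); apply/funext => x /=; rewrite mul1r.
Qed.

Lemma Rintegral_cauchyK_shift (A t : R) : Rintegral mu setT (fun x => A * cauchyK (x - t)) = A * cauchyJ.
Proof.
rewrite /cauchyJ -RintegralZl//; last exact: integrable_cauchyK.
have m : measurable_fun setT (fun x => A * cauchyK x) by apply: measurable_funM => //; exact: measurable_cauchyK.
rewrite (Rintegral_affine (- t) ltr01 m) mul1r; congr Rintegral.
by apply/funext => x; rewrite mul1r.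
Qed.

Lemma derivable_translate (F : Cplx R -> Cplx R) (c z : Cplx R) : derivable F (z + c) 1 ->
  derivable (fun u => F (u + c)) z 1.
Proof.
move=> /derivable1_diffP dF; apply/derivable1_diffP.
apply: (@differentiable_comp _ _ _ _ (fun u => u + c) F); last exact: dF.
by apply/derivable1_diffP; exact: derivableD.
Qed.

Section one_function.
Variables (Phi : Cplx R -> Cplx R) (A t : R).

Hypothesis hP : forall x y, `|y| < w' -> derivable Phi (mkC x y) 1.
Hypothesis bP : forall x y, `|y| < w' -> cmod (Phi (mkC x y)) <= A * cauchyK (x - t).

Lemma Phi_line_integrable y : `|y| < w' -> cintegrable (fun x => Phi (mkC x y)).
Proof.
move=> yw; apply: (cintegrable_le (cmeas_line hP yw) (fun x => @bP x y yw)).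
exact: integrable_cauchyK_shift.
Qed.

Let phase_int y s := cint (fun x => Phi (mkC x y) * cexp (iC * ofR x * ofR s)).

Lemma cmod_phase_int y s : `|y| < w' -> cmod (phase_int y s) <= A * cauchyJ.
Proof.
move=> yw; rewrite -(Rintegral_cauchyK_shift A t); apply: cmod_cint_dom.
- by apply: cmeasM; [exact: (cmeas_line hP yw)|exact: cmeas_phase].
- by move=> x; rewrite (cmodM (Phi _)) cmod_phase mulr1; exact: bP.
- exact: integrable_cauchyK_shift.
Qed.

(** Contour shift from height 0 to height [y], the phase contributing [expR (- (y * s))].
    Translating by [t] centres the decay at 0, as [contour_shift] requires. *)
Lemma phase_int_shift y s : `|y| < w' -> phase_int 0 s = phase_int y s * ofR (expR (- (y * s))).
Proof.
move=> yw; have w'0 : 0 < w' := le_lt_trans w0 ww'.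
pose F z := Phi (z + ofR t) * cexp (iC * (z + ofR t) * ofR s).
have mkt x y' : mkC x y' + ofR t = mkC (x + t) y' by apply: eqC; rewrite !reimE ?addr0.
have hF x y' : `|y'| < w' -> derivable F (mkC x y') 1.
  move=> yw'; apply: derivableM.
    by apply: derivable_translate; rewrite mkt; exact: hP.
  apply: derivable_cexp_comp; apply: derivableM; last exact: derivable_cst.
  apply: derivableM; first exact: derivable_cst.
  by apply: derivableD; [exact: derivable_id|exact: derivable_cst].
have bF x y' : `|y'| < w' -> cmod (F (mkC x y')) <= A * expR (w' * `|s|) * cauchyK x.
  move=> yw'; rewrite /F mkt (cmodM (Phi _)) [leRHS]mulrAC; apply: ler_pM; rewrite ?cmod_ge0//.
    by have := bP (x + t) yw'; rewrite addrK.
  rewrite cmod_cexp !reimE ler_expR.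
  have -> : (0 * (x + t) - 1 * y') * s - (0 * y' + 1 * (x + t)) * 0 = - (y' * s) by ring.
  by apply: le_trans (ler_norm _) _; rewrite normrN normrM ler_wpM2r// ltW.
have n0 : `|0 : R| < w' by rewrite normr0.
have := contour_shift hF bF n0 yw.
have E y' : `|y'| < w' -> cint (fun x => F (mkC x y')) = phase_int y' s * ofR (expR (- (y' * s))).
  move=> yw'; pose H x := Phi (mkC x y') * cexp (iC * mkC x y' * ofR s).
  have HE x : H x = Phi (mkC x y') * cexp (iC * ofR x * ofR s) * ofR (expR (- (y' * s))).
    rewrite /H -[RHS]mulrA; congr (_ * _); rewrite -cexp_ofR -cexpD; congr cexp.
    by apply: eqC; rewrite !reimE; ring.
  have mH : cmeas H.
    apply: cmeasM; first exact: (cmeas_line hP yw').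
    apply: cmeas_cexp; apply: cmeasM; last exact: cmeas_cst.
    apply: cmeasM; first exact: cmeas_cst.
    by split; [exact: measurable_id|exact: (measurable_cst y')].
  have -> : (fun x => F (mkC x y')) = fun x => H (x + t) by apply/funext => x; rewrite /F /H mkt.
  rewrite (cint_shift t mH) (funext HE) cintZr//.
  have [mP nP] := (cintegrableP _).1 (Phi_line_integrable yw'); apply: (cintegrable_le _ _ nP).
    by apply: cmeasM => //; exact: cmeas_phase.
  by move=> x; rewrite (cmodM (Phi _)) cmod_phase mulr1.
by rewrite !E// mul0r oppr0 expR0 ofR1 mulr1.
Qed.

Let a := invFT Phi.

Lemma invFT_phase_int s : a s = (ofR (2 * pi))^-1 * phase_int 0 s.
Proof.
rewrite /a invFT_E//; apply: Phi_line_integrable; rewrite normr0.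
exact: le_lt_trans w0 ww'.
Qed.

Lemma pi2_gt0 : 0 < 2 * pi :> R. Proof. by rewrite mulr_gt0// pi_gt0. Qed.

Lemma invFT_decay sg s : 0 <= sg < w' -> cmod (a s) <= (2 * pi)^-1 * (A * cauchyJ) * expR (- (sg * `|s|)).
Proof.
move=> /andP[sg0 sgw]; rewrite invFT_phase_int (cmodM (_^-1)) cmodV cmod_ofR (gtr0_norm pi2_gt0) -mulrA.
rewrite ler_wpM2l ?invr_ge0 ?(ltW pi2_gt0)//.
(* The contour is moved up or down according to the sign of [s], so that the exponential factor
   always decays. *)
have [y yw yE] : exists2 y : R, `|y| < w' & y * s = sg * `|s|.
  case: (leP 0 s) => s0; first by exists sg; rewrite ger0_norm.
  by exists (- sg); rewrite ?normrN ger0_norm// mulrNN || rewrite ltr0_norm// mulNr mulrN.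
rewrite (phase_int_shift s yw) (cmodM (phase_int _ _)) cmod_ofR yE (ger0_norm (expR_ge0 _)).
by rewrite ler_wpM2r ?expR_ge0// cmod_phase_int.
Qed.

Lemma cmeas_invFT_Phi : cmeas a.
Proof.
have w'0 : `|0 : R| < w' by rewrite normr0; exact: le_lt_trans w0 ww'.
have -> : a = fun s => (ofR (2 * pi))^-1 * phase_int 0 s by apply/funext => s; rewrite invFT_phase_int.
apply: cmeasM; first exact: cmeas_cst.
apply: (@cmeas_cint _ (fun s x => Phi (mkC x 0) * cexp (iC * ofR x * ofR s))).
apply: cmeasM; first exact: (cmeas_comp (cmeas_line hP w'0) measurable_snd).
apply: cmeas_cexp; apply: cmeasM; last exact: (cmeas_ofR measurable_fst).
by apply: cmeasM; [exact: cmeas_cst|exact: (cmeas_ofR measurable_snd)].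
Qed.

(** Pointwise inversion on the horizontal line through [z]: by the contour shift the inverse
    transform there is [a s * expR (imC z * s)], which [hB] makes integrable. *)
Lemma hat_invFT_Phi z (B : R) : `|imC z| <= w -> (forall q, expR (w * `|q|) * cmod (a q) <= B * cauchyK q) ->
  cintegrable (fun q => ker z q * a q) /\ hat a z = Phi z.
Proof.
move=> zw hB; have iB := integrable_KcauchyK B.
have ka q : cmod (ker z q * a q) <= B * cauchyK q.
  by apply: le_trans (hB q); exact: ker_dom.
have ik : cintegrable (fun q => ker z q * a q).
  by apply: (cintegrable_le _ ka iB); apply: cmeas_kerM; exact: cmeas_invFT_Phi.
split => //.
have yw : `|imC z| < w' := le_lt_trans zw ww'.
have zE : z = mkC (reC z) (imC z) by case: (z).
pose h x := Phi (mkC x (imC z)).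
have ch : continuous h.
  move=> x; apply: (@continuous_hline _ Phi (imC z) x); apply: derivableC_continuous; exact: hP.
have hvE s : phase_int (imC z) s = ofR (2 * pi) * (a s * ofR (expR (imC z * s))).
  rewrite invFT_phase_int (phase_int_shift s yw) mulrA mulrA divff ?ofR2pi_neq0// mul1r.
  by rewrite -mulrA -ofRM -expRD addNr expR0 ofR1 mulr1.
have kE s : ker (ofR (reC z)) s * (a s * ofR (expR (imC z * s))) = ker z s * a s.
  rewrite [in RHS]zE mulrCA mulrC; congr (_ * _); rewrite /ker -cexp_ofR -cexpD; congr cexp.
  by apply: eqC; rewrite !reimE; ring.
have ihv : cintegrable (phase_int (imC z)).
  apply: (@cintegrable_le _ _ (fun s => 2 * pi * (B * cauchyK s))).
  - rewrite (funext hvE); apply: cmeasM; first exact: cmeas_cst.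
    apply: cmeasM; first exact: cmeas_invFT_Phi.
    by apply: cmeas_ofR; apply: measurableT_comp => //; exact: measurable_funM.
  - move=> s; rewrite hvE (cmodM (ofR (2 * pi))) cmod_ofR (gtr0_norm pi2_gt0) ler_wpM2l ?(ltW pi2_gt0)//.
    apply: le_trans (hB s); rewrite cmodM cmod_ofR (ger0_norm (expR_ge0 _)) mulrC ler_wpM2r ?cmod_ge0//.
    by have := ker_le s zw; rewrite cmod_ker.
  - by rewrite /comp; under eq_fun do rewrite EFinM; apply: integrableZl.
have iP : cintegrable h by exact: Phi_line_integrable.
have := fourier_inversion_pt ch iP ihv (reC z).
rewrite /h -zE => E; apply: (mulfI ofR2pi_neq0); rewrite -E -cintZ//; congr cint; apply/funext => s.
by rewrite -kE -/(phase_int (imC z) s) hvE; ring.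
Qed.

End one_function.

(** The margin between [w] and [w'] is converted into exponential decay of the density beyond the
    weight, and the weight [v] consumes only part of it. The constant depends on neither [Phi] nor
    [t]. *)
Lemma holo_kernel : exists2 C : R, 0 < C & forall (Phi : Cplx R -> Cplx R) (A t : R), 0 <= A ->
  (forall x y, `|y| < w' -> derivable Phi (mkC x y) 1) ->
  (forall x y, `|y| < w' -> cmod (Phi (mkC x y)) <= A * cauchyK (x - t)) ->
  [/\ cmeas (invFT Phi), (forall q, Wt w v q * cmod (invFT Phi q) <= C * A * cauchyK q) &
    forall z, `|imC z| <= w -> cintegrable (fun q => ker z q * invFT Phi q) /\ hat (invFT Phi) z = Phi z].
Proof.
(* Shifting contours gives the rate [w + d]; half of the surplus [d] absorbs [v], and the other half
   leaves an integrable factor. *)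
pose d := (w' - w) / 2; have d0 : 0 < d by rewrite divr_gt0// subr_gt0.
have d20 : 0 < d / 2 by rewrite divr_gt0.
have [Cv Cv0 HCv] := v_subexp sv d20.
pose C := Cv * (1 + 2 / (d / 2) ^+ 2) * ((2 * pi)^-1 * cauchyJ).
have c1 : 0 <= 1 + 2 / (d / 2) ^+ 2 by rewrite addr_ge0// divr_ge0// sqr_ge0.
have C0 : 0 <= C.
  rewrite /C; apply: mulr_ge0; first by rewrite mulr_ge0// ltW.
  by rewrite mulr_ge0 ?cauchyJ_ge0// invr_ge0 ltW// pi2_gt0.
(* The added 1 gives strict positivity, [cauchyJ] being known only to be nonnegative. *)
exists (C + 1) => [|Phi A t A0 hP bP]; first by rewrite ltr_wpDl.
have key q : Wt w v q * cmod (invFT Phi q) <= (C + 1) * A * cauchyK q.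
  apply: (@le_trans _ _ (C * A * cauchyK q)); last first.
    by rewrite ler_wpM2r ?cauchyK_ge0// ler_wpM2r// lerDl.
  have sgw : 0 <= w + d < w'.
    apply/andP; split; first exact: addr_ge0 w0 (ltW d0).
    by rewrite /d -ltrBrDl ltr_pdivrMr// ltr_pMr ?subr_gt0// ltr1n.
  have h1 := invFT_decay hP bP q sgw.
  rewrite /Wt; apply: le_trans (ler_wpM2l _ h1) _; first by rewrite mulr_ge0 ?expR_ge0// ltW// (v_gt0 sv).
  set B := (2 * pi)^-1 * (A * cauchyJ); have B0 : 0 <= B.
    by rewrite mulr_ge0 ?invr_ge0 ?(ltW pi2_gt0)// mulr_ge0// cauchyJ_ge0.
  rewrite (_ : v q * _ * _ = B * (v q * expR (- (d * `|q|)))); last first.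
    have -> : expR (- (d * `|q|)) = expR (w * `|q|) * expR (- ((w + d) * `|q|)).
      by rewrite -expRD; congr expR; ring.
    by ring.
  have -> : C * A * cauchyK q = B * (Cv * ((1 + 2 / (d / 2) ^+ 2) * cauchyK q)) by rewrite /C /B; ring.
  rewrite ler_wpM2l//; apply: (@le_trans _ _ (Cv * expR (d / 2 * `|q|) * expR (- (d * `|q|)))).
    by rewrite ler_wpM2r ?expR_ge0.
  rewrite -mulrA -expRD ler_wpM2l ?(ltW Cv0)//.
  have -> : d / 2 * `|q| + - (d * `|q|) = - (d / 2 * `|q|) by field.
  exact: expRN_abs_le_cauchyK.
split => //; first exact: cmeas_invFT_Phi hP bP.
move=> z zw; apply: (hat_invFT_Phi hP bP (B := (C + 1) * A) zw) => q.
apply: le_trans (key q); rewrite /Wt ler_wpM2r ?cmod_ge0//.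
by rewrite ler_peMl ?expR_ge0// (v_ge1 sv).
Qed.

End HoloKernel.

(** * The Hormander space *)

Section HorBasics.
Context {R : realType}.
Notation mu := (@lebesgue_measure R).

Lemma strip_ofR (w x : R) : 0 <= w -> strip w (ofR x).
Proof.
rewrite le_eqVlt => /orP[/eqP <-|w0]; first by right.
by left; rewrite (_ : imC (ofR x) = 0) ?normr0.
Qed.
Lemma strip_le (w : R) (z : Cplx R) : 0 <= w -> strip w z -> `|imC z| <= w.
Proof. by move=> w0 [/ltW//|[_ ->]]; rewrite normr0. Qed.

Lemma gaussC_ofR (x : R) : gaussC (ofR x) = ofR (expR (- x ^+ 2)).
Proof. by rewrite /gaussC -cexp_ofR; congr cexp; apply: eqC; rewrite !reimE; ring. Qed.

Lemma expRN_sqr_le_cauchyK (x : R) : expR (- x ^+ 2) <= cauchyK x.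
Proof.
rewrite expRN /cauchyK lef_pV2 ?posrE ?expR_gt0 ?ltr_pwDl ?sqr_ge0//; exact: expR_ge1Dx.
Qed.

(** Two powers serve [holo_mul]: one is spent in [cauchyK_mul_le], the other stays as decay in
    [x - r]. *)
Lemma expRN_sqr_le_cauchyK2 (x : R) : expR (- x ^+ 2) <= 4 * cauchyK x ^+ 2.
Proof.
have h : expR (- (x ^+ 2 / 2)) <= 2 * cauchyK x.
  have p : 0 < 1 + x ^+ 2 by rewrite ltr_pwDl ?sqr_ge0.
  rewrite expRN /cauchyK ler_pdivlMr// mulrC ler_pdivrMr ?expR_gt0//.
  have := expR_ge1Dx (x ^+ 2 / 2); have := sqr_ge0 x; set e := expR _; set y := x ^+ 2; lra.
have -> : - x ^+ 2 = - (x ^+ 2 / 2) + - (x ^+ 2 / 2) by field.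
rewrite expRD (_ : 4 * _ = (2 * cauchyK x) * (2 * cauchyK x)); last by ring.
by apply: ler_pM; rewrite ?expR_ge0.
Qed.

(** Decay of one factor around [t] and of the other around [r] becomes decay in [r - t], uniformly
    in [x]. After clearing denominators the difference is 1 plus squares. *)
Lemma cauchyK_mul_le (x t r : R) : cauchyK (x - t) * cauchyK (x - r) <= 2 * cauchyK (r - t).
Proof.
have p (y : R) : 0 < 1 + y ^+ 2 by rewrite ltr_pwDl ?sqr_ge0.
rewrite /cauchyK -invfM ler_pdivlMr ?p// mulrC ler_pdivrMr; last by rewrite mulr_gt0.
have -> : r - t = (x - t) - (x - r) by ring.
set a := x - t; set b := x - r.
have := sqr_ge0 (a + b); have := sqr_ge0 (a * b).
have -> : 2 * ((1 + a ^+ 2) * (1 + b ^+ 2)) = 1 + (a - b) ^+ 2 + ((a + b) ^+ 2 + 2 * (a * b) ^+ 2 + 1) by ring.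
move=> h1 h2; rewrite lerDl; apply: addr_ge0 => //; apply: addr_ge0 => //; exact: mulr_ge0.
Qed.

Variables (w : R) (v : R -> R).
Hypothesis w0 : 0 <= w.
Hypothesis sv : strongly_admissible v.
Implicit Types (f : Cplx R -> Cplx R) (g h : R -> Cplx R) (M N A B e x t : R) (a z : Cplx R).

Lemma hatZ (a z : Cplx R) g : `|imC z| <= w -> L2W w v g -> hat (fun s => a * g s) z = a * hat g z.
Proof.
move=> zw Lg; rewrite /hat -cintZ; last exact: (hat_integrable sv zw Lg).
by congr cint; apply/funext => s; rewrite mulrCA.
Qed.

Lemma nsqZ (a : Cplx R) g : cmeas g -> nsq w v (fun s => a * g s) = ((cmod a ^+ 2)%:E * nsq w v g)%E.
Proof.
move=> mg; rewrite /nsq -ge0_integralZl_EFin ?sqr_ge0//.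
- by apply: eq_integral => s _; rewrite (cmodM a) mulrCA exprMn (EFinM (cmod a ^+ 2)).
- by move=> s _; rewrite lee_fin sqr_ge0.
- apply/measurable_EFinP; exact: mnsq.
Qed.

Lemma L2WZ (a : Cplx R) g : L2W w v g -> L2W w v (fun s => a * g s).
Proof.
move=> Lg; split; first by apply: cmeasM; [exact: cmeas_cst|exact: Lg.1].
by rewrite nsqZ ?(nW_sq Lg) -?EFinM ?ltry//; case: Lg.
Qed.

Lemma nWZ_le (a : Cplx R) g M : L2W w v g -> nW w v g <= M -> nW w v (fun s => a * g s) <= cmod a * M.
Proof.
move=> Lg gM; apply: le_trans (ler_wpM2l (cmod_ge0 a) gM); apply: nW_le.
  by rewrite mulr_ge0 ?cmod_ge0 ?nW_ge0.
by rewrite nsqZ ?(nW_sq Lg) -?EFinM ?exprMn//; case: Lg.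
Qed.

(** Minkowski's inequality from the convexity bound [(x + y) ^ 2 <= (A + B) / A * x ^ 2 + (A + B) /
    B * y ^ 2], integrated pointwise; hence the strictly positive upper bounds in place of the
    norms. *)
Lemma nsqD_le g h A B : L2W w v g -> L2W w v h -> 0 < A -> 0 < B -> nW w v g <= A -> nW w v h <= B ->
  (nsq w v (fun s => (g s + h s)%R) <= ((A + B) ^+ 2)%:E)%E.
Proof.
move=> Lg Lh A0 B0 gA hB; have AB0 : 0 < A + B by exact: addr_gt0.
have mi g' : L2W w v g' -> measurable_fun setT (fun s => ((Wt w v s * cmod (g' s)) ^+ 2)%:E).
  move=> [mg _]; apply/measurable_EFinP; exact: mnsq.
have c1 : 0 <= (A + B) / A by rewrite divr_ge0 // ltW.
have c2 : 0 <= (A + B) / B by rewrite divr_ge0 // ltW.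
apply: (@le_trans _ _ (((A + B) / A)%:E * nsq w v g + ((A + B) / B)%:E * nsq w v h)%E).
  rewrite /nsq -!ge0_integralZl_EFin//; try (by move=> s _; rewrite lee_fin sqr_ge0); try exact: mi.
  rewrite -ge0_integralD//; try (by move=> s _; apply: mule_ge0; rewrite lee_fin// sqr_ge0);
    try (by apply: emeasurable_funM; [exact: measurable_cst|exact: mi]).
  apply: ge0_le_integral; first exact: measurableT.
  - by move=> s _; rewrite lee_fin sqr_ge0.
  - apply/measurable_EFinP; apply: mnsq => //; apply: cmeasD; [exact: Lg.1|exact: Lh.1].
  - by apply: emeasurable_funD; apply: emeasurable_funM; [exact: measurable_cst|exact: mi|exact: measurable_cst|exact: mi].
  move=> s _; rewrite -!EFinM -EFinD lee_fin.
  set x := Wt w v s * cmod (g s); set y := Wt w v s * cmod (h s).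
  have x0 : 0 <= x by rewrite mulr_ge0 ?cmod_ge0 ?(ltW (Wt_gt0 w sv s)).
  have y0 : 0 <= y by rewrite mulr_ge0 ?cmod_ge0 ?(ltW (Wt_gt0 w sv s)).
  apply: (@le_trans _ _ ((x + y) ^+ 2)).
    rewrite ler_sqr ?nnegrE ?addr_ge0//; last by rewrite mulr_ge0 ?cmod_ge0 ?(ltW (Wt_gt0 w sv s)).
    by rewrite /x /y -mulrDr ler_wpM2l ?(ltW (Wt_gt0 w sv s))// cmodD.
  have -> : (A + B) / A * x ^+ 2 + (A + B) / B * y ^+ 2 = (x + y) ^+ 2 + (B * x - A * y) ^+ 2 / (A * B).
    by field; rewrite !gt_eqF.
  by rewrite lerDl divr_ge0 ?sqr_ge0 ?mulr_ge0 ?ltW.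
rewrite (nW_sq Lg) (nW_sq Lh) -!EFinM -EFinD lee_fin.
have h1 : nW w v g ^+ 2 <= A ^+ 2 by rewrite ler_sqr ?nnegrE ?nW_ge0 ?(ltW A0).
have h2 : nW w v h ^+ 2 <= B ^+ 2 by rewrite ler_sqr ?nnegrE ?nW_ge0 ?(ltW B0).
apply: le_trans (lerD (ler_wpM2l c1 h1) (ler_wpM2l c2 h2)) _.
by rewrite le_eqVlt; apply/orP; left; apply/eqP; field; rewrite !gt_eqF.
Qed.

Lemma L2WD g h : L2W w v g -> L2W w v h -> L2W w v (fun s => g s + h s).
Proof.
move=> Lg Lh; split; first by apply: cmeasD; [exact: Lg.1|exact: Lh.1].
have p x : 0 <= x -> 0 < x + 1 :> R by move=> x0; rewrite ltr_wpDl.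
have q x : x <= x + 1 :> R by rewrite lerDl.
exact: le_lt_trans (nsqD_le Lg Lh (p _ (nW_ge0 w v g)) (p _ (nW_ge0 w v h)) (q _) (q _)) (ltry _).
Qed.

Lemma nWD_le g h A B : L2W w v g -> L2W w v h -> 0 < A -> 0 < B -> nW w v g <= A -> nW w v h <= B ->
  nW w v (fun s => g s + h s) <= A + B.
Proof.
move=> Lg Lh A0 B0 gA hB; apply: nW_le; [by rewrite ltW// addr_gt0|exact: nsqD_le].
Qed.

Lemma normW2_ge0 f : 0 <= normW2 w v f.
Proof.
rewrite /normW2; set E := [set _ | _ in _].
have [->|/set0P ne] := eqVneq E set0; first by rewrite inf0.
by apply: lb_le_inf => // x [g _ <-]; exact: sqrtr_ge0.
Qed.

Lemma normW2_le f g : W2_rep w v f g -> normW2 w v f <= nW w v g.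
Proof.
move=> rg; apply: ge_inf; first by exists 0 => x [h _ <-]; exact: sqrtr_ge0.
by exists g => //; exact: L2norm_W.
Qed.

Lemma normW2_adherent f e : inW2 w v f -> 0 < e -> exists2 g, W2_rep w v f g & nW w v g < normW2 w v f + e.
Proof.
move=> [g0 r0] e0; have hi : has_inf [set L2norm (fun s => ofR (v s * expR (w * `|s|)) * g s) | g in W2_rep w v f].
  split; first by exists (nW w v g0), g0 => //; exact: L2norm_W.
  by exists 0 => x [h _ <-]; exact: sqrtr_ge0.
have [x [g rg <-] hx] := inf_adherent e0 hi; exists g => //.
by move: hx; rewrite L2norm_W.
Qed.

Lemma cmeas_hat_ofR (g : R -> Cplx R) : cmeas g -> cmeas (fun x : R => hat g (ofR x)).
Proof.
move=> mg; apply: (@cmeas_cint _ (fun x s => ker (ofR x) s * g s)).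
apply: cmeasM; last exact: (cmeas_comp mg measurable_snd).
by apply: cmeas_ker2 => //; exact: (cmeas_ofR measurable_fst).
Qed.

Lemma cmeas_invFT (H : Cplx R -> Cplx R) : cmeas (fun x : R => H (ofR x)) -> cmeas (invFT H).
Proof.
move=> mH; apply: (@cmeas_cint _ (fun s x => ofR (2 * pi)^-1 * H (ofR x) * cexp (iC * ofR x * ofR s))).
apply: cmeasM; first by apply: cmeasM; [exact: cmeas_cst|exact: (cmeas_comp mH measurable_snd)].
apply: cmeas_cexp; apply: cmeasM; last exact: (cmeas_ofR measurable_fst).
by apply: cmeasM; [exact: cmeas_cst|exact: (cmeas_ofR measurable_snd)].
Qed.

Lemma rep_ofR f g x : W2_rep w v f g -> f (ofR x) = hat g (ofR x).
Proof. by move=> /(W2_repP w sv)[_]; apply; exact: strip_ofR. Qed.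

Lemma rep_cmeas f g : W2_rep w v f g -> cmeas (fun x : R => f (ofR x)).
Proof.
move=> rg; rewrite (funext (fun x => rep_ofR x rg)).
by apply: cmeas_hat_ofR; case/(W2_repP w sv): rg => -[].
Qed.

Lemma rep_ae f g : W2_rep w v f g -> cintegrable (fun x => f (ofR x)) ->
  {ae mu, forall s, invFT f s = g s}.
Proof.
move=> rg iF; have [Lg _] := (W2_repP w sv f g).1 rg.
by apply: invFT_unique => [|x|//]; [exact: (L2W_integrable w0 sv Lg)|exact: rep_ofR].
Qed.

(** Replaces an arbitrary density by the explicit one at equal norm; the explicit one is measurable
    in parameters and depends linearly on [f]. *)
Lemma rep_invFT f g : W2_rep w v f g -> cintegrable (fun x => f (ofR x)) ->
  W2_rep w v f (invFT f) /\ nW w v (invFT f) = nW w v g.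
Proof.
move=> rg iF; have [Lg hg] := (W2_repP w sv f g).1 rg; have ae := rep_ae rg iF.
have mi : cmeas (invFT f) by apply: cmeas_invFT; exact: rep_cmeas rg.
have E := nsq_ae w sv mi Lg.1 ae.
split; last by rewrite /nW E.
apply/(W2_repP w sv); split; first by split => //; rewrite E; exact: Lg.2.
by move=> z sz; rewrite hg//; apply/esym; apply: hat_ae => //; exact: Lg.1.
Qed.

(** A bound realized by a density for each localization. It avoids infima and suprema in the
    estimates; [Horb_normHor] and [inHor_Horb] translate to and from [normHor]. *)
Definition Horb (w : R) (v : R -> R) (f : Cplx R -> Cplx R) (M : R) :=
  forall t, exists2 g, W2_rep w v (locG t f) g & nW w v g <= M.

Lemma Horb_ge0 f M : Horb w v f M -> 0 <= M.
Proof. by move=> /(_ 0)[g _]; apply: le_trans; exact: nW_ge0. Qed.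
Lemma Horb_le f M N : Horb w v f M -> M <= N -> Horb w v f N.
Proof. by move=> hf MN t; have [g rg gM] := hf t; exists g => //; exact: le_trans MN. Qed.

Lemma Horb_normHor f M : Horb w v f M -> inHor w v f /\ normHor w v f <= M.
Proof.
move=> hf; have le t : normW2 w v (locG t f) <= M.
  by have [g rg gM] := hf t; exact: le_trans (normW2_le rg) gM.
split; first by split; [move=> t; have [g rg _] := hf t; exists g|exists M].
by apply: ge_sup => [|_ [t _ <-]//]; exists (normW2 w v (locG 0 f)), 0.
Qed.

Lemma normW2_le_normHor f t : inHor w v f -> normW2 w v (locG t f) <= normHor w v f.
Proof.
move=> [_ [M HM]]; apply: ub_le_sup; last by exists t.
by exists M => _ [s _ <-].
Qed.

Lemma normHor_ge0 f : inHor w v f -> 0 <= normHor w v f.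
Proof. by move=> hf; exact: le_trans (normW2_ge0 _) (normW2_le_normHor 0 hf). Qed.

(** The strict inequality leaves room for a density whose norm lies slightly above the infimum. *)
Lemma inHor_Horb f M : inHor w v f -> normHor w v f < M -> Horb w v f M.
Proof.
move=> hf fM t; have e0 : 0 < M - normHor w v f by rewrite subr_gt0.
have [g rg gl] := normW2_adherent (hf.1 t) e0; exists g => //; apply: le_trans (ltW gl) _.
by rewrite -lerBrDr opprB addrC subrK; exact: normW2_le_normHor.
Qed.

Lemma normHor_le f M : inHor w v f -> (forall e, 0 < e -> Horb w v f (M + e)) -> normHor w v f <= M.
Proof. by move=> hf h; apply/ler_addgt0Pr => e e0; exact: (Horb_normHor (h e e0)).2. Qed.

(** Localizing at [t = reC z] makes the Gaussian factor at [z] at least 1 in modulus. *)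
Lemma Horb_bounded f M z : Horb w v f M -> strip w z -> cmod (f z) <= Num.sqrt (vcst v) * M.
Proof.
move=> hf sz; have zw := strip_le w0 sz; have [g /(W2_repP w sv)[Lg hg] gM] := hf (reC z).
apply: (@le_trans _ _ (cmod (locG (reC z) f z))); last first.
  rewrite hg//; apply: le_trans (hat_bound sv zw Lg) _.
  by rewrite ler_wpM2l ?sqrtr_ge0.
rewrite /locG (cmodM (gaussC _)) cmod_gaussC ler_peMl ?cmod_ge0// -expR0 ler_expR !reimE.
by rewrite subrr expr0n/= !subr0 sqr_ge0.
Qed.

(** On the real line [f] is recovered from a single localization by multiplying with
    [expR (x ^+ 2)]. *)
Lemma Horb_cmeas f M : Horb w v f M -> cmeas (fun x => f (ofR x)).
Proof.
move=> hf; have [g rg _] := hf 0; have := rep_cmeas rg.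
have E x : f (ofR x) = ofR (expR (x ^+ 2)) * locG 0 f (ofR x).
  rewrite /locG (_ : ofR x - ofR 0 = ofR x) ?gaussC_ofR; last by rewrite ofR0 subr0.
  by rewrite mulrA -ofRM -expRD subrr expR0 ofR1 mul1r.
move=> m; rewrite (funext E); apply: cmeasM => //.
by apply: cmeas_ofR; apply: measurableT_comp => //; exact: exprn_measurable.
Qed.

Lemma cmod_locG_ofR t f x : cmod (locG t f (ofR x)) = expR (- (x - t) ^+ 2) * cmod (f (ofR x)).
Proof. by rewrite /locG (cmodM (gaussC _)) cmod_gaussC !reimE subr0 expr0n/= add0r. Qed.

Lemma Horb_integrable f M t : Horb w v f M -> cintegrable (fun x => locG t f (ofR x)).
Proof.
move=> hf; have [g rg _] := hf t.
apply: (@cintegrable_le _ _ (fun x => (Num.sqrt (vcst v) * M) * cauchyK (x - t))).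
- exact: rep_cmeas rg.
- move=> x; rewrite cmod_locG_ofR mulrC; apply: ler_pM; rewrite ?cmod_ge0 ?expR_ge0//.
    by apply: Horb_bounded hf _; exact: strip_ofR.
  exact: expRN_sqr_le_cauchyK.
- exact: integrable_cauchyK_shift.
Qed.

Lemma Horb_rep f M t : Horb w v f M ->
  W2_rep w v (locG t f) (invFT (locG t f)) /\ nW w v (invFT (locG t f)) <= M.
Proof.
move=> hf; have [g rg gM] := hf t.
by have [r ->] := rep_invFT rg (Horb_integrable t hf).
Qed.

End HorBasics.

(** * Multiplication by decaying holomorphic functions *)

Section HoloMul.
Context {R : realType}.
Notation mu := (@lebesgue_measure R).

(** After translation by [reC z] only the height [imC z] matters, and a contour shift removes it.
    The constant is the Gaussian integral with [k] the square root of 2. *)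
Lemma gaussC_sq_int : exists2 c0 : R, 0 < c0 &
  forall z : Cplx R, cint (fun r : R => gaussC (z - ofR r) * gaussC (z - ofR r)) = ofR c0.
Proof.
pose k : R := Num.sqrt 2; have k0 : 0 < k by rewrite sqrtr_gt0.
exists (k^-1 * Num.sqrt pi * expR (- ((0 / k) ^+ 2 / 4))).
  by rewrite mulr_gt0 ?expR_gt0// mulr_gt0 ?invr_gt0// sqrtr_gt0 pi_gt0.
move=> z; pose F (u : Cplx R) := gaussC u * gaussC u.
pose a := `|imC z| + 1; have za : `|imC z| < a by rewrite ltrDl.
have a0 : `|0 : R| < a by rewrite normr0; exact: le_lt_trans za.
have dF x y : `|y| < a -> derivable F (mkC x y) 1.
  by move=> _; apply: derivableM; apply: derivable_gaussC_comp; exact: derivable_id.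
have bF x y : `|y| < a -> cmod (F (mkC x y)) <= expR (a ^+ 2 + a ^+ 2) * cauchyK x.
  move=> ya; rewrite /F (cmodM (gaussC _)) cmod_gaussC !reimE.
  have a1 : 0 < a := le_lt_trans (normr_ge0 y) ya.
  have y2 : y ^+ 2 <= a ^+ 2 by rewrite -(real_normK (num_real y)) ler_sqr ?nnegrE ?(ltW ya) ?(ltW a1).
  have -> : expR (y ^+ 2 - x ^+ 2) * expR (y ^+ 2 - x ^+ 2) = expR (y ^+ 2 + y ^+ 2) * (expR (- x ^+ 2) * expR (- x ^+ 2)).
    by rewrite -!expRD; congr expR; ring.
  apply: ler_pM; rewrite ?expR_ge0 ?mulr_ge0 ?expR_ge0//; first by rewrite ler_expR lerD.
  apply: le_trans (expRN_sqr_le_cauchyK x); rewrite ler_piMr ?expR_ge0//.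
  by rewrite -expR0 ler_expR oppr_le0 sqr_ge0.
pose h (r : R) := F (mkC r (imC z)).
have mh : cmeas h by exact: (cmeas_line dF za).
have -> : (fun r : R => gaussC (z - ofR r) * gaussC (z - ofR r)) = fun r => h (- r + reC z).
  apply/funext => r; rewrite /h /F; congr (gaussC _ * gaussC _); apply: eqC; rewrite !reimE; ring.
rewrite (@cint_opp _ (fun r => h (r + reC z))); last first.
  by apply: (cmeas_comp mh); apply: measurable_funD => //; exact: measurable_cst.
rewrite (cint_shift _ mh) /h (contour_shift dF bF za a0) -gauss_FT_scaled//.
congr cint; apply/funext => r; rewrite /F -/(ofR r) gaussC_ofR.
rewrite (_ : iC * ofR r * ofR 0 = 0) ?cexp0 ?mulr1; last by rewrite ofR0 mulr0.
rewrite -ofRM -expRD; congr (ofR (expR _)); rewrite exprMn sqr_sqrtr//; ring.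
Qed.

Variables (w w' : R) (v : R -> R).
Hypothesis w0 : 0 <= w.
Hypothesis ww' : w < w'.
Hypothesis sv : strongly_admissible v.

Lemma cauchyJ_le (A : R) : 0 <= A -> (\int[mu]_q (A * cauchyK q)%:E <= (A * (@cauchyJ R + 1))%:E)%E.
Proof.
move=> A0; under eq_integral do rewrite (EFinM A).
rewrite ge0_integralZl_EFin//; last 2 first.
- by move=> x _; rewrite lee_fin cauchyK_ge0.
- by apply/measurable_EFinP; exact: measurable_cauchyK.
rewrite (EFinM A) lee_wpmul2l ?lee_fin//.
have f := integrable_fin_num measurableT (@integrable_cauchyK R).
by rewrite -(fineK f) lee_fin /cauchyJ /Rintegral lerDl.
Qed.

Lemma cauchyJ_shift_le (A t : R) : 0 <= A ->
  (\int[mu]_r (A * cauchyK (r - t))%:E <= (A * (@cauchyJ R + 1))%:E)%E.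
Proof.
move=> A0; apply: le_trans (cauchyJ_le A0).
have m : measurable_fun setT (fun q : R => (A * cauchyK q)%:E).
  by apply/measurable_EFinP; apply: measurable_funM => //; exact: measurable_cauchyK.
rewrite [leRHS](ge0_integral_affine (- t) ltr01 m); last by move=> x; rewrite lee_fin mulr_ge0 ?cauchyK_ge0.
by rewrite mul1e; under [leRHS]eq_integral do rewrite mul1r.
Qed.

(** Uniformity of [C] in [f], [m] and [t] is essential: the product estimate takes a supremum over
    [t], while the reproducing formula centres [m] at [reC z]. *)
Lemma holo_mul : exists2 C : R, 0 < C & forall (f m : Cplx R -> Cplx R) (M A t : R),
  Horb w v f M -> 0 < M -> 0 < A ->
  (forall x y, `|y| < w' -> derivable m (mkC x y) 1) ->
  (forall x y, `|y| < w' -> cmod (m (mkC x y)) <= A * cauchyK (x - t)) ->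
  exists2 g, W2_rep w v (fun z => m z * f z) g & nW w v g <= C * A * M.
Proof.
have [K K1 HK] := v_quasi sv.
have [C1 C10 H1] := holo_kernel w0 ww' sv.
have [c0 c00 Hc0] := gaussC_sq_int.
have w'0 : 0 < w' := le_lt_trans w0 ww'.
have J1 : 0 < @cauchyJ R + 1 by rewrite ltr_wpDl ?cauchyJ_ge0.
have K0 : 0 < K := lt_le_trans ltr01 K1.
pose C2 := 2 * K * (C1 * (8 * expR (w' ^+ 2)) * (@cauchyJ R + 1)).
have C20 : 0 < C2 by rewrite !mulr_gt0 ?expR_gt0.
exists (c0^-1 * (C2 * (@cauchyJ R + 1))); first by apply: mulr_gt0; [rewrite invr_gt0|exact: mulr_gt0].
move=> f m M A t hf M0 A0 dm bm.
(* The 8 is the 4 of [expRN_sqr_le_cauchyK2] times the 2 of [cauchyK_mul_le]; the exponential bounds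
   the growth of the Gaussian with the height. *)
pose Ar (r : R) := 8 * expR (w' ^+ 2) * A * cauchyK (r - t).
have Ar0 r : 0 < Ar r by rewrite !mulr_gt0 ?expR_gt0 ?cauchyK_gt0.
pose Phi (r : R) (z : Cplx R) := m z * gaussC (z - ofR r).
have dPhi r x y : `|y| < w' -> derivable (Phi r) (mkC x y) 1.
  move=> yw; apply: derivableM; first exact: (dm x y yw).
  apply: (@derivable_gaussC_comp _ (fun z => z + - ofR r)).
  by apply: derivableD; [exact: derivable_id|exact: derivable_cst].
have bPhi r x y : `|y| < w' -> cmod (Phi r (mkC x y)) <= Ar r * cauchyK (x - r).
  move=> yw; rewrite /Phi (cmodM (m _)) cmod_gaussC !reimE subr0 expRD.
  have y2 : expR (y ^+ 2) <= expR (w' ^+ 2).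
    by rewrite ler_expR -(real_normK (num_real y)) ler_sqr ?nnegrE ?(ltW yw) ?(ltW w'0).
  have h := expRN_sqr_le_cauchyK2 (x - r); have k0 := cauchyK_ge0 (x - r).
  have kk := cauchyK_mul_le x t r.
  apply: (@le_trans _ _ (A * cauchyK (x - t) * (expR (w' ^+ 2) * (4 * cauchyK (x - r) ^+ 2)))).
    apply: ler_pM; rewrite ?cmod_ge0 ?mulr_ge0 ?expR_ge0//; first exact: bm.
    by apply: ler_pM; rewrite ?expR_ge0.
  have -> : A * cauchyK (x - t) * (expR (w' ^+ 2) * (4 * cauchyK (x - r) ^+ 2)) =
    4 * expR (w' ^+ 2) * A * cauchyK (x - r) * (cauchyK (x - t) * cauchyK (x - r)) by ring.
  have -> : Ar r * cauchyK (x - r) = 4 * expR (w' ^+ 2) * A * cauchyK (x - r) * (2 * cauchyK (r - t)).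
    by rewrite /Ar; ring.
  apply: ler_wpM2l kk; apply: mulr_ge0 => //; apply: ltW; apply: mulr_gt0 => //.
  by apply: mulr_gt0 => //; exact: expR_gt0.
pose H (r : R) (z : Cplx R) := Phi r z * locG r f z.
(* The density of [Phi r] has an integrable weighted majorant of size [Ar r], so convolving it with
   a density of [locG r f] keeps the factor [cauchyK (r - t)]. *)
have repH r : exists2 g, W2_rep w v (H r) g & nW w v g <= C2 * A * M * cauchyK (r - t).
  have [ma ba ha] := H1 (Phi r) (Ar r) r (ltW (Ar0 r)) (dPhi r) (bPhi r).
  have [g /(W2_repP w sv)[Lg hg] gM] := hf r.
  have mbe : measurable_fun setT (fun q : R => C1 * Ar r * cauchyK q).
    by apply: measurable_funM => //; exact: measurable_cauchyK.
  have CA0 : 0 < C1 * Ar r by rewrite mulr_gt0.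
  have A'0 : 0 < C1 * Ar r * (@cauchyJ R + 1) by rewrite mulr_gt0.
  have bI := cauchyJ_le (ltW CA0).
  exists (conv (invFT (Phi r)) g).
    apply/(W2_repP w sv); split; first exact: (conv_L2W w0 sv K1 HK ma Lg mbe ba A'0 bI).
    move=> z sz; have zw := strip_le w0 sz; have [iz hz] := ha z zw.
    by rewrite (conv_hat w0 sv K1 HK ma Lg mbe ba A'0 bI zw iz) hz /H hg.
  apply: le_trans (conv_nW w0 sv K1 HK ma Lg mbe ba A'0 bI) _.
  have -> : C2 * A * M * cauchyK (r - t) = 2 * K * (C1 * Ar r * (@cauchyJ R + 1)) * M by rewrite /C2 /Ar; ring.
  by apply: ler_wpM2l gM; rewrite mulr_ge0 ?(ltW A'0)// mulr_ge0 ?(ltW K0).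
have w'00 : `|0 : R| < w' by rewrite normr0.
have mm : cmeas (fun x : R => m (ofR x)) by exact: (cmeas_line dm w'00).
have mf := Horb_cmeas w0 sv hf.
pose D := C2 * A * M; have D0 : 0 < D by apply: mulr_gt0 => //; exact: mulr_gt0.
pose kap (r : R) := invFT (H r).
have repk r : W2_rep w v (H r) (kap r) /\ nW w v (kap r) <= D * cauchyK (r - t).
  have [g rg gM] := repH r.
  have iH : cintegrable (fun x => H r (ofR x)).
    have [mg ng] := (cintegrableP _).1 (Horb_integrable w0 sv r hf).
    apply: (@cintegrable_le _ _ (fun x => Ar r * cmod (locG r f (ofR x)))).
    - exact: rep_cmeas rg.
    - move=> x; rewrite /H (cmodM (Phi _ _)) ler_wpM2r ?cmod_ge0//; apply: le_trans (bPhi r x 0 w'00) _.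
      by rewrite ler_piMr ?(ltW (Ar0 r))// /cauchyK invf_le1 ?ltr_pwDl ?sqr_ge0// lerDl sqr_ge0.
    - by rewrite /comp; under eq_fun do rewrite (EFinM (Ar r)); apply: integrableZl.
  have [r1 E] := rep_invFT w0 sv rg iH; split; first exact: r1.
  by rewrite E; exact: gM.
have mk : cmeas (fun p : R * R => kap p.1 p.2).
  apply: (@cmeas_cintT _ _ _ (fun (p : R * R) x => ofR (2 * pi)^-1 * H p.1 (ofR x) * cexp (iC * ofR x * ofR p.2))).
  have mg : cmeas (fun q : R * R * R => gaussC (ofR q.2 - ofR q.1.1)).
    by apply: cmeas_gaussC; apply: cmeasB; [exact: (cmeas_ofR measurable_snd)|exact: (cmeas_ofR (measurableT_comp measurable_fst measurable_fst))].
  apply: cmeasM; last first.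
    apply: cmeas_cexp; apply: cmeasM; last exact: (cmeas_ofR (measurableT_comp measurable_snd measurable_fst)).
    by apply: cmeasM; [exact: cmeas_cst|exact: (cmeas_ofR measurable_snd)].
  apply: cmeasM; first exact: cmeas_cst.
  apply: cmeasM; first by apply: cmeasM; [exact: (cmeas_comp mm measurable_snd)|exact: mg].
  by apply: cmeasM; [exact: mg|exact: (cmeas_comp mf measurable_snd)].
pose P (r s : R) := D * cauchyK (r - t).
have P0 r s : 0 < P r s by apply: mulr_gt0 => //; exact: cauchyK_gt0.
(* With [P] the bound on the norm of [kap r], the integral of [Q] in [s] is at most [P], so both
   hypotheses of the Schur test reduce to the integral of [cauchyK]. *)
pose Q (r s : R) := (P r s)^-1 * (Wt w v s * cmod (kap r s)) ^+ 2.
have Q0 r s : 0 <= Q r s by rewrite mulr_ge0 ?invr_ge0 ?(ltW (P0 r s)) ?sqr_ge0.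
have mPr : measurable_fun setT (fun r : R => D * cauchyK (r - t)).
  apply: measurable_funM => //; apply: measurableT_comp; first exact: measurable_cauchyK.
  by apply: measurable_funB; [exact: measurable_id|exact: measurable_cst].
have mP s : measurable_fun setT (P^~ s) by exact: mPr.
have mQ : measurable_fun setT (fun p : R * R => Q p.1 p.2).
  apply: measurable_funM.
    by apply: measurable_inv_pos => [p|]; [exact: P0|exact: (measurableT_comp mPr measurable_fst)].
  apply: measurable_funX; apply: measurable_funM; last exact: measurable_cmod.
  by apply: (measurableT_comp (mWt w sv)); exact: measurable_snd.
have kPQ r s : (Wt w v s * cmod (kap r s)) ^+ 2 <= P r s * Q r s.
  by rewrite /Q mulrA divff ?mul1r// gt_eqF.
have DJ0 : 0 < D * (@cauchyJ R + 1) by exact: mulr_gt0.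
have PA s : (\int[mu]_r (P r s)%:E <= (D * (@cauchyJ R + 1))%:E)%E by exact: cauchyJ_shift_le t (ltW D0).
have QB : (\int[mu]_r \int[mu]_s (Q r s)%:E <= (D * (@cauchyJ R + 1))%:E)%E.
  apply: le_trans (cauchyJ_shift_le t (ltW D0)); apply: ge0_le_integral => //.
  - by move=> r _; apply: integral_ge0 => s _; rewrite lee_fin.
  - apply: (@measurable_tonelliT _ _ _ (fun p : R * R => (Q p.1 p.2)%:E)) => [|p]; last by rewrite lee_fin.
    by apply/measurable_EFinP.
  - by apply/measurable_EFinP.
  move=> r _; have [/(W2_repP w sv)[Lk _] kM] := repk r.
  rewrite (_ : (\int[mu]_s (Q r s)%:E)%E = ((P r 0)^-1%:E * nsq w v (kap r))%E); last first.
    rewrite /nsq -ge0_integralZl_EFin ?invr_ge0 ?(ltW (P0 r 0))//.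
    - by move=> s _; rewrite lee_fin sqr_ge0.
    - by apply/measurable_EFinP; apply: mnsq => //; exact: Lk.1.
  rewrite (nW_sq Lk) -EFinM lee_fin ler_pdivrMl// -expr2 ler_sqr// nnegrE ?nW_ge0//; exact: ltW (P0 r 0).
pose V0 := fun s : R => cint (fun r => kap r s).
have LV := superpose_L2W sv mk mP mQ (fun r s => ltW (P0 r s)) Q0 kPQ DJ0 PA QB.
have nV := superpose_nsq sv mk mP mQ (fun r s => ltW (P0 r s)) Q0 kPQ DJ0 PA QB.
exists (fun s => ofR c0^-1 * V0 s).
  apply/(W2_repP w sv); split; first exact: (L2WZ sv (ofR c0^-1) LV).
  move=> z sz; have zw := strip_le w0 sz.
  rewrite (hatZ sv (ofR c0^-1) zw LV).
  rewrite (superpose_hat sv mk mP mQ (fun r s => ltW (P0 r s)) Q0 kPQ DJ0 PA QB zw).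
  have -> : (fun r : R => hat (kap r) z) = fun r => m z * f z * (gaussC (z - ofR r) * gaussC (z - ofR r)).
    apply/funext => r; have [/(W2_repP w sv)[_ hk] _] := repk r.
    by rewrite -hk// /H /Phi /locG; ring.
  rewrite cintZ ?Hc0; first by rewrite mulrCA -ofRM mulVf ?gt_eqF// ofR1 mulr1.
  apply: (@cintegrable_le _ _ (fun r => expR (imC z ^+ 2 + imC z ^+ 2) * cauchyK (r - reC z))).
  - have mg : cmeas (fun r : R => gaussC (z - ofR r)).
      by apply: cmeas_gaussC; apply: cmeasB; [exact: cmeas_cst|exact: cmeas_ofR].
    by apply: cmeasM.
  - move=> r; rewrite (cmodM (gaussC _)) cmod_gaussC !reimE subr0.
    have -> : expR (imC z ^+ 2 - (reC z - r) ^+ 2) * expR (imC z ^+ 2 - (reC z - r) ^+ 2) =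
      expR (imC z ^+ 2 + imC z ^+ 2) * (expR (- (r - reC z) ^+ 2) * expR (- (r - reC z) ^+ 2)).
      by rewrite -!expRD; congr expR; ring.
    rewrite ler_wpM2l ?expR_ge0//; apply: le_trans (expRN_sqr_le_cauchyK _); rewrite ler_piMr ?expR_ge0//.
    by rewrite -expR0 ler_expR oppr_le0 sqr_ge0.
  - exact: integrable_cauchyK_shift.
have h : nW w v V0 <= D * (@cauchyJ R + 1) by apply: nW_le (ltW DJ0) _; rewrite expr2.
apply: le_trans (nWZ_le sv (ofR c0^-1) LV h) _.
rewrite cmod_ofR gtr0_norm ?invr_gt0// le_eqVlt; apply/orP; left; apply/eqP; rewrite /D; ring.
Qed.

End HoloMul.

(** * Extension to the closed strip and the reproducing formula *)

Section Extension.
Context {R : realType}.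
Notation mu := (@lebesgue_measure R).
Implicit Types (f F : Cplx R -> Cplx R) (g h : R -> Cplx R) (M N A B e x t : R) (a z : Cplx R) (u : nat -> Cplx R).

Lemma cvgC_seqP u z : u n @[n --> \oo] --> z <->
  forall e : R, 0 < e -> exists N0 : nat, forall n, (N0 <= n)%N -> cmod (u n - z) < e.
Proof.
rewrite cvgCP; split => [/cvgrPdist_lt h e e0|h].
  have [N _ hN] := h e e0; exists N => n Nn.
  by have := hN n Nn; rewrite /= sub0r normrN ger0_norm ?cmod_ge0.
apply/cvgrPdist_lt => e e0; have [N hN] := h e e0; exists N => // n Nn /=.
by rewrite sub0r normrN ger0_norm ?cmod_ge0//; exact: hN.
Qed.

Lemma derivable_seq F z u : derivable F z 1 -> u n @[n --> \oo] --> z -> F (u n) @[n --> \oo] --> F z.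
Proof. by move=> dF hu; apply: (cvg_comp _ _ hu (derivableC_continuous dF)). Qed.

Lemma derivable_gauss_shift t z : derivable (fun z => gaussC (z - ofR t)) z 1.
Proof.
apply: (@derivable_gaussC_comp _ (fun z => z + - ofR t)).
by apply: derivableD; [exact: derivable_id|exact: derivable_cst].
Qed.

Lemma gauss_seq t z u : u n @[n --> \oo] --> z ->
  gaussC (u n - ofR t) @[n --> \oo] --> gaussC (z - ofR t).
Proof.
by move=> hu; apply: (@derivable_seq (fun z => gaussC (z - ofR t)) z u); [exact: derivable_gauss_shift|exact: hu].
Qed.

Lemma within_seq (D : set (Cplx R)) F z u : {within D, continuous F} -> D z -> (forall n, D (u n)) ->
  u n @[n --> \oo] --> z -> F (u n) @[n --> \oo] --> F z.
Proof.
move=> /subspace_continuousP cF Dz Du hu P nP.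
have := hu _ (cF z Dz P nP); rewrite !nbhs_simpl /=.
by apply: filterS => n /=; apply.
Qed.

Lemma cl_strip_seq (w : R) z : 0 <= w -> cl_strip w z ->
  exists2 u : nat -> Cplx R, (forall n, strip w (u n)) & u n @[n --> \oo] --> z.
Proof.
rewrite le_eqVlt => /orP[/eqP <-|w0] zw.
  exists (fun=> z); last exact: cvg_cst.
  by move=> n; right; split => //; apply/eqP; rewrite -normr_le0.
have zE : z = mkC (reC z) (imC z) by case: (z).
exists (fun n => mkC (reC z) (imC z * (1 - harmonic n))) => [n|].
  left; change (is_true (`|imC z * (1 - harmonic n)| < w)); rewrite normrM; have h0 : 0 < harmonic n :> R by rewrite /harmonic/= invr_gt0.
  have h1 : harmonic n <= 1 :> R by rewrite /harmonic/= invf_le1 ?ler1n.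
  rewrite (ger0_norm (x := 1 - _)) ?subr_ge0//.
  apply: (@le_lt_trans _ _ (w * (1 - harmonic n))); first by rewrite ler_wpM2r ?subr_ge0.
  by rewrite gtr_pMr// gtrBl.
apply/cvgC_reim; split; first exact: cvg_cst.
have h1 : (fun n => 1 - harmonic n) @ \oo --> (1 - 0 : R) by apply: cvgB; [exact: cvg_cst|exact: cvg_harmonic].
have h2 : (fun n => imC z * (1 - harmonic n)) @ \oo --> imC z * (1 - 0) by apply: cvgM => //; exact: cvg_cst.
by move: h2; rewrite subr0 mulr1.
Qed.

Variables (w : R) (v : R -> R).
Hypothesis w0 : 0 <= w.
Hypothesis sv : strongly_admissible v.

Lemma hat_seq g z u : L2W w v g -> cl_strip w z -> (forall n, cl_strip w (u n)) ->
  u n @[n --> \oo] --> z -> hat g (u n) @[n --> \oo] --> hat g z.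
Proof.
move=> Lg zw uw /cvgC_seqP hu; apply/cvgC_seqP => e e0.
have [d d0 hd] := hat_modulus w sv (nW w v g) e0.
have [N hN] := hu d d0; exists N => n /hN; exact: (hd g Lg (lexx _) (u n) z (uw n) zw).
Qed.

Lemma cl_strip_eq (P Q : Cplx R -> Cplx R) z : cl_strip w z -> (forall y, strip w y -> P y = Q y) ->
  (forall u, (forall n, strip w (u n)) -> u n @[n --> \oo] --> z -> P (u n) @[n --> \oo] --> P z) ->
  (forall u, (forall n, strip w (u n)) -> u n @[n --> \oo] --> z -> Q (u n) @[n --> \oo] --> Q z) ->
  P z = Q z.
Proof.
move=> zw PQ cP cQ; have [u su hu] := cl_strip_seq w0 zw.
apply: (cvgC_unique (cP u su hu)); rewrite (_ : (fun n => P (u n)) = fun n => Q (u n)); first exact: cQ.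
by apply/funext => n; exact: PQ.
Qed.

Lemma strip_cl z : strip w z -> cl_strip w z. Proof. exact: strip_le. Qed.

Lemma cont_ext_rep f F t g z : W2_rep w v (locG t f) g -> cont_ext w f F -> cl_strip w z ->
  gaussC (z - ofR t) * F z = hat g z.
Proof.
move=> /(W2_repP w sv)[Lg hg] [Ff cF] zw.
apply: (@cl_strip_eq (fun z => gaussC (z - ofR t) * F z) (hat g)); first exact: zw.
- by move=> y sy; rewrite -(hg y sy) (Ff y sy).
- move=> u su hu; apply: cvgM; first exact: gauss_seq.
  exact: (within_seq cF zw (fun n => strip_cl (su n)) hu).
- move=> u su hu; exact: (hat_seq Lg zw (fun n => strip_cl (su n)) hu).
Qed.

Lemma cmod_gauss_vertical z : 1 <= cmod (gaussC (z - ofR (reC z))).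
Proof.
by rewrite cmod_gaussC -[leLHS]expR0 ler_expR !reimE subrr expr0n/= !subr0 sqr_ge0.
Qed.

Lemma cont_ext_bound f F M z : Horb w v f M -> cont_ext w f F -> cl_strip w z ->
  cmod (F z) <= Num.sqrt (vcst v) * M.
Proof.
move=> hf cF zw; have [g rg gM] := hf (reC z); have [Lg _] := (W2_repP w sv _ _).1 rg.
apply: (@le_trans _ _ (cmod (gaussC (z - ofR (reC z)) * F z))).
  by rewrite cmodM ler_peMl ?cmod_ge0// cmod_gauss_vertical.
rewrite (cont_ext_rep rg cF zw); apply: le_trans (hat_bound sv zw Lg) _.
by rewrite ler_wpM2l ?sqrtr_ge0.
Qed.

(** Each point uses the localization at its own real part, where the Gaussian has modulus at least
    1, so that dividing by it does not enlarge the value. *)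
Definition horExt f z : Cplx R := (gaussC (z - ofR (reC z)))^-1 * hat (invFT (locG (reC z) f)) z.

(** The localization chosen in [horExt] is immaterial: inside the strip both cross products equal
    the product of two Gaussians with [f], and continuity of [hat] carries the identity to the
    boundary. *)
Lemma horExt_rep f M t z : Horb w v f M -> cl_strip w z ->
  gaussC (z - ofR t) * horExt f z = hat (invFT (locG t f)) z.
Proof.
move=> hf zw; set r := reC z.
have [/(W2_repP w sv)[Lr hr] _] := Horb_rep w0 sv r hf.
have [/(W2_repP w sv)[Lt ht] _] := Horb_rep w0 sv t hf.
have E : gaussC (z - ofR t) * hat (invFT (locG r f)) z = gaussC (z - ofR r) * hat (invFT (locG t f)) z.
  apply: (@cl_strip_eq (fun z => gaussC (z - ofR t) * hat (invFT (locG r f)) z)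
    (fun z => gaussC (z - ofR r) * hat (invFT (locG t f)) z)); first exact: zw.
  - by move=> y sy; rewrite -(hr y sy) -(ht y sy) /locG; ring.
  - move=> u su hu; apply: cvgM; first exact: gauss_seq.
    exact: (hat_seq Lr zw (fun n => strip_cl (su n)) hu).
  - move=> u su hu; apply: cvgM; first exact: gauss_seq.
    exact: (hat_seq Lt zw (fun n => strip_cl (su n)) hu).
by rewrite /horExt -/r mulrCA E mulrA (mulVf (gaussC_neq0 _)) mul1r.
Qed.

Lemma horExt_strip f M z : Horb w v f M -> strip w z -> horExt f z = f z.
Proof.
move=> hf sz; have [/(W2_repP w sv)[_ h] _] := Horb_rep w0 sv (reC z) hf.
by rewrite /horExt -(h z sz) /locG mulrA (mulVf (gaussC_neq0 _)) mul1r.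
Qed.

Lemma horExt_bound f M z : Horb w v f M -> cl_strip w z -> cmod (horExt f z) <= Num.sqrt (vcst v) * M.
Proof.
move=> hf zw; have [/(W2_repP w sv)[Lg hg] gM] := Horb_rep w0 sv (reC z) hf.
apply: (@le_trans _ _ (cmod (gaussC (z - ofR (reC z)) * horExt f z))).
  by rewrite cmodM ler_peMl ?cmod_ge0// cmod_gauss_vertical.
rewrite (horExt_rep _ hf zw); apply: le_trans (hat_bound sv zw Lg) _.
by rewrite ler_wpM2l ?sqrtr_ge0.
Qed.

Lemma cexp_near0 e : 0 < e -> exists2 d : R, 0 < d & forall q : Cplx R, cmod q < d -> cmod (cexp q - 1) < e.
Proof.
move=> e0; have [d d0 hd] := (continuousCP _ _).1 (@continuous_cexp R 0) e e0.
by exists d => // q qd; have := hd q; rewrite subr0 cexp0; exact.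
Qed.

Lemma ext_diff_id (a b c d G : Cplx R) : c * G = 1 -> a - b = c * (G * a - d * b) + b * (d * c - 1).
Proof.
move=> h; have -> : c * (G * a - d * b) + b * (d * c - 1) = c * G * a - b by ring.
by rewrite h mul1r.
Qed.

Lemma horExt_UC f M : Horb w v f M -> UCb_on (cl_strip w) (horExt f).
Proof.
move=> hf; split; first by exists (Num.sqrt (vcst v) * M) => z; exact: horExt_bound hf.
move=> e e0; set B := Num.sqrt (vcst v) * M.
have B0 : 0 <= B by rewrite mulr_ge0 ?sqrtr_ge0// (Horb_ge0 hf).
have e2 : 0 < e / 2 by rewrite divr_gt0.
have e3 : 0 < e / 2 / (B + 1) by rewrite divr_gt0// ltr_wpDl.
have [d1 d10 hd1] := hat_modulus w sv M e2.
have [d2 d20 hd2] := cexp_near0 e3.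
(* [d1] controls the transforms; the other two entries control the quotient of the Gaussians, whose
   exponent has modulus at most [cmod (z1 - z2) * (2 * w + 1)], because [|z1 - t| <= w] and
   [|z2 - z1| < 1]. *)
pose d := Num.min (Num.min d1 1) (d2 / (2 * w + 1)).
have c0 : 0 < 2 * w + 1 by rewrite ltr_wpDl// mulr_ge0.
exists d; split; first by rewrite !lt_min d10 ltr01 divr_gt0.
move=> z1 z2 zw1 zw2; rewrite !lt_min => /andP[/andP[zd1 zd2] zd3].
set t := reC z1; set G1 := gaussC (z1 - ofR t); set G2 := gaussC (z2 - ofR t).
have [/(W2_repP w sv)[Lg hg] gM] := Horb_rep w0 sv t hf.
have G0 : G1 != 0 by exact: gaussC_neq0.
have iG : cmod G1^-1 <= 1.
  by rewrite cmodV invf_le1 ?cmod_gauss_vertical// (lt_le_trans ltr01)// cmod_gauss_vertical.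
have E : horExt f z1 - horExt f z2 = G1^-1 * (G1 * horExt f z1 - G2 * horExt f z2) + horExt f z2 * (G2 * G1^-1 - 1).
  by apply: ext_diff_id; exact: mulVf.
(* Both points are compared through the same localization, at the real part of [z1]; the second
   summand corrects for the different Gaussian values. *)
rewrite E [ltRHS](splitr e); apply: le_lt_trans (cmodD _ _) _; apply: ltr_leD.
  rewrite (cmodM (_^-1)) (horExt_rep t hf zw1) (horExt_rep t hf zw2).
  apply: le_lt_trans (hd1 _ Lg gM z1 z2 zw1 zw2 zd1).
  by rewrite ler_piMl ?cmod_ge0.
have GE : G2 * G1^-1 = cexp (- ((z2 - z1) * (2 * (z1 - ofR t) + (z2 - z1)))).
  apply: (mulIf G0); rewrite mulfVK// /G1 /G2 /gaussC -cexpD; congr cexp; ring.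
rewrite (cmodM (horExt _ _)) GE.
have qd : cmod (- ((z2 - z1) * (2 * (z1 - ofR t) + (z2 - z1)))) < d2.
  rewrite cmodN (cmodM (z2 - z1)) (cmodB z2).
  apply: (@le_lt_trans _ _ (cmod (z1 - z2) * (2 * w + 1))); last by rewrite -ltr_pdivlMr.
  rewrite ler_wpM2l ?cmod_ge0//; apply: le_trans (cmodD _ _) _; apply: lerD; last by rewrite (cmodB z2) ltW.
  rewrite (_ : 2 * (z1 - ofR t) = ofR 2 * (z1 - ofR t)); last by rewrite (_ : ofR 2 = 2)// ofRD.
  rewrite (cmodM (ofR 2)) cmod_ofR ger0_norm// ler_wpM2l//.
  rewrite (_ : z1 - ofR t = iC * ofR (imC z1)); last by apply: eqC; rewrite !reimE /t; ring.
  by rewrite (cmodM iC) cmod_ofR cmod_i mul1r.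
apply: (@le_trans _ _ (B * (e / 2 / (B + 1)))).
  by apply: ler_pM; rewrite ?cmod_ge0//; [exact: horExt_bound hf zw2|exact/ltW/hd2].
rewrite mulrA ler_pdivrMr ?ltr_wpDl// mulrC ler_wpM2l ?(ltW e2)// lerDl//.
Qed.

Lemma UCb_within F : UCb_on (cl_strip w) F -> {within cl_strip w, continuous F}.
Proof.
move=> [_ UC]; apply/subspace_continuousP => z zw P /nbhsCP[e e0 eP].
have [d [d0 hd]] := UC e e0; rewrite nbhs_simpl /within /=; apply/nbhsCP; exists d => // y yd yw.
by apply: eP; exact: hd.
Qed.

Lemma cont_ext_le_normHor f F z : cont_ext w f F -> cl_strip w z -> inHor w v f ->
  cmod (F z) <= Num.sqrt (vcst v) * normHor w v f.
Proof.
move=> cF zw hf; apply/ler_addgt0Pr => e e0.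
have c0 : 0 < Num.sqrt (vcst v) by rewrite sqrtr_gt0 (vcst_gt0 v).
have e1 : 0 < e / Num.sqrt (vcst v) by rewrite divr_gt0.
have := cont_ext_bound (inHor_Horb sv hf (M := normHor w v f + e / Num.sqrt (vcst v)) _) cF zw.
rewrite mulrDr (mulrC _ (e / _)) divfK ?gt_eqF//; apply; by rewrite ltrDl.
Qed.

Lemma embed_UCb : exists K : R, 0 < K /\
     forall f : Cplx R -> Cplx R, inHor w v f ->
       exists F : Cplx R -> Cplx R, cont_ext w f F /\ UCb_on (cl_strip w) F /\
         forall z, cl_strip w z -> cmod (F z) <= K * normHor w v f.
Proof.
exists (Num.sqrt (vcst v)); split; first by rewrite sqrtr_gt0 (vcst_gt0 v).
move=> f hf; have hb : Horb w v f (normHor w v f + 1) by apply: inHor_Horb => //; rewrite ltrDl.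
have UC := horExt_UC hb.
have cE : cont_ext w f (horExt f) by split; [move=> z sz; exact: horExt_strip hb sz|exact: UCb_within].
exists (horExt f); split => //; split => // z zw; exact: cont_ext_le_normHor cE zw hf.
Qed.

Lemma reproducing (th : R) (phi : Cplx R -> Cplx R) : 0 < th -> Hinf0 (th + w) phi ->
     forall f F : Cplx R -> Cplx R, inHor w v f -> cont_ext w f F ->
       forall z : Cplx R, strip th z -> cl_strip w z ->
         cintegrable (fun s => invFT (fun u : Cplx R => phi (u - z) * f u) s
                                * cexp (- (iC * ofR s * z))) /\
         phi 0 * F z = cint (fun s => invFT (fun u : Cplx R => phi (u - z) * f u) s
                                       * cexp (- (iC * ofR s * z))).
Proof.
move=> th0 [hol dec] f F hf cF z sz zw.
have zth : `|imC z| < th by case: sz => // -[/eqP]; rewrite gt_eqF.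
(* Decay of order 2 is what [cauchyK] asks for. *)
have [K0 HK0] := dec 2%:R (ltr0Sn _ _).
pose K := `|K0| + 1; have K_gt0 : 0 < K by rewrite ltr_wpDl.
(* The strip on which [u |-> phi (u - z)] is sure to be holomorphic: [|imC u| + |imC z|] must stay
   below [th + w]. *)
pose w' := w + (th - `|imC z|); have ww' : w < w' by rewrite ltrDl subr_gt0.
have [C C0 HC] := holo_mul w0 ww' sv.
have hb : Horb w v f (normHor w v f + 1) by apply: inHor_Horb => //; rewrite ltrDl.
have M0 : 0 < normHor w v f + 1 by rewrite ltr_wpDl// normHor_ge0.
pose m (u : Cplx R) := phi (u - z).
have st x y : `|y| < w' -> strip (th + w) (mkC x y - z).
  move=> yw; left; rewrite !reimE; apply: le_lt_trans (ler_normB _ _) _.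
  by rewrite (_ : th + w = w' + `|imC z|) ?ltrD2r// /w'; ring.
have dm x y : `|y| < w' -> derivable m (mkC x y) 1.
  by move=> yw; apply: (@derivable_translate _ phi (- z)); apply: hol; exact: st.
have bm x y : `|y| < w' -> cmod (m (mkC x y)) <= K * cauchyK (x - reC z).
  move=> yw; apply: le_trans (HK0 _ (st x y yw)) _; rewrite !reimE powRN.
  set a := x - reC z; have a1 : 0 < 1 + `|a| by rewrite ltr_pwDl.
  rewrite powR_mulrn ?(ltW a1)//.
  apply: (@le_trans _ _ (K * ((1 + `|a|) ^+ 2)^-1)).
    by rewrite ler_wpM2r ?invr_ge0 ?sqr_ge0// (le_trans (ler_norm K0))// lerDl.
  rewrite ler_wpM2l ?(ltW K_gt0)// /cauchyK lef_pV2 ?posrE ?exprn_gt0 ?ltr_pwDl ?sqr_ge0//.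
  rewrite -(real_normK (num_real a)) (_ : (1 + `|a|) ^+ 2 = 1 + `|a| ^+ 2 + 2 * `|a|); last by ring.
  by rewrite lerDl mulr_ge0.
have [g rg _] := HC f m _ K (reC z) hb M0 K_gt0 dm bm.
have w'0 : `|0 : R| < w' by rewrite normr0; exact: le_lt_trans ww'.
have iF : cintegrable (fun x => (fun u : Cplx R => m u * f u) (ofR x)).
  apply: (@cintegrable_le _ _ (fun x => K * (Num.sqrt (vcst v) * (normHor w v f + 1)) * cauchyK (x - reC z))).
  - exact: rep_cmeas rg.
  - move=> x; rewrite (cmodM (m _)) mulrAC; apply: ler_pM; rewrite ?cmod_ge0//; first exact: (bm x 0 w'0).
    by apply: Horb_bounded hb _ => //; exact: strip_ofR.
  - exact: integrable_cauchyK_shift.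
have [/(W2_repP w sv)[LV hV] _] := rep_invFT w0 sv rg iF.
set V := invFT _ in LV hV.
(* The formula is the Fourier representation of [phi (. - z) * f] evaluated at [z]; it is known
   inside the strip and passes to the boundary by continuity. *)
have E : phi (z - z) * F z = hat V z.
  apply: (@cl_strip_eq (fun y => phi (y - z) * F y) (hat V)); first exact: zw.
  - by move=> y sy; rewrite -(hV y sy) (cF.1 y sy).
  - move=> u su hu; apply: cvgM; last exact: (within_seq cF.2 zw (fun n => strip_cl (su n)) hu).
    apply: (@derivable_seq (fun y => phi (y + - z)) z u); last exact: hu.
    apply: derivable_translate; apply: hol; left; rewrite subrr; change (is_true (`|0 : R| < th + w)).
    by rewrite normr0 ltr_wpDr.
  - move=> u su hu; exact: (hat_seq LV zw (fun n => strip_cl (su n)) hu).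
have kE : (fun s : R => V s * cexp (- (iC * ofR s * z))) = fun s => ker z s * V s.
  by apply/funext => s; rewrite [LHS]mulrC /ker (mulrAC iC).
rewrite -[phi 0](_ : phi (z - z) = _); last by rewrite subrr.
rewrite -/V kE E; split => //; exact: (hat_integrable sv zw LV).
Qed.

End Extension.

(** * Banach algebra structure *)

Section Algebra.
Context {R : realType}.
Notation mu := (@lebesgue_measure R).
Implicit Types (f F : Cplx R -> Cplx R) (g h : R -> Cplx R) (M N A B e x t : R) (a z : Cplx R).
Variables (w : R) (v : R -> R).
Hypothesis w0 : 0 <= w.
Hypothesis sv : strongly_admissible v.

Lemma HorbD f f' A B : Horb w v f A -> Horb w v f' B -> 0 < A -> 0 < B ->
  Horb w v (fun z => f z + f' z) (A + B).
Proof.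
move=> hf hf' A0 B0 t; have [g /(W2_repP w sv)[Lg hg] gM] := hf t.
have [g' /(W2_repP w sv)[Lg' hg'] gM'] := hf' t.
exists (fun s => g s + g' s); last exact: nWD_le.
apply/(W2_repP w sv); split; first exact: L2WD.
move=> z sz; rewrite (hatD sv (strip_le w0 sz) Lg Lg') -(hg z sz) -(hg' z sz) /locG; ring.
Qed.

Lemma HorbZ a f M : Horb w v f M -> Horb w v (fun z => a * f z) (cmod a * M).
Proof.
move=> hf t; have [g /(W2_repP w sv)[Lg hg] gM] := hf t.
exists (fun s => a * g s); last exact: nWZ_le.
apply/(W2_repP w sv); split; first exact: L2WZ.
move=> z sz; rewrite (hatZ sv a (strip_le w0 sz) Lg) -(hg z sz) /locG; ring.
Qed.

Lemma inHor_Horb_add f e : inHor w v f -> 0 < e -> Horb w v f (normHor w v f + e).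
Proof. by move=> hf e0; apply: inHor_Horb => //; rewrite ltrDl. Qed.

Lemma normHor_add_gt0 f e : inHor w v f -> 0 < e -> 0 < normHor w v f + e.
Proof. by move=> hf e0; rewrite ltr_wpDl// normHor_ge0. Qed.

Lemma inHorD f f' : inHor w v f -> inHor w v f' ->
  inHor w v (fun z => f z + f' z) /\
  normHor w v (fun z => f z + f' z) <= normHor w v f + normHor w v f'.
Proof.
move=> hf hf'.
have H e : 0 < e -> Horb w v (fun z => f z + f' z) (normHor w v f + normHor w v f' + e).
  move=> e0; have e2 : 0 < e / 2 by rewrite divr_gt0.
  have := HorbD (inHor_Horb_add hf e2) (inHor_Horb_add hf' e2) (normHor_add_gt0 hf e2) (normHor_add_gt0 hf' e2).
  by rewrite (_ : _ + _ + (_ + _) = normHor w v f + normHor w v f' + e)//; field.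
have i := (Horb_normHor sv (H 1 ltr01)).1; split => //; exact: normHor_le.
Qed.

Lemma inHorZ_le a f : inHor w v f -> inHor w v (fun z => a * f z) /\
  normHor w v (fun z => a * f z) <= cmod a * normHor w v f.
Proof.
move=> hf; have i := (Horb_normHor sv (HorbZ a (inHor_Horb_add hf ltr01))).1; split => //.
apply: normHor_le => // e e0.
have a1 : 0 < cmod a + 1 by rewrite ltr_wpDl ?cmod_ge0.
have e1 : 0 < e / (cmod a + 1) by rewrite divr_gt0.
apply: (Horb_le (HorbZ a (inHor_Horb_add hf e1))).
by rewrite mulrDr lerD2l mulrA ler_pdivrMr// mulrC ler_wpM2l ?(ltW e0)// lerDl.
Qed.

(** The reverse inequality comes from applying [inHorZ_le] to [a^-1]; the case [a = 0] is
    separate. *)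
Lemma inHorZ a f : inHor w v f -> inHor w v (fun z => a * f z) /\
  normHor w v (fun z => a * f z) = cmod a * normHor w v f.
Proof.
move=> hf; have [i le] := inHorZ_le a hf; split => //; apply/eqP; rewrite eq_le le/=.
have [a0|a0] := eqVneq a 0.
  have -> : cmod a = 0 by rewrite a0 cmod0.
  by rewrite mul0r normHor_ge0.
have [_] := inHorZ_le a^-1 i.
have -> : (fun z => a^-1 * (a * f z)) = f by apply/funext => z; rewrite mulrA mulVf ?mul1r.
have c0 : 0 < cmod a.
  by rewrite lt_neqAle cmod_ge0 andbT eq_sym; apply: contra_neq a0; exact: cmod_eq0.
by rewrite cmodV ler_pdivlMl.
Qed.

Lemma normHor_eq0 f : inHor w v f -> normHor w v f = 0 -> forall z, strip w z -> f z = 0.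
Proof.
move=> hf f0 z sz; apply: cmod_eq0; apply/eqP; rewrite eq_le cmod_ge0 andbT.
apply/ler_addgt0Pr => e e0; rewrite add0r.
have c0 : 0 < Num.sqrt (vcst v) by rewrite sqrtr_gt0 (vcst_gt0 v).
have e1 : 0 < e / Num.sqrt (vcst v) by rewrite divr_gt0.
have := Horb_bounded w0 sv (inHor_Horb_add hf e1) sz.
by rewrite f0 add0r mulrC divfK// gt_eqF.
Qed.

(** Convolving the densities of G f and G f' would represent G^2 f f'. Each factor therefore
    receives only half a Gaussian, a multiplier to which [holo_mul] applies. *)
Lemma HorbM : exists2 C : R, 0 < C & forall f f' A B, Horb w v f A -> Horb w v f' B -> 0 < A -> 0 < B ->
  Horb w v (fun z => f z * f' z) (C * A * B).
Proof.
have w1 : w < w + 1 by rewrite ltrDl.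
have w10 : 0 < w + 1 := le_lt_trans w0 w1.
have [K K1 HK] := v_quasi sv; have K0 : 0 < K := lt_le_trans ltr01 K1.
have [C C0 HC] := holo_mul w0 w1 sv.
(* The exponential bounds the growth of the half Gaussian on the strip of half-width [w + 1]; the 2
   comes from [exp (- x ^ 2 / 2) <= 2 * cauchyK x]. *)
pose A1 : R := expR ((w + 1) ^+ 2 / 2) * 2.
have A10 : 0 < A1 by rewrite mulr_gt0 ?expR_gt0.
have S0 : 0 < Num.sqrt (vcst v) by rewrite sqrtr_gt0 (vcst_gt0 v).
exists (3 * K * Num.sqrt (vcst v) * (C * A1) * (C * A1)) => [|f f' A B hf hf' A0 B0 t].
  have CA0 : 0 < C * A1 by exact: mulr_gt0.
  by apply: mulr_gt0 => //; apply: mulr_gt0 => //; apply: mulr_gt0 => //; exact: mulr_gt0.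
pose m z := cexp (- (ofR 2^-1 * ((z + - ofR t) * (z + - ofR t)))).
have dm x y : `|y| < w + 1 -> derivable m (mkC x y) 1.
  move=> _; apply: derivable_cexp_comp.
  have dz : derivable (fun z => z + - ofR t) (mkC x y) 1.
    by apply: derivableD; [exact: derivable_id|exact: derivable_cst].
  apply: derivableN; apply: derivableM; first exact: derivable_cst.
  by apply: derivableM; exact: dz.
have bm x y : `|y| < w + 1 -> cmod (m (mkC x y)) <= A1 * cauchyK (x - t).
  move=> yw; rewrite /m cmod_cexp !reimE.
  rewrite (_ : expR _ = expR (y ^+ 2 / 2) * expR (- ((x - t) ^+ 2 / 2))); last by rewrite -expRD; congr expR; field.
  rewrite /A1 -mulrA; apply: ler_pM; rewrite ?expR_ge0//.
    rewrite ler_expR ler_pM2r ?invr_gt0// -(real_normK (num_real y)) ler_sqr ?nnegrE ?(ltW yw)//.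
    exact: ltW.
  rewrite expRN /cauchyK ler_pdivlMr ?ltr_pwDl ?sqr_ge0// mulrC ler_pdivrMr ?expR_gt0//.
  have := expR_ge1Dx ((x - t) ^+ 2 / 2); move: (expR _) (sqr_ge0 (x - t)) => E; move: (_ ^+ 2) => y2; lra.
have [g /(W2_repP w sv)[Lg hg] gM] := HC f m A A1 t hf A0 A10 dm bm.
have [g' /(W2_repP w sv)[Lg' hg'] gM'] := HC f' m B A1 t hf' B0 A10 dm bm.
have CA0 : 0 < C * A1 by exact: mulr_gt0.
have p1 : 0 < C * A1 * A by exact: mulr_gt0.
have p2 : 0 < C * A1 * B by exact: mulr_gt0.
exists (conv g g').
  apply/(W2_repP w sv); split; first exact: (algebra_L2W w0 sv K1 HK Lg Lg' p1 p2 gM gM').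
  move=> z sz; rewrite (algebra_hat w0 sv K1 HK Lg Lg' p1 p2 gM gM' (strip_le w0 sz)) -(hg z sz) -(hg' z sz).
  have E : gaussC (z - ofR t) = m z * m z.
    rewrite /gaussC /m -cexpD; congr cexp.
    have h2 : ofR 2^-1 + ofR 2^-1 = 1 :> Cplx R by rewrite -ofRD -[RHS]ofR1; congr ofR; field.
    by rewrite -opprD -mulrDl h2 mul1r.
  rewrite /locG E; ring.
apply: le_trans (algebra_nW w0 sv K1 HK Lg Lg' p1 p2 gM gM') _.
by rewrite le_eqVlt; apply/orP; left; apply/eqP; ring.
Qed.

Lemma inHorM : exists K : R, 0 < K /\ forall f f', inHor w v f -> inHor w v f' ->
  inHor w v (fun z => f z * f' z) /\
  normHor w v (fun z => f z * f' z) <= K * normHor w v f * normHor w v f'.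
Proof.
have [C C0 HC] := HorbM; exists C; split => // f f' hf hf'.
have H e := fun e0 : 0 < e => HC _ _ _ _ (inHor_Horb_add hf e0) (inHor_Horb_add hf' e0)
  (normHor_add_gt0 hf e0) (normHor_add_gt0 hf' e0).
have i := (Horb_normHor sv (H 1 ltr01)).1; split => //.
apply: normHor_le => // e e0.
set p := normHor w v f; set q := normHor w v f'.
have p0 : 0 <= p by exact: normHor_ge0. have q0 : 0 <= q by exact: normHor_ge0.
have D0 : 0 < C * (p + q + 1) by rewrite mulr_gt0// ltr_wpDl// addr_ge0.
(* With [d <= 1], the excess of [C * (p + d) * (q + d)] over [C * p * q] is at most
   [d * (C * (p + q + 1))]. *)
pose d := Num.min 1 (e / (C * (p + q + 1))).
have d0 : 0 < d by rewrite lt_min ltr01 divr_gt0.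
apply: (Horb_le (H d d0)); rewrite -/p -/q.
have d1 : d <= 1 by rewrite ge_min lexx.
have d2 : d * (C * (p + q + 1)) <= e by rewrite -ler_pdivlMr// ge_min lexx orbT.
have d3 : d * d <= d by rewrite ler_piMl// ltW.
apply: (@le_trans _ _ (C * p * q + d * (C * (p + q + 1)))); last by rewrite lerD2l.
have -> : C * (p + d) * (q + d) = C * p * q + (d * (C * (p + q)) + C * (d * d)) by ring.
have -> : d * (C * (p + q + 1)) = d * (C * (p + q)) + C * d by ring.
by rewrite !lerD2l ler_wpM2l// ltW.
Qed.

Lemma limn_einf_le (u : (\bar R)^nat) (c : \bar R) : (forall n, u n <= c)%E -> (limn_einf u <= c)%E.
Proof.
move=> uc; rewrite limn_einf_lim; apply: lime_le; first exact: is_cvg_einfs.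
by apply: nearW => n; apply: le_trans (uc n); apply: ereal_inf_lbound; exists n => /=.
Qed.

(** Fatou's lemma for the weighted squares. Pointwise limits are what dominated convergence gives
    for the inverse transforms of a Cauchy sequence. *)
Lemma nsq_fatou (D : nat -> R -> Cplx R) h (c : R) : (forall n, L2W w v (D n)) ->
  (forall n, nsq w v (D n) <= c%:E)%E -> (forall s, D n s @[n --> \oo] --> h s) ->
  L2W w v h /\ (nsq w v h <= c%:E)%E.
Proof.
move=> LD nD cD.
have mh : cmeas h.
  split.
    apply: (@measurable_fun_cvg _ _ _ _ (fun n s => reC (D n s))) => [n|s _]; first exact: (LD n).1.1.
    exact: ((cvgC_reim _ _).1 (cD s)).1.
  apply: (@measurable_fun_cvg _ _ _ _ (fun n s => imC (D n s))) => [n|s _]; first exact: (LD n).1.2.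
  exact: ((cvgC_reim _ _).1 (cD s)).2.
have cW s : ((Wt w v s * cmod (D n s)) ^+ 2)%:E @[n --> \oo] --> ((Wt w v s * cmod (h s)) ^+ 2)%:E.
  have c1 : cmod (D n s) @[n --> \oo] --> cmod (h s).
    exact: (cvg_comp _ _ (cD s) (@continuous_cmod R (h s))).
  have c2 : Wt w v s * cmod (D n s) @[n --> \oo] --> Wt w v s * cmod (h s).
    by apply: cvgM => //; exact: cvg_cst.
  by apply: cvg_EFin; [exact: nearW|exact: cvgM].
have le : (nsq w v h <= c%:E)%E.
  apply: le_trans (limn_einf_le nD).
  have mf n : measurable_fun setT (fun s => ((Wt w v s * cmod (D n s)) ^+ 2)%:E).
    by apply/measurable_EFinP; apply: mnsq => //; exact: (LD n).1.
  have f0 n s : setT s -> (0 <= ((Wt w v s * cmod (D n s)) ^+ 2)%:E)%E by rewrite lee_fin sqr_ge0.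
  apply: le_trans (fatou mu measurableT mf f0).
  rewrite le_eqVlt; apply/orP; left; apply/eqP; apply: eq_integral => s _.
  by rewrite (cvg_limn_einf_sup (cW s)).1.
split => //; split => //; exact: le_lt_trans le (ltry _).
Qed.

End Algebra.

(** * Completeness *)

Section Completeness.
Context {R : realType}.
Notation mu := (@lebesgue_measure R).
Implicit Types (f F : Cplx R -> Cplx R) (g h : R -> Cplx R) (M N A B e x t : R) (a z : Cplx R).

Lemma real_cauchy_cvg (s : nat -> R) :
  (forall e, 0 < e -> exists N0 : nat, forall m n, (N0 <= m)%N -> (N0 <= n)%N -> `|s m - s n| < e) ->
  s n @[n --> \oo] --> lim (s n @[n --> \oo]).
Proof.
move=> hs; apply/cauchy_cvgP/cauchy_ballP => e e0; have [N0 hN] := hs e e0.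
pose D := [set y | exists2 m, (N0 <= m)%N & y = s m].
have hD : nbhs (s n @[n --> \oo]) D by exists N0 => // m Nm; exists m.
exists (D, D); first by split.
by case=> _ _ [/= [m Nm ->] [n Nn ->]]; rewrite /ball/=; exact: hN.
Qed.

Lemma cplx_cauchy_cvg (s : nat -> Cplx R) :
  (forall e, 0 < e -> exists N0 : nat, forall m n, (N0 <= m)%N -> (N0 <= n)%N -> cmod (s m - s n) < e) ->
  s n @[n --> \oo] --> mkC (lim (reC (s n) @[n --> \oo])) (lim (imC (s n) @[n --> \oo])).
Proof.
move=> hs; apply/cvgC_reim; split; apply: real_cauchy_cvg => e /hs[N0 hN]; exists N0 => m n Nm Nn.
- by apply: le_lt_trans (hN m n Nm Nn); rewrite -reCN -reCD cmod_re.
- by apply: le_lt_trans (hN m n Nm Nn); rewrite -imCN -imCD cmod_im.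
Qed.

Lemma cmod_lim_le (s : nat -> Cplx R) a z (c : R) (N0 : nat) : s n @[n --> \oo] --> z ->
  (forall n, (N0 <= n)%N -> cmod (a - s n) <= c) -> cmod (a - z) <= c.
Proof.
move=> /cvgC_seqP hs h; apply/ler_addgt0Pr => e /hs[N1 hN1].
have := hN1 (maxn N0 N1) (leq_maxr _ _); have := h (maxn N0 N1) (leq_maxl _ _).
move=> h1 h2; rewrite (_ : a - z = (a - s (maxn N0 N1)) + (s (maxn N0 N1) - z)); last by ring.
by apply: le_trans (cmodD _ _) _; apply: lerD => //; exact: ltW.
Qed.

Variables (w : R) (v : R -> R).
Hypothesis w0 : 0 <= w.
Hypothesis sv : strongly_admissible v.

Lemma hatB g h z : `|imC z| <= w -> L2W w v g -> L2W w v h -> hat (fun s => g s - h s) z = hat g z - hat h z.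
Proof.
move=> zw Lg Lh; rewrite /hat -(cintB (hat_integrable sv zw Lg) (hat_integrable sv zw Lh)).
by congr cint; apply/funext => s; rewrite mulrBr.
Qed.

Lemma invFTB (H1 H2 : Cplx R -> Cplx R) s : cintegrable (fun x => H1 (ofR x)) -> cintegrable (fun x => H2 (ofR x)) ->
  invFT (fun z => H1 z - H2 z) s = invFT H1 s - invFT H2 s.
Proof.
have ip (H : Cplx R -> Cplx R) : cintegrable (fun x => H (ofR x)) ->
    cintegrable (fun x => ofR (2 * pi)^-1 * H (ofR x) * cexp (iC * ofR x * ofR s)).
  move=> iH; have [m n] := (cintegrableP _).1 (cintegrableZ (ofR (2 * pi)^-1) iH).
  apply: (cintegrable_le _ _ n); first by apply: cmeasM => //; exact: cmeas_phase.
  by move=> x; rewrite (cmodM (_ * H _)) cmod_phase mulr1.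
move=> i1 i2; rewrite /invFT -cintB; [|exact: ip|exact: ip].
by congr cint; apply/funext => x; rewrite mulrBr mulrBl.
Qed.

(** The limit is built pointwise from the sup bound rather than from limits of densities. Its
    inverse transforms are pointwise limits of those of [u n], Fatou bounds the differences, and it
    remains to check that they represent the localizations of the limit. *)
Lemma Horb_complete (u : nat -> Cplx R -> Cplx R) : (forall n, exists M, Horb w v (u n) M) ->
  (forall e, 0 < e -> exists N0 : nat, forall m n, (N0 <= m)%N -> (N0 <= n)%N ->
     Horb w v (fun z => u m z - u n z) e) ->
  exists f, forall e, 0 < e -> exists N0 : nat, forall n, (N0 <= n)%N -> Horb w v (fun z => u n z - f z) e.
Proof.
move=> hu hC; set S := Num.sqrt (vcst v); have S0 : 0 < S by rewrite sqrtr_gt0 (vcst_gt0 v).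
(* Convergence is claimed only on the strip; elsewhere [lim] may return a default value, which
   neither the norm nor membership sees. *)
pose f z := mkC (lim (reC (u n z) @[n --> \oo])) (lim (imC (u n z) @[n --> \oo])).
have cf z : strip w z -> u n z @[n --> \oo] --> f z.
  move=> sz; apply: cplx_cauchy_cvg => e e0; have e1 : 0 < e / S / 2 by rewrite !divr_gt0.
  have [N0 hN] := hC _ e1; exists N0 => m n Nm Nn.
  apply: le_lt_trans (Horb_bounded w0 sv (hN m n Nm Nn) sz) _.
  by rewrite -/S mulrCA !mulrA divfK ?gt_eqF// ltr_pdivrMr// ltr_pMr// ltr1n.
exists f => e e0; have [N0 hN0] := hC e e0; exists N0 => n Nn t.
have [N1 hN1] := hC 1 ltr01; have [M1 hM1] := hu N1.
have M10 := Horb_ge0 hM1.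
pose N2 := maxn N0 N1.
pose V k := invFT (locG t (u k)); pose V' := invFT (locG t f).
have repV k : W2_rep w v (locG t (u k)) (V k).
  by have [M hM] := hu k; exact: (Horb_rep w0 sv t hM).1.
have iV k : cintegrable (fun x => locG t (u k) (ofR x)).
  by have [M hM] := hu k; exact: (Horb_integrable w0 sv t hM).
have VV m k e' s : Horb w v (fun z => u m z - u k z) e' ->
    invFT (locG t (fun z => u m z - u k z)) s = V m s - V k s.
  move=> _; rewrite -invFTB//; congr (invFT _ s); apply/funext => z; rewrite /locG; ring.
have B0 : 0 <= S * (1 + M1) by rewrite mulr_ge0 ?addr_ge0// ltW.
have ub k x : (N1 <= k)%N -> cmod (u k (ofR x)) <= S * (1 + M1).
  move=> Nk; rewrite (_ : u k (ofR x) = (u k (ofR x) - u N1 (ofR x)) + u N1 (ofR x)); last by rewrite subrK.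
  apply: le_trans (cmodD _ _) _; rewrite mulrDr; apply: lerD.
    exact: (Horb_bounded w0 sv (hN1 k N1 Nk (leqnn _)) (strip_ofR x w0)).
  exact: (Horb_bounded w0 sv hM1 (strip_ofR x w0)).
(* The shift of the index by [N2] makes the uniform bound [ub] valid for every term. *)
have cV s : V (k + N2)%N s @[k --> \oo] --> V' s.
  pose b (x : R) := (2 * pi)^-1 * (S * (1 + M1)) * cauchyK (x - t).
  pose hn (k : nat) (x : R) := ofR (2 * pi)^-1 * locG t (u (k + N2)%N) (ofR x) * cexp (iC * ofR x * ofR s).
  have p0 : 0 <= (2 * pi)^-1 :> R by rewrite invr_ge0 mulr_ge0// pi_ge0.
  have mhn k : cmeas (hn k).
    apply: cmeasM; last exact: cmeas_phase.
    by apply: cmeasM; [exact: cmeas_cst|exact: ((cintegrableP _).1 (iV _)).1].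
  have chn x : hn k x @[k --> \oo] --> ofR (2 * pi)^-1 * locG t f (ofR x) * cexp (iC * ofR x * ofR s).
    apply: cvgM; last exact: cvg_cst.
    apply: cvgM; first exact: cvg_cst.
    apply: cvgM; first exact: cvg_cst.
    have := cf _ (strip_ofR x w0); rewrite -(cvg_shiftn N2); exact.
  have bhn k x : cmod (hn k x) <= b x.
    rewrite /hn (cmodM (_ * locG _ _ _)) cmod_phase mulr1 (cmodM (ofR _)) cmod_ofR ger0_norm// /b -[leRHS]mulrA.
    rewrite ler_wpM2l// cmod_locG_ofR mulrC; apply: ler_pM; rewrite ?cmod_ge0 ?expR_ge0//.
      by apply: ub; rewrite (leq_trans (leq_maxr N0 N1))// leq_addl.
    exact: expRN_sqr_le_cauchyK.
  by have [_] := cint_dct mhn chn bhn (integrable_cauchyK_shift _ _).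
(* For fixed [m], the differences of densities along the tail have norm at most [e'] and converge
   pointwise to [V m - V']. *)
have key m e' (N3 : nat) : (forall k, (N3 <= k)%N -> Horb w v (fun z => u m z - u k z) e') ->
    L2W w v (fun s => V m s - V' s) /\ nW w v (fun s => V m s - V' s) <= e'.
  move=> hm; have e'0 := Horb_ge0 (hm _ (leqnn _)).
  pose p k := (k + (N2 + N3))%N.
  have cVp s : V (p k) s @[k --> \oo] --> V' s.
    have /cvgC_seqP hs := cV s; apply/cvgC_seqP => e1 /hs[N5 hN5]; exists N5 => k Nk.
    by have := hN5 (k + N3)%N (leq_trans Nk (leq_addr _ _)); rewrite /p (addnC N2) addnA.
  have le k : (N3 <= p k)%N by rewrite /p addnA leq_addl.
  have H k : L2W w v (fun s => V m s - V (p k) s) /\ (nsq w v (fun s => (V m s - V (p k) s)%R) <= (e' ^+ 2)%:E)%E.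
    have [/(W2_repP w sv)[L _] n0] := Horb_rep w0 sv t (hm _ (le k)).
    rewrite (funext (fun s => VV _ _ _ s (hm _ (le k)))) in L n0; split; first exact: L.
    by rewrite (nW_sq L) lee_fin ler_sqr ?nnegrE ?nW_ge0.
  have [L le'] := nsq_fatou sv (fun k => (H k).1) (fun k => (H k).2)
    (fun s => cvgB (cvg_cst (V m s)) (cVp s)).
  by split => //; exact: nW_le.
have [LD nD] := key n e N0 (fun k Nk => hN0 n k Nn Nk).
have [LVn hVn] := (W2_repP w sv _ _).1 (repV n).
have LV' : L2W w v V'.
  have := L2WD sv LVn (L2WZ sv (- 1) LD); congr L2W; apply/funext => s /=; ring.
(* Fatou says nothing about the transform of [V']. Both [u m - f] at [z] and the density [V m - V']
   become arbitrarily small in [m], and [V m] does represent [u m]. *)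
have hatV z : strip w z -> locG t f z = hat V' z.
  move=> sz; have zw := strip_le w0 sz.
  apply/eqP; rewrite -subr_eq0; apply/eqP; apply: cmod_eq0; apply/eqP; rewrite eq_le cmod_ge0 andbT.
  apply/ler_addgt0Pr => d d0; rewrite add0r.
  pose G := cmod (gaussC (z - ofR t)); have G0 : 0 <= G by exact: cmod_ge0.
  have c0 : 0 < S * (G + 1) by rewrite mulr_gt0// ltr_wpDl.
  have d1 : 0 < d / (S * (G + 1)) by rewrite divr_gt0.
  have [N3 hN3] := hC _ d1; pose m := maxn N2 N3.
  have Nm : (N3 <= m)%N by exact: leq_maxr.
  have Hm k : (N3 <= k)%N -> Horb w v (fun z => u m z - u k z) (d / (S * (G + 1))) by exact: hN3.
  have [LDm nDm] : L2W w v (fun s => V m s - V' s) /\ nW w v (fun s => V m s - V' s) <= d / (S * (G + 1)).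
    exact: key Hm.
  have [LVm hVm] := (W2_repP w sv _ _).1 (repV m).
  have h1 : cmod (u m z - f z) <= S * (d / (S * (G + 1))).
    apply: (cmod_lim_le (N0 := N3) (cf z sz)) => k Nk.
    exact: (Horb_bounded w0 sv (Hm k Nk) sz).
  have h2 := hat_bound sv zw LDm.
  have -> : locG t f z - hat V' z = hat (fun s => V m s - V' s) z - gaussC (z - ofR t) * (u m z - f z).
    rewrite (hatB zw LVm LV') -(hVm z sz) /locG; ring.
  apply: le_trans (cmodBD _ _) _; rewrite (cmodM (gaussC _)) -/G.
  apply: (@le_trans _ _ (S * (d / (S * (G + 1))) + G * (S * (d / (S * (G + 1)))))).
    apply: lerD; last by rewrite ler_wpM2l.
    by apply: le_trans h2 _; rewrite ler_wpM2l ?(ltW S0).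
  rewrite le_eqVlt; apply/orP; left; apply/eqP; field.
  by rewrite !gt_eqF// ltr_wpDl.
exists (fun s => V n s - V' s) => //; apply/(W2_repP w sv); split => // z sz.
rewrite (hatB (strip_le w0 sz) LVn LV') -(hVn z sz) -(hatV z sz) /locG; ring.
Qed.

End Completeness.

(** * Boundary values *)

Section Boundary.
Context {R : realType}.
Notation mu := (@lebesgue_measure R).
Implicit Types (f F b : Cplx R -> Cplx R) (g h k : R -> Cplx R) (M N A B D e x y t s : R) (a z : Cplx R).

(** Boundary limits exist only almost everywhere; multiplying by the indicator of the complement of
    a null set restores convergence at every point. *)
Lemma cint_dct_ae (hn : nat -> R -> Cplx R) h (B : R -> R) : (forall n, cmeas (hn n)) -> cmeas h ->
  {ae mu, forall x, hn n x @[n --> \oo] --> h x} -> (forall n x, cmod (hn n x) <= B x) ->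
  mu.-integrable setT (EFin \o B) -> cint (hn n) @[n --> \oo] --> cint h.
Proof.
move=> mhn mh [N [mN N0 hN]] hB iB.
pose chi (x : R) : Cplx R := ofR (\1_(~` N) x).
have mchi : cmeas chi by apply: cmeas_ofR; apply: measurable_indic; exact: measurableC.
have chiN x : N x -> chi x = 0 by move=> Nx; rewrite /chi indicE memNset ?ofR0//; apply.
have chiC x : ~ N x -> chi x = 1 by move=> Nx; rewrite /chi indicE mem_set ?ofR1.
have E g : cmeas g -> cint (fun x => chi x * g x) = cint g.
  move=> mg; apply: cint_ae => //; first exact: cmeasM.
  exists N; split => // x /= nE; apply: contrapT => Nx; apply: nE.
  by rewrite chiC// mul1r.
rewrite -(E h mh) (_ : (fun n => cint (hn n)) = fun n => cint (fun x => chi x * hn n x)); last first.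
  by apply/funext => n; rewrite E.
apply: (@cint_dct _ (fun n x => chi x * hn n x) (fun x => chi x * h x) B _ _ _ iB).2.
- by move=> n; exact: cmeasM.
- move=> x; have [Nx|Nx] := pselect (N x).
    rewrite (chiN x Nx) mul0r (_ : (fun n => 0 * hn n x) = fun=> 0); first exact: cvg_cst.
    by apply/funext => n; rewrite mul0r.
  rewrite (chiC x Nx) mul1r (_ : (fun n => 1 * hn n x) = fun n => hn n x); last by apply/funext => n; rewrite mul1r.
  by apply: contrapT => nc; apply: Nx; apply: hN.
- move=> n x; have [Nx|Nx] := pselect (N x).
    by rewrite (chiN x Nx) mul0r cmod0 (le_trans _ (hB n x))// cmod_ge0.
  by rewrite (chiC x Nx) mul1r.
Qed.

Variables (v : R -> R).
Hypothesis sv : strongly_admissible v.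

(** Since [v s >= 1], the additive term [v y] of quasi-subadditivity is absorbed into a multiple of
    [v s]. *)
Lemma v_shift y : exists2 K : R, 0 < K & forall s, v (s + y) <= K * v s.
Proof.
have [K K1 HK] := v_quasi sv; have K0 : 0 < K := lt_le_trans ltr01 K1.
exists (K * (1 + v y)) => [|s]; first by rewrite mulr_gt0// ltr_wpDr// ltW// (v_gt0 sv).
apply: le_trans (HK s y) _; rewrite -mulrA ler_wpM2l ?(ltW K0)// mulrDl mul1r lerD2l.
by rewrite ler_peMr ?(v_ge1 sv)// ltW// (v_gt0 sv).
Qed.

Lemma Wt0 s : Wt 0 v s = v s. Proof. by rewrite /Wt mul0r expR0 mulr1. Qed.

Lemma nsq_shift (w : R) k y : cmeas k ->
  (\int[mu]_s ((Wt w v (s + y) * cmod (k (s + y))) ^+ 2)%:E)%E = nsq w v k.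
Proof.
move=> mk; have m : measurable_fun setT (fun s => ((Wt w v s * cmod (k s)) ^+ 2)%:E).
  by apply/measurable_EFinP; exact: mnsq.
rewrite /nsq (ge0_integral_affine y ltr01 m); last by move=> s; rewrite lee_fin sqr_ge0.
by rewrite mul1e; apply: eq_integral => s _; rewrite mul1r.
Qed.

Lemma sqr_le_sum (X Y Z c : R) : 0 <= X -> 0 <= c -> 0 <= Y -> 0 <= Z -> X <= c * Y \/ X <= c * Z ->
  X ^+ 2 <= c ^+ 2 * (Y ^+ 2 + Z ^+ 2).
Proof.
move=> X0 c0 Y0 Z0 [h|h].
  apply: (@le_trans _ _ ((c * Y) ^+ 2)); first by rewrite ler_sqr ?nnegrE// mulr_ge0.
  by rewrite exprMn ler_wpM2l ?sqr_ge0// lerDl sqr_ge0.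
apply: (@le_trans _ _ ((c * Z) ^+ 2)); first by rewrite ler_sqr ?nnegrE// mulr_ge0.
by rewrite exprMn ler_wpM2l ?sqr_ge0// lerDr sqr_ge0.
Qed.

(** Stated for arbitrary densities because it serves twice: once with [bdk] for a function already
    in the space, once with contour-shift identities for a bounded holomorphic function. *)
Lemma two_sided (w D : R) : 0 <= w -> 0 < D -> exists2 C : R, 0 < C & forall g k1 k2 A B,
  cmeas g -> cmeas k1 -> cmeas k2 -> 0 <= A -> 0 <= B ->
  (nsq 0 v k1 <= (A ^+ 2)%:E)%E -> (nsq 0 v k2 <= (B ^+ 2)%:E)%E ->
  (forall s, expR (w * s) * cmod (g s) <= D * cmod (k1 (s - 2 * w))) ->
  (forall s, expR (- (w * s)) * cmod (g s) <= D * cmod (k2 (s + 2 * w))) ->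
  L2W w v g /\ nW w v g <= C * (A + B).
Proof.
move=> w0 D0; have [K1 K10 HK1] := v_shift (2 * w); have [K2 K20 HK2] := v_shift (- (2 * w)).
pose C := D * (K1 + K2); have C0 : 0 < C by rewrite mulr_gt0// addr_gt0.
exists C => // g k1 k2 A B mg mk1 mk2 A0 B0 n1 n2 h1 h2.
pose p1 s := Wt 0 v (s - 2 * w) * cmod (k1 (s - 2 * w)).
pose p2 s := Wt 0 v (s + 2 * w) * cmod (k2 (s + 2 * w)).
have p10 s : 0 <= p1 s by rewrite mulr_ge0 ?cmod_ge0// ltW// Wt_gt0.
have p20 s : 0 <= p2 s by rewrite mulr_ge0 ?cmod_ge0// ltW// Wt_gt0.
have mp1 : measurable_fun setT (fun s => (p1 s ^+ 2)%:E).
  apply/measurable_EFinP; apply: (measurableT_comp (mnsq 0 sv mk1)).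
  by apply: measurable_funB; [exact: measurable_id|exact: measurable_cst].
have mp2 : measurable_fun setT (fun s => (p2 s ^+ 2)%:E).
  apply/measurable_EFinP; apply: (measurableT_comp (mnsq 0 sv mk2)).
  by apply: measurable_funD; [exact: measurable_id|exact: measurable_cst].
have pt s : (Wt w v s * cmod (g s)) ^+ 2 <= C ^+ 2 * (p1 s ^+ 2 + p2 s ^+ 2).
  have vs : 0 <= v s by rewrite ltW// (v_gt0 sv).
  apply: sqr_le_sum => //; [by rewrite mulr_ge0 ?cmod_ge0// ltW// Wt_gt0|exact: ltW|].
  (* On each half-line the weight [expR (w * |s|)] is one of the two one-sided exponentials; moving
     [v] across the translation costs [K1] or [K2]. *)
  have [s0|s0] := leP 0 s; [left|right]; rewrite /Wt -mulrA.
    rewrite ger0_norm// /p1 Wt0 /C; apply: le_trans (ler_wpM2l vs (h1 s)) _.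
    have := HK1 (s - 2 * w); rewrite subrK => hv.
    have q0 : 0 <= D * cmod (k1 (s - 2 * w)) by rewrite mulr_ge0 ?cmod_ge0// ltW.
    apply: le_trans (ler_wpM2r q0 hv) _.
    have vk : 0 <= v (s - 2 * w) * cmod (k1 (s - 2 * w)) by rewrite mulr_ge0 ?cmod_ge0// ltW// (v_gt0 sv).
    rewrite [leLHS](_ : _ = D * K1 * (v (s - 2 * w) * cmod (k1 (s - 2 * w)))); last by ring.
    by rewrite ler_wpM2r// ler_wpM2l ?(ltW D0)// lerDl ltW.
  rewrite ltr0_norm// mulrN /p2 Wt0 /C; apply: le_trans (ler_wpM2l vs (h2 s)) _.
  have := HK2 (s + 2 * w); rewrite addrK => hv.
  have q0 : 0 <= D * cmod (k2 (s + 2 * w)) by rewrite mulr_ge0 ?cmod_ge0// ltW.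
  apply: le_trans (ler_wpM2r q0 hv) _.
  have vk : 0 <= v (s + 2 * w) * cmod (k2 (s + 2 * w)) by rewrite mulr_ge0 ?cmod_ge0// ltW// (v_gt0 sv).
  rewrite [leLHS](_ : _ = D * K2 * (v (s + 2 * w) * cmod (k2 (s + 2 * w)))); last by ring.
  by rewrite ler_wpM2r// ler_wpM2l ?(ltW D0)// lerDr ltW.
have le : (nsq w v g <= ((C * (A + B)) ^+ 2)%:E)%E.
  apply: (@le_trans _ _ (\int[mu]_s ((C ^+ 2)%:E * ((p1 s ^+ 2)%:E + (p2 s ^+ 2)%:E)))%E).
    apply: ge0_le_integral; first exact: measurableT.
    - by move=> s _; rewrite lee_fin sqr_ge0.
    - by apply/measurable_EFinP; exact: mnsq.
    - by apply: emeasurable_funM; [exact: measurable_cst|exact: emeasurable_funD].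
    - by move=> s _; rewrite -EFinD -EFinM lee_fin; exact: pt.
  rewrite ge0_integralZl_EFin//; last 3 first.
  - by move=> s _; rewrite -EFinD lee_fin addr_ge0 ?sqr_ge0.
  - exact: emeasurable_funD.
  - exact: sqr_ge0.
  rewrite ge0_integralD//; last 2 first.
  - by move=> s _; rewrite lee_fin sqr_ge0.
  - by move=> s _; rewrite lee_fin sqr_ge0.
  have -> : (\int[mu]_s (p1 s ^+ 2)%:E = nsq 0 v k1)%E by exact: nsq_shift.
  have -> : (\int[mu]_s (p2 s ^+ 2)%:E = nsq 0 v k2)%E by exact: nsq_shift.
  have -> : ((C * (A + B)) ^+ 2)%:E = ((C ^+ 2)%:E * ((A + B) ^+ 2)%:E)%E by rewrite exprMn EFinM.
  apply: lee_wpmul2l; first by rewrite lee_fin sqr_ge0.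
  apply: le_trans (leeD n1 n2) _; rewrite -EFinD lee_fin sqrrD -addrA lerD2l lerDr.
  by rewrite mulrn_wge0// mulr_ge0.
split; first by split => //; exact: le_lt_trans le (ltry _).
by apply: nW_le => //; rewrite mulr_ge0 ?addr_ge0// ltW.
Qed.

(* The density of [x |-> G(x - t) F(x + iy)] when [g] is the density of [G(. - t) F]. *)
Definition bdk y t g (q : R) : Cplx R :=
  ofR (expR (- y ^+ 2)) * ker (ofR t) (2 * y) * ofR (expR (y * (q + 2 * y))) * g (q + 2 * y).

Lemma cmod_bdk y t g q : cmod (bdk y t g q) = expR (- y ^+ 2) * (expR (y * (q + 2 * y)) * cmod (g (q + 2 * y))).
Proof.
rewrite /bdk (cmodM (_ * ofR _)) (cmodM (_ * ker _ _)) (cmodM (ofR _)) cmod_ker !cmod_ofR !(ger0_norm (expR_ge0 _)).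
by rewrite (_ : imC (ofR t) = 0)// mul0r expR0 mulr1 mulrA.
Qed.

Lemma cmeas_bdk y t g : cmeas g -> cmeas (bdk y t g).
Proof.
move=> mg; have ms : measurable_fun setT (fun q : R => q + 2 * y).
  by apply: measurable_funD; [exact: measurable_id|exact: measurable_cst].
apply: cmeasM; last exact: (cmeas_comp mg ms).
apply: cmeasM; first exact: cmeas_cst.
apply: cmeas_ofR; apply: measurableT_comp => //.
by apply: measurable_funM; [exact: measurable_cst|exact: ms].
Qed.

(** The quotient of G at [x - t] by G at [x + iy - t] is [exp (- y ^ 2 + 2iy(x - t))], a constant
    times a character in [x]; on the density side this is the translation by [2 * y].
    Cross-multiplied to avoid division. *)
Lemma bdk_hat y t g x : cmeas g -> cintegrable (fun s => ker (mkC x y) s * g s) ->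
  gaussC (mkC x y - ofR t) * hat (bdk y t g) (ofR x) = gaussC (ofR x - ofR t) * hat g (mkC x y).
Proof.
move=> mg ig.
pose cf := ofR (expR (- y ^+ 2)) * ker (ofR t) (2 * y) * ker (ofR x) (- (2 * y)).
have E : (fun q => ker (ofR x) q * bdk y t g q) = fun q => cf * (ker (mkC x y) (q + 2 * y) * g (q + 2 * y)).
  apply/funext => q; have -> : ker (mkC x y) (q + 2 * y) = ker (ofR x) (q + 2 * y) * ofR (expR (y * (q + 2 * y))).
    by rewrite /ker -cexp_ofR -cexpD; congr cexp; apply: eqC; rewrite !reimE; ring.
  have -> : ker (ofR x) q = ker (ofR x) (q + 2 * y) * ker (ofR x) (- (2 * y)) by rewrite -kerDs addrK.
  rewrite /bdk /cf; ring.
have mh : cmeas (fun s => cf * (ker (mkC x y) s * g s)).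
  by apply: cmeasM; [exact: cmeas_cst|exact: cmeas_kerM].
rewrite /hat E (cint_shift (2 * y) mh) (cintZ cf ig) mulrA; congr (_ * _).
rewrite /gaussC /cf /ker -cexp_ofR -!cexpD; congr cexp; apply: eqC; rewrite !reimE; ring.
Qed.

End Boundary.

(** * Comparison of the strip norm with the boundary norms *)

Section BoundaryNorms.
Context {R : realType}.
Notation mu := (@lebesgue_measure R).
Implicit Types (f F b : Cplx R -> Cplx R) (g h k : R -> Cplx R) (M N A B D e x y t s : R) (a z : Cplx R).

Lemma harmonic_scale y : y * (1 - harmonic n) @[n --> \oo] --> y.
Proof.
have h1 : (fun n => 1 - harmonic n) @ \oo --> (1 - 0 : R) by apply: cvgB; [exact: cvg_cst|exact: cvg_harmonic].
have h2 : (fun n => y * (1 - harmonic n)) @ \oo --> y * (1 - 0) by apply: cvgM => //; exact: cvg_cst.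
by move: h2; rewrite subr0 mulr1.
Qed.

Lemma harmonic_scale_lt y (n : nat) : 0 < `|y| -> `|y * (1 - harmonic n)| < `|y|.
Proof.
move=> y0; have h0 : 0 < harmonic n :> R by rewrite /harmonic/= invr_gt0.
have h1 : harmonic n <= 1 :> R by rewrite /harmonic/= invf_le1 ?ler1n.
by rewrite normrM (ger0_norm (x := 1 - _)) ?subr_ge0// gtr_pMr// gtrBl.
Qed.

Lemma mkC_cvg x y (u : nat -> R) : u n @[n --> \oo] --> y -> mkC x (u n) @[n --> \oo] --> mkC x y.
Proof. by move=> hu; apply/cvgC_reim; split; [exact: cvg_cst|exact: hu]. Qed.

Lemma at_left_seq (h : R -> Cplx R) (w : R) (l : Cplx R) : 0 < w -> h @ at_left w --> l ->
  h (w * (1 - harmonic n)) @[n --> \oo] --> l.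
Proof.
move=> w0 hl; have hs : (fun n => w * (1 - harmonic n)) @ \oo --> at_left w.
  move=> P hP; have := harmonic_scale hP; rewrite !nbhs_simpl /=; apply: filterS => n; apply.
  by rewrite gtr_pMr// gtrBl /harmonic/= invr_gt0.
exact: (cvg_comp _ _ hs hl).
Qed.

Lemma at_right_seq (h : R -> Cplx R) (w : R) (l : Cplx R) : 0 < w -> h @ at_right (- w) --> l ->
  h (- w * (1 - harmonic n)) @[n --> \oo] --> l.
Proof.
move=> w0 hl; have hs : (fun n => - w * (1 - harmonic n)) @ \oo --> at_right (- w).
  move=> P hP; have := harmonic_scale hP; rewrite !nbhs_simpl /=; apply: filterS => n; apply.
  by rewrite mulNr ltrN2 gtr_pMr// gtrBl /harmonic/= invr_gt0.
exact: (cvg_comp _ _ hs hl).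
Qed.

Variables (w : R) (v : R -> R).
Hypothesis w0 : 0 <= w.
Hypothesis sv : strongly_admissible v.

(** On a line inside the closed strip [expR (y * s) <= expR (w * |s|)], so the loss is only the
    constant for translating [v], independent of [t] and [f]. *)
Lemma bdk_rep y : `|y| <= w -> exists2 C : R, 0 < C & forall f F t g M,
  W2_rep w v (locG t f) g -> cont_ext w f F -> nW w v g <= M ->
  W2_rep 0 v (locG t (fun z => F (z + ofR y * iC))) (bdk y t g) /\ nW 0 v (bdk y t g) <= C * M.
Proof.
move=> yw; have [C C0 HC] := v_shift sv (- (2 * y)); exists C => // f F t g M rg cF gM.
have [Lg _] := (W2_repP w sv _ _).1 rg; have mg := Lg.1.
have mk := cmeas_bdk y t mg.
have pt q : (Wt 0 v q * cmod (bdk y t g q)) ^+ 2 <= C ^+ 2 * (Wt w v (q + 2 * y) * cmod (g (q + 2 * y))) ^+ 2.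
  have X0 : 0 <= Wt 0 v q * cmod (bdk y t g q) by rewrite mulr_ge0 ?cmod_ge0// ltW// Wt_gt0.
  have Y0 : 0 <= C * (Wt w v (q + 2 * y) * cmod (g (q + 2 * y))).
    by rewrite mulr_ge0 ?(ltW C0)// mulr_ge0 ?cmod_ge0// ltW// Wt_gt0.
  rewrite -exprMn ler_sqr ?nnegrE//.
  rewrite Wt0 cmod_bdk /Wt.
  have := HC (q + 2 * y); rewrite addrK => hv.
  have vq : 0 <= v q by rewrite ltW// (v_gt0 sv).
  have vs : 0 <= v (q + 2 * y) by rewrite ltW// (v_gt0 sv).
  have e1 : expR (- y ^+ 2) <= 1 by rewrite -expR0 ler_expR oppr_le0 sqr_ge0.
  have e2 : expR (y * (q + 2 * y)) <= expR (w * `|q + 2 * y|).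
    by rewrite ler_expR (le_trans (ler_norm _))// normrM ler_wpM2r.
  move: (cmod _) (cmod_ge0 (g (q + 2 * y))) hv e1 e2 => cg cg0 hv e1 e2.
  rewrite [leRHS](_ : _ = (C * v (q + 2 * y)) * (1 * (expR (w * `|q + 2 * y|) * cg))); last by ring.
  apply: ler_pM => //; first by apply: mulr_ge0; [exact: expR_ge0|rewrite mulr_ge0 ?expR_ge0].
  by apply: ler_pM; rewrite ?expR_ge0 ?mulr_ge0 ?expR_ge0// ler_wpM2r.
have le M' : nW w v g <= M' -> (nsq 0 v (bdk y t g) <= ((C * M') ^+ 2)%:E)%E.
  move=> gM'; have M'0 := le_trans (nW_ge0 w v g) gM'.
  have mh : measurable_fun setT (fun q : R => ((Wt w v (q + 2 * y) * cmod (g (q + 2 * y))) ^+ 2)%:E).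
    apply/measurable_EFinP; apply: (measurableT_comp (mnsq w sv mg)).
    by apply: measurable_funD; [exact: measurable_id|exact: measurable_cst].
  apply: (@le_trans _ _ (\int[mu]_q ((C ^+ 2)%:E * ((Wt w v (q + 2 * y) * cmod (g (q + 2 * y))) ^+ 2)%:E))%E).
    apply: ge0_le_integral; first exact: measurableT.
    - by move=> s _; rewrite lee_fin sqr_ge0.
    - by apply/measurable_EFinP; exact: mnsq.
    - by apply: emeasurable_funM; [exact: measurable_cst|exact: mh].
    - by move=> s _; rewrite -EFinM lee_fin; exact: pt.
  rewrite ge0_integralZl_EFin//; last 2 first.
  - by move=> s _; rewrite lee_fin sqr_ge0.
  - exact: sqr_ge0.
  rewrite (nsq_shift sv w (2 * y) mg) (nW_sq Lg).
  have -> : ((C * M') ^+ 2)%:E = ((C ^+ 2)%:E * (M' ^+ 2)%:E)%E by rewrite exprMn EFinM.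
  apply: lee_wpmul2l; first by rewrite lee_fin sqr_ge0.
  by rewrite lee_fin ler_sqr ?nnegrE ?nW_ge0.
have Lk : L2W 0 v (bdk y t g) by split => //; exact: le_lt_trans (le _ (lexx _)) (ltry _).
split; last by apply: nW_le; [rewrite mulr_ge0 ?(ltW C0)// (le_trans (nW_ge0 w v g))|exact: le].
apply/(W2_repP 0 sv); split; first exact: Lk.
move=> z sz; have z0 : imC z = 0.
  by have := strip_le (lexx 0) sz; rewrite normr_le0 => /eqP.
have -> : z = ofR (reC z) by apply: eqC; rewrite ?z0.
move: (reC z) => x.
have E : ofR x + ofR y * iC = mkC x y by apply: eqC; rewrite !reimE; ring.
have yz : cl_strip w (mkC x y) by exact: yw.
have h1 := cont_ext_rep w0 sv rg cF yz.
have h2 := bdk_hat t mg (hat_integrable sv yz Lg).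
apply: (mulfI (gaussC_neq0 (mkC x y - ofR t))); rewrite h2 -h1 /locG E; ring.
Qed.

Lemma boundary_Horb y : `|y| <= w -> exists2 C : R, 0 < C & forall f F M,
  Horb w v f M -> cont_ext w f F -> Horb 0 v (fun z => F (z + ofR y * iC)) (C * M).
Proof.
move=> yw; have [C C0 HC] := bdk_rep yw; exists C => // f F M hf cF t.
have [g rg gM] := hf t; have [r n] := HC f F t g M rg cF gM.
by exists (bdk y t g).
Qed.

(** Membership supplies a density [g], which is then measured again from the boundary, so the
    constant does not involve [M]. The choice [D = expR (w ^+ 2)] undoes the factor
    [expR (- y ^+ 2)] in [bdk]. *)
Lemma Horb_of_boundary : exists2 C : R, 0 < C & forall f F M A B,
  Horb w v f M -> cont_ext w f F -> Horb 0 v (fun z => F (z + ofR w * iC)) A ->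
  Horb 0 v (fun z => F (z + ofR (- w) * iC)) B -> Horb w v f (C * (A + B)).
Proof.
have D0 : 0 < expR (w ^+ 2) :> R by exact: expR_gt0.
have [C C0 HC] := two_sided sv w0 D0; exists C => // f F M A B hf cF h1 h2 t.
have [g rg gM] := hf t; exists g => //.
have mg : cmeas g by have [[]] := (W2_repP w sv _ _).1 rg.
(* By uniqueness almost everywhere, [bdk y t g] is the density of the localized boundary function,
   so it inherits the boundary bound [A']. *)
have key y A' : `|y| <= w -> Horb 0 v (fun z => F (z + ofR y * iC)) A' ->
    cmeas (bdk y t g) /\ (nsq 0 v (bdk y t g) <= (A' ^+ 2)%:E)%E.
  move=> yw hy; have [C' _ HC'] := bdk_rep yw.
  have [rk _] := HC' f F t g M rg cF gM; have mk := cmeas_bdk y t mg; split => //.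
  have A'0 := Horb_ge0 hy.
  have [/(W2_repP 0 sv)[L _] n] := Horb_rep (lexx 0) sv t hy.
  have ae := rep_ae (lexx 0) sv rk (Horb_integrable (lexx 0) sv t hy).
  by rewrite -(nsq_ae 0 sv L.1 mk ae) (nW_sq L) lee_fin ler_sqr ?nnegrE ?nW_ge0.
have w1 : `|w| <= w by rewrite ger0_norm.
have w2 : `|- w| <= w by rewrite normrN ger0_norm.
have [m1 n1] := key _ _ w1 h1; have [m2 n2] := key _ _ w2 h2.
have ee s y : expR (y ^+ 2) * (expR (- y ^+ 2) * s) = s by rewrite mulrA -expRD subrr expR0 mul1r.
apply: (HC g (bdk w t g) (bdk (- w) t g) A B mg m1 m2 (Horb_ge0 h1) (Horb_ge0 h2) n1 n2 _ _).2 => s.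
  by rewrite cmod_bdk subrK ee.
by rewrite cmod_bdk mulrN addrK sqrrN ee mulNr; exact: lexx.
Qed.

(** Contour shift to the heights [y * (1 - 1/(n+1))], then dominated convergence towards the almost
    everywhere boundary values. It replaces [bdk_hat] where neither a continuous extension nor a
    weighted bound on the density is available. *)
Lemma bdry_phase y f b M t s B : 0 < w -> `|y| = w -> holo_on (strip w) f ->
  (forall z, strip w z -> cmod (f z) <= B) -> Horb 0 v b M ->
  {ae mu, forall x, f (mkC x (y * (1 - harmonic n))) @[n --> \oo] --> b (ofR x)} ->
  expR (y * s) * cmod (invFT (locG t f) s) = expR (y ^+ 2) * cmod (invFT (locG t b) (s - 2 * y)).
Proof.
move=> wp yw hol bf hb cv.
have st x y' : `|y'| < w -> strip w (mkC x y') by left.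
have dH x y' : `|y'| < w -> derivable (locG t f) (mkC x y') 1.
  move=> y'w; apply: derivableM; first exact: derivable_gauss_shift.
  by apply: hol; exact: st.
have bH x y' : `|y'| < w -> cmod (locG t f (mkC x y')) <= B * expR (w ^+ 2) * cauchyK (x - t).
  move=> y'w; rewrite /locG (cmodM (gaussC _)) cmod_gaussC !reimE subr0 expRD mulrC -[leRHS]mulrA.
  apply: ler_pM; rewrite ?cmod_ge0 ?mulr_ge0 ?expR_ge0//; first by apply: bf; exact: st.
  apply: ler_pM; rewrite ?expR_ge0//; last exact: expRN_sqr_le_cauchyK.
  by rewrite ler_expR -(real_normK (num_real y')) ler_sqr ?nnegrE ?(ltW y'w).
have yp : 0 < `|y| by rewrite yw.
pose yn n := y * (1 - harmonic n).
have ynw n : `|yn n| < w by rewrite -yw; exact: harmonic_scale_lt.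
have ynE n := phase_int_shift (lexx 0) wp dH bH s (ynw n).
have mb := Horb_cmeas (lexx 0) sv hb.
pose G x := gaussC (mkC x y - ofR t) * b (ofR x) * cexp (iC * ofR x * ofR s).
have mG : cmeas G.
  apply: cmeasM; last exact: cmeas_phase.
  apply: cmeasM; last exact: mb.
  apply: cmeas_gaussC; apply: cmeasB; last exact: cmeas_cst.
  by split; [exact: measurable_id|exact: (measurable_cst y)].
have lim1 : cint (fun x => locG t f (mkC x (yn n)) * cexp (iC * ofR x * ofR s)) @[n --> \oo] --> cint G.
  apply: (@cint_dct_ae _ _ _ (fun x => B * expR (w ^+ 2) * cauchyK (x - t)) _ mG).
  - by move=> n; apply: cmeasM; [exact: (cmeas_line dH (ynw n))|exact: cmeas_phase].
  - apply: ae_imp cv => x cx; apply: cvgM; last exact: cvg_cst.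
    apply: cvgM; last exact: cx.
    by apply: gauss_seq; apply: mkC_cvg; exact: harmonic_scale.
  - by move=> n x; rewrite (cmodM (locG _ _ _)) cmod_phase mulr1; exact: bH.
  - exact: integrable_cauchyK_shift.
have lim2 : ofR (expR (- (yn n * s))) @[n --> \oo] --> ofR (expR (- (y * s))).
  apply/cvgC_reim; split; last exact: cvg_cst.
  have c1 : yn n * s @[n --> \oo] --> y * s by apply: cvgM; [exact: harmonic_scale|exact: cvg_cst].
  by apply: (cvg_comp _ _ (cvgN c1)); exact: continuous_expR.
have E1 : cint (fun x => locG t f (mkC x 0) * cexp (iC * ofR x * ofR s)) = cint G * ofR (expR (- (y * s))).
  set X0 := cint (fun x => _); apply: (@cvgC_unique _ (fun=> X0)); first exact: cvg_cst.
  suff -> : (fun=> X0) = (fun n => cint (fun x => locG t f (mkC x (yn n)) * cexp (iC * ofR x * ofR s)) *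
    ofR (expR (- (yn n * s)))) by exact: cvgM lim1 lim2.
  by apply/funext => n; exact: ynE.
have iH : cintegrable (fun x => locG t f (ofR x)).
  by apply: (Phi_line_integrable dH bH (y := 0)); rewrite normr0.
have ib := Horb_integrable (lexx 0) sv t hb.
(* A unimodular constant times [expR (y ^+ 2)]; only its modulus enters the conclusion. *)
pose cf := ofR (expR (y ^+ 2)) * cexp (iC * ofR t * ofR (2 * y)).
have GE : G = fun x => cf * (locG t b (ofR x) * cexp (iC * ofR x * ofR (s - 2 * y))).
  apply/funext => x.
  have e1 : gaussC (mkC x y - ofR t) * cexp (iC * ofR x * ofR s) =
      cf * (gaussC (ofR x - ofR t) * cexp (iC * ofR x * ofR (s - 2 * y))).
    by rewrite /gaussC /cf -cexp_ofR -!cexpD; congr cexp; apply: eqC; rewrite !reimE; ring.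
  by rewrite /G /locG mulrAC e1; ring.
have ibp : cintegrable (fun x => locG t b (ofR x) * cexp (iC * ofR x * ofR (s - 2 * y))).
  have [m n] := (cintegrableP _).1 ib.
  apply: (cintegrable_le _ _ n); first by apply: cmeasM => //; exact: cmeas_phase.
  by move=> x; rewrite (cmodM (locG _ _ _)) cmod_phase mulr1.
have cfm : cmod cf = expR (y ^+ 2) by rewrite /cf (cmodM (ofR _)) cmod_phase mulr1 cmod_ofR ger0_norm ?expR_ge0.
rewrite (invFT_E _ iH) (invFT_E _ ib) [cint _](E1) GE (cintZ cf ibp).
move: (cint _) => c; rewrite (cmodM (_^-1)) (cmodM (cf * c)) (cmodM cf) cfm (cmodM (_^-1) c) cmod_ofR ger0_norm ?expR_ge0//.
have e0 : expR (y * s) * expR (- (y * s)) = 1 by rewrite -expRD subrr expR0.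
rewrite (_ : _ * (_ * _) = expR (y * s) * expR (- (y * s)) * (expR (y ^+ 2) * (cmod (ofR (2 * pi))^-1 * cmod c))); last by ring.
by rewrite e0 mul1r.
Qed.

(** The candidate density is the inverse transform of the localization on the real line; its
    weighted bound is read off the two boundary identities. *)
Lemma Horb_of_boundary_limits : 0 < w -> exists2 C : R, 0 < C & forall f b1 b2 A B,
  Hinf w f -> Horb 0 v b1 A -> Horb 0 v b2 B ->
  {ae mu, forall x, (fun y : R => f (mkC x y)) @ at_left w --> b1 (ofR x)} ->
  {ae mu, forall x, (fun y : R => f (mkC x y)) @ at_right (- w) --> b2 (ofR x)} ->
  Horb w v f (C * (A + B)).
Proof.
move=> wp; have D0 : 0 < expR (w ^+ 2) :> R by exact: expR_gt0.
have [C C0 HC] := two_sided sv w0 D0; exists C => // f b1 b2 A B [hol [B0 bf]] h1 h2 a1 a2 t.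
pose V := invFT (locG t f).
have st x y' : `|y'| < w -> strip w (mkC x y') by left.
have dH x y' : `|y'| < w -> derivable (locG t f) (mkC x y') 1.
  move=> y'w; apply: derivableM; first exact: derivable_gauss_shift.
  by apply: hol; exact: st.
have B00 : 0 <= B0 by apply: le_trans (cmod_ge0 _) (bf 0 _); left; rewrite (_ : imC 0 = 0)// normr0.
have bH x y' : `|y'| < w -> cmod (locG t f (mkC x y')) <= B0 * expR (w ^+ 2) * cauchyK (x - t).
  move=> y'w; rewrite /locG (cmodM (gaussC _)) cmod_gaussC !reimE subr0 expRD mulrC -[leRHS]mulrA.
  apply: ler_pM; rewrite ?cmod_ge0 ?mulr_ge0 ?expR_ge0//; first by apply: bf; exact: st.
  apply: ler_pM; rewrite ?expR_ge0//; last exact: expRN_sqr_le_cauchyK.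
  by rewrite ler_expR -(real_normK (num_real y')) ler_sqr ?nnegrE ?(ltW y'w).
have A0 : 0 <= B0 * expR (w ^+ 2) by rewrite mulr_ge0 ?expR_ge0.
(* Holomorphy gives no margin beyond [w], so [holo_kernel] is used for each [z] with inner width
   [|imC z|] and outer width [w]. This identifies the transform, while the bound in the weight [w]
   comes from [two_sided]. *)
have hV z : `|imC z| < w -> cmeas V /\ hat V z = locG t f z.
  move=> zw; have [C' _ HC'] := holo_kernel (normr_ge0 (imC z)) zw sv.
  have [m _ H] := HC' _ _ t A0 dH bH; split => //; exact: (H z (lexx _)).2.
have mV : cmeas V by apply: (hV 0 _).1; rewrite (_ : imC 0 = 0)// normr0.
have w1 : `|w| = w by rewrite gtr0_norm.
have w2 : `|- w| = w by rewrite normrN gtr0_norm.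
have c1 : {ae mu, forall x, f (mkC x (w * (1 - harmonic n))) @[n --> \oo] --> b1 (ofR x)}.
  by apply: ae_imp a1 => x hx; exact: (at_left_seq wp hx).
have c2 : {ae mu, forall x, f (mkC x (- w * (1 - harmonic n))) @[n --> \oo] --> b2 (ofR x)}.
  by apply: ae_imp a2 => x hx; exact: (at_right_seq wp hx).
have k1 s := bdry_phase t s wp w1 hol bf h1 c1.
have k2 s := bdry_phase t s wp w2 hol bf h2 c2.
have [/(W2_repP 0 sv)[L1 _] n1] := Horb_rep (lexx 0) sv t h1.
have [/(W2_repP 0 sv)[L2 _] n2] := Horb_rep (lexx 0) sv t h2.
have q1 : (nsq 0 v (invFT (locG t b1)) <= (A ^+ 2)%:E)%E.
  by rewrite (nW_sq L1) lee_fin ler_sqr ?nnegrE ?nW_ge0 ?(Horb_ge0 h1).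
have q2 : (nsq 0 v (invFT (locG t b2)) <= (B ^+ 2)%:E)%E.
  by rewrite (nW_sq L2) lee_fin ler_sqr ?nnegrE ?nW_ge0 ?(Horb_ge0 h2).
have e1 s : expR (w * s) * cmod (V s) <= expR (w ^+ 2) * cmod (invFT (locG t b1) (s - 2 * w)) by rewrite k1.
have e2 s : expR (- (w * s)) * cmod (V s) <= expR (w ^+ 2) * cmod (invFT (locG t b2) (s + 2 * w)).
  by have := k2 s; rewrite mulNr sqrrN mulrN opprK => ->.
have [LV nV] := HC V _ _ A B mV L1.1 L2.1 (Horb_ge0 h1) (Horb_ge0 h2) q1 q2 e1 e2.
exists V => //; apply/(W2_repP w sv); split => // z [zw|[/eqP]]; last by rewrite gt_eqF.
by rewrite (hV z zw).2.
Qed.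

End BoundaryNorms.

(** * Passage from bounds to norms *)

Section MainParts.
Context {R : realType}.
Variables (w : R) (v : R -> R).
Hypothesis w0 : 0 <= w.
Hypothesis sv : strongly_admissible v.
Local Notation C := (Cplx R).

Lemma inHorB (f g : C -> C) : inHor w v f -> inHor w v g -> inHor w v (fun z => f z - g z).
Proof.
move=> hf hg; have [h _] := inHorD w0 sv hf (inHorZ w0 sv (- 1) hg).1.
by move: h; congr inHor; apply/funext => z; rewrite mulN1r.
Qed.

Lemma normHor_complete (u : nat -> C -> C) : (forall n, inHor w v (u n)) ->
  (forall e : R, 0 < e -> exists N : nat, forall m n : nat, (N <= m)%N -> (N <= n)%N ->
     normHor w v (fun z => u n z - u m z) < e) ->
  exists f, inHor w v f /\ (fun n => normHor w v (fun z => u n z - f z)) @ \oo --> (0 : R).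
Proof.
move=> hu hC; have [|e e0|f hf] := Horb_complete w0 sv (u := u).
- by move=> n; exists (normHor w v (u n) + 1); exact: inHor_Horb_add.
- have [N0 hN] := hC e e0; exists N0 => m n Nm Nn.
  by apply: inHor_Horb => //; [exact: inHorB|exact: hN].
exists f; split.
  have [N0 hN] := hf 1 ltr01.
  (* The limit lies in the space as the difference of [u N0] and [u N0 - f]. *)
  have h := inHorB (hu N0) (Horb_normHor sv (hN N0 (leqnn _))).1.
  by move: h; congr inHor; apply/funext => z; rewrite opprB addrC subrK.
apply/cvgrPdist_lt => e e0; have e2 : 0 < e / 2 by rewrite divr_gt0.
have [N0 hN] := hf _ e2; exists N0 => // n Nn /=.
have [i le] := Horb_normHor sv (hN n Nn).
rewrite sub0r normrN ger0_norm ?(normHor_ge0 i)//; apply: le_lt_trans le _.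
by rewrite ltr_pdivrMr// ltr_pMr// ltr1n.
Qed.

Lemma boundary_inHor (y : R) : `|y| <= w -> exists2 c : R, 0 < c & forall f F : C -> C,
  inHor w v f -> cont_ext w f F -> inHor 0 v (fun z => F (z + ofR y * iC)) /\
  normHor 0 v (fun z => F (z + ofR y * iC)) <= c * normHor w v f.
Proof.
move=> yw; have [c c0 Hc] := boundary_Horb w0 sv yw; exists c; first exact: c0.
move=> f F hf cF.
have H e : 0 < e -> Horb 0 v (fun z => F (z + ofR y * iC)) (c * normHor w v f + e).
  move=> e0; have e1 : 0 < e / c by rewrite divr_gt0.
  have := Hc f F _ (inHor_Horb_add sv hf e1) cF.
  by rewrite mulrDr (mulrC c (e / c)) divfK ?gt_eqF.
have i := (Horb_normHor sv (H 1 ltr01)).1; split => //; exact: normHor_le.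
Qed.

Lemma normHor_le_boundary : exists2 c : R, 0 < c & forall f F : C -> C, inHor w v f -> cont_ext w f F ->
  normHor w v f <= c * (normHor 0 v (fun z => F (z + ofR w * iC)) +
                        normHor 0 v (fun z => F (z + ofR (- w) * iC))).
Proof.
have [c c0 Hc] := Horb_of_boundary w0 sv; exists c; first exact: c0.
move=> f F hf cF.
have w1 : `|w| <= w by rewrite ger0_norm.
have w2 : `|- w| <= w by rewrite normrN ger0_norm.
have [_ _ /(_ f F hf cF)[i1 _]] := boundary_inHor w1.
have [_ _ /(_ f F hf cF)[i2 _]] := boundary_inHor w2.
(* The slack [e / c / 2] on each boundary norm adds up to [e] after multiplication by [c]. *)
apply: normHor_le => // e e0; have e1 : 0 < e / c / 2 by rewrite !divr_gt0.
have := Hc f F _ _ _ (inHor_Horb_add sv hf ltr01) cF (inHor_Horb_add sv i1 e1) (inHor_Horb_add sv i2 e1).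
set p := normHor 0 v _; set q := normHor 0 v _.
by have -> : c * (p + e / c / 2 + (q + e / c / 2)) = c * (p + q) + e by field; rewrite gt_eqF.
Qed.

Lemma shift_minus (F : C -> C) : (fun z => F (z + ofR (- w) * iC)) = (fun z => F (z - ofR w * iC)).
Proof. by apply/funext => z; rewrite ofRN mulNr. Qed.

Lemma normHor_boundary_equiv : exists c1 c2 : R, 0 < c1 /\ 0 < c2 /\
  forall f F : C -> C, inHor w v f -> cont_ext w f F ->
    c1 * (normHor 0 v (fun z => F (z + ofR w * iC)) +
          normHor 0 v (fun z => F (z - ofR w * iC))) <= normHor w v f /\
    normHor w v f <= c2 * (normHor 0 v (fun z => F (z + ofR w * iC)) +
          normHor 0 v (fun z => F (z - ofR w * iC))).
Proof.
have w1 : `|w| <= w by rewrite ger0_norm.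
have w2 : `|- w| <= w by rewrite normrN ger0_norm.
have [a a0 Ha] := boundary_inHor w1; have [b b0 Hb] := boundary_inHor w2.
have [c c0 Hc] := normHor_le_boundary.
have ab : 0 < a + b by exact: addr_gt0.
(* Each boundary norm is at most [a] or [b] times the strip norm, so their sum is at most [a + b]
   times it. *)
exists (a + b)^-1, c; split; first by rewrite invr_gt0.
split; first exact: c0.
move=> f F hf cF; have := Hc f F hf cF; have [_ ha] := Ha f F hf cF; have [_ hb] := Hb f F hf cF.
move: hb; rewrite shift_minus => hb hc; split; last exact: hc.
rewrite (ler_pdivrMl _ _ ab) mulrDl; apply: lerD; [exact: ha|exact: hb].
Qed.

Lemma boundary_limits_inHor : 0 < w -> forall f b1 b2 : C -> C, Hinf w f ->
  inHor 0 v b1 -> inHor 0 v b2 ->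
  {ae @lebesgue_measure R, forall x : R, (fun y : R => f (mkC x y)) @ at_left w --> b1 (ofR x)} ->
  {ae @lebesgue_measure R, forall x : R, (fun y : R => f (mkC x y)) @ at_right (- w) --> b2 (ofR x)} ->
  inHor w v f.
Proof.
move=> wp f b1 b2 hf h1 h2 c1 c2; have [c _ Hc] := Horb_of_boundary_limits w0 sv wp.
have H := Hc f b1 b2 _ _ hf (inHor_Horb_add sv h1 ltr01) (inHor_Horb_add sv h2 ltr01) c1 c2.
exact: (Horb_normHor sv H).1.
Qed.

End MainParts.

Unset Implicit Arguments.

Theorem theorem5p6 (R : realType) (w : R) (v : R -> R) :
  0 <= w -> strongly_admissible v ->
  (* (a) continuous embedding into UC_b(closure S_w) *)
  (exists K : R, 0 < K /\
     forall f : Cplx R -> Cplx R, inHor w v f ->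
       exists F : Cplx R -> Cplx R, cont_ext w f F /\ UCb_on (cl_strip w) F /\
         forall z, cl_strip w z -> cmod (F z) <= K * normHor w v f) /\
  (* (b) boundary values *)
  (0 < w ->
     (forall f F : Cplx R -> Cplx R, inHor w v f -> cont_ext w f F ->
        inHor 0 v (fun z => F (z + ofR w * iC)) /\
        inHor 0 v (fun z => F (z - ofR w * iC))) /\
     (forall (f b1 b2 : Cplx R -> Cplx R), Hinf w f ->
        inHor 0 v b1 -> inHor 0 v b2 ->
        {ae @lebesgue_measure R, forall x : R,
            (fun y : R => f (mkC x y)) @ at_left w --> b1 (ofR x)} ->
        {ae @lebesgue_measure R, forall x : R,
            (fun y : R => f (mkC x y)) @ at_right (- w) --> b2 (ofR x)} ->
        inHor w v f) /\
     (exists c1 c2 : R, 0 < c1 /\ 0 < c2 /\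
        forall f F : Cplx R -> Cplx R, inHor w v f -> cont_ext w f F ->
          c1 * (normHor 0 v (fun z => F (z + ofR w * iC)) +
                normHor 0 v (fun z => F (z - ofR w * iC))) <= normHor w v f /\
          normHor w v f <= c2 * (normHor 0 v (fun z => F (z + ofR w * iC)) +
                normHor 0 v (fun z => F (z - ofR w * iC))))) /\
  (* (c) Banach algebra (after scaling the norm by K) *)
  ((forall f g : Cplx R -> Cplx R, inHor w v f -> inHor w v g ->
      inHor w v (fun z => f z + g z) /\
      normHor w v (fun z => f z + g z) <= normHor w v f + normHor w v g) /\
   (forall (a : Cplx R) (f : Cplx R -> Cplx R), inHor w v f ->
      inHor w v (fun z => a * f z) /\
      normHor w v (fun z => a * f z) = cmod a * normHor w v f) /\
   (forall f : Cplx R -> Cplx R, inHor w v f -> normHor w v f = 0 ->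
      forall z, strip w z -> f z = 0) /\
   (forall u : nat -> Cplx R -> Cplx R, (forall n, inHor w v (u n)) ->
      (forall e : R, 0 < e -> exists N : nat, forall m n : nat, (N <= m)%N -> (N <= n)%N ->
         normHor w v (fun z => u n z - u m z) < e) ->
      exists f, inHor w v f /\
        (fun n => normHor w v (fun z => u n z - f z)) @ \oo --> (0 : R)) /\
   (exists K : R, 0 < K /\
      forall f g : Cplx R -> Cplx R, inHor w v f -> inHor w v g ->
        inHor w v (fun z => f z * g z) /\
        normHor w v (fun z => f z * g z) <= K * normHor w v f * normHor w v g)) /\
  (* (d) reproducing formula *)
  (forall (th : R) (phi : Cplx R -> Cplx R), 0 < th -> Hinf0 (th + w) phi ->
     forall f F : Cplx R -> Cplx R, inHor w v f -> cont_ext w f F ->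
       forall z : Cplx R, strip th z -> cl_strip w z ->
         cintegrable (fun s => invFT (fun u => phi (u - z) * f u) s
                                * cexp (- (iC * ofR s * z))) /\
         phi 0 * F z = cint (fun s => invFT (fun u => phi (u - z) * f u) s
                                       * cexp (- (iC * ofR s * z)))).
Proof.
move=> w0 sv; split; first exact: embed_UCb.
split.
  move=> wp; split=> [f F hf cF|].
    have w1 : `|w| <= w by rewrite ger0_norm.
    have w2 : `|- w| <= w by rewrite normrN ger0_norm.
    have [c1 _ H1] := boundary_inHor w0 sv w1; have [c2 _ H2] := boundary_inHor w0 sv w2.
    by split; [exact: (H1 f F hf cF).1|have := (H2 f F hf cF).1; rewrite shift_minus].
  split; [exact: boundary_limits_inHor|exact: normHor_boundary_equiv].
split; last exact: reproducing.
split; first by move=> f g; exact: inHorD.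
split; first by move=> a f; exact: inHorZ.
split; first by move=> f; exact: normHor_eq0.
split; first by move=> u; exact: normHor_complete.
exact: inHorM.
Qed.
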